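(* Let $\ell\in\mathbb N$ and, for $1\le k\le\ell$, let $\mathbf Z_k=\mathbf X_k\sqcup\mathbf Y_k$, where $\mathbf X_k=(X_{k,1},\ldots,X_{k,n_k})$ and $\mathbf Y_k=(Y_{k,1},\ldots,Y_{k,m_k})$ are tuples of self-adjoint operators ($n_k,m_k\ge0$, $n_k+m_k\ge1$) in a C$^*$-non-commutative probability space $(\mathcal A,\varphi)$. Suppose that $\chi(\mathbf Z_k)>-\infty$ for all $1\le k\le\ell$ and that \[ \Big(\bigcup_{k=1}^\ell\{X_{k,i}\}_{i=1}^{n_k},\ \bigcup_{k=1}^\ell\{Y_{k,j}\}_{j=1}^{m_k}\Big) \] is a tracially bi-partite system. If \[ \chi(\mathbf X_1,\ldots,\mathbf X_\ell\sqcup\mathbf Y_1,\ldots,\mathbf Y_\ell)=\sum_{k=1}^\ell\chi(\mathbf Z_k), \] then $\mathbf Z_1,\ldots,\mathbf Z_\ell$ are bi-free with respect to $\varphi$.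
   Context: A C$^*$-non-commutative probability space $(\mathcal A,\varphi)$ is a unital C$^*$-algebra with a state $\varphi$. A tracially bi-partite system $(\{X_i\}_{i=1}^n,\{Y_j\}_{j=1}^m)$ in $(\mathcal A,\varphi)$ consists of self-adjoint operators $X_1,\ldots,X_n$ (left variables) and $Y_1,\ldots,Y_m$ (right variables) in $\mathcal A$ such that every $X_i$ commutes with every $Y_j$ (in distribution: interchanging adjacent $X_i,Y_j$ in a word does not change $\varphi$ of the word) and $\varphi$ is tracial on the unital algebra generated by the $X_i$ and on the unital algebra generated by the $Y_j$; $\varphi$ is not assumed tracial or faithful on $\mathcal A$. Microstate bi-free entropy. $\mathcal M_d$ is the algebra of complex $d\times d$ matrices, $\mathcal M_d^{sa}$ its self-adjoint part, $\mathrm{Tr}_d$ the trace, $\tau_d=\frac1d\mathrm{Tr}_d$, $\|\cdot\|$ the operator norm, and $\lambda_{d,p}$ is Lebesgue measure on $(\mathcal M_d^{sa})^p$ normalized by the inner product $\langle (A_i),(B_i)\rangle=\sum_i\mathrm{Tr}_d(A_iB_i)$. For $M,d\in\mathbb N$ and $R,\epsilon>0$, $\Gamma_R(X_1,\ldots,X_n\sqcup Y_1,\ldots,Y_m;M,d,\epsilon)$ is the set of $(A_1,\ldots,A_n,B_1,\ldots,B_m)\in(\mathcal M_d^{sa})^{n+m}$ with $\|A_i\|,\|B_j\|\le R$ for all $i,j$ and \[ |\varphi(X_{i_1}\cdots X_{i_p}Y_{j_1}\cdots Y_{j_q})-\tau_d(A_{i_1}\cdots A_{i_p}B_{j_q}\cdots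 B_{j_1})|<\epsilon \] for all $p,q\ge0$ with $1\le p+q\le M$ and all indices. Define (with $\log 0=-\infty$) $\chi_R(\cdot;M,d,\epsilon)=\log\lambda_{d,n+m}(\Gamma_R(\cdot;M,d,\epsilon))$, $\chi_R(\cdot;M,\epsilon)=\limsup_{d\to\infty}\big(\frac1{d^2}\chi_R(\cdot;M,d,\epsilon)+\frac{n+m}2\log d\big)$, $\chi_R(\cdot)=\inf_{M\in\mathbb N,\epsilon>0}\chi_R(\cdot;M,\epsilon)$, and $\chi(X_1,\ldots,X_n\sqcup Y_1,\ldots,Y_m)=\sup_{R>0}\chi_R(X_1,\ldots,X_n\sqcup Y_1,\ldots,Y_m)\in[-\infty,\infty)$. For the joint family, the left variables are those in $\mathbf X_1,\ldots,\mathbf X_\ell$ and the right variables those in $\mathbf Y_1,\ldots,\mathbf Y_\ell$, in the order listed; $\chi(\mathbf Z_k)=\chi(\mathbf X_k\sqcup\mathbf Y_k)$. Bi-freeness. Given vector spaces with specified state vectors $(\mathcal X_k,\mathcal X_k^\circ,\xi_k)$, $\mathcal X_k=\mathbb C\xi_k\oplus\mathcal X_k^\circ$, their free product is $\mathcal X=\mathbb C\xi\oplus\bigoplus_{r\ge1}\bigoplus_{k_1\ne k_2\ne\cdots\ne k_r}\mathcal X_{k_1}^\circ\otimes\cdots\otimes\mathcal X_{k_r}^\circ$. Let $\mathcal X(\ell,k)$ (resp. $\mathcal X(r,k)$) be the span of $\xi$ and the summands with first index (resp. last index) $\neq k$. Using the canonical isomorphisms $V_k:\mathcal X_k\otimes\mathcal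 X(\ell,k)\to\mathcal X$ and $W_k:\mathcal X(r,k)\otimes\mathcal X_k\to\mathcal X$, put $\lambda_k(T)=V_k(T\otimes I)V_k^{-1}$ and $\rho_k(T)=W_k(I\otimes T)W_k^{-1}$ for linear maps $T$ on $\mathcal X_k$. Pairs $(C_k,D_k)_{k\in K}$ of unital subalgebras of $\mathcal A$ are bi-free with respect to $\varphi$ if there exist such $\mathcal X_k$ and unital homomorphisms $l_k:C_k\to L(\mathcal X_k)$, $r_k:D_k\to L(\mathcal X_k)$ such that for every word $z_1\cdots z_N$ in elements of the $C_k$'s and $D_k$'s, $\varphi(z_1\cdots z_N)$ equals the $\xi$-coefficient of $T_1\cdots T_N\xi$, where $T_i=\lambda_k(l_k(z_i))$ if $z_i$ is taken from $C_k$ and $T_i=\rho_k(r_k(z_i))$ if $z_i$ is taken from $D_k$. The families $\mathbf Z_1,\ldots,\mathbf Z_\ell$ are bi-free if the pairs $(\mathrm{alg}(\mathbf X_k),\mathrm{alg}(\mathbf Y_k))$ of generated unital algebras are. *)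

(* Defs.v *)
From HB Require Import structures.
From mathcomp Require Import all_boot all_order all_algebra.
From mathcomp Require Import finmap.
From mathcomp Require Import all_classical all_reals all_analysis.
From mathcomp Require Import complex ring.
From mathcomp Require monalg.
Import (canonicals) monalg.
Set Implicit Arguments.
Unset Strict Implicit.
Unset Printing Implicit Defensive.
Import Order.TTheory GRing.Theory Num.Theory.
Local Open Scope classical_set_scope.
Local Open Scope ring_scope.
Local Open Scope complex_scope.
Local Open Scope quotient_scope.

Notation normc := ComplexField.Normc.normc.

(* Free product of the spaces X_k = F xi_k (+) V k, where V k plays the role of
   X_k^o.  The summand V k_1 (x) ... (x) V k_r is the free module on words of
   letters (k_i, x_i), x_i in V k_i, modulo linearity in each letter; taking all
   alternating words at once gives the direct sum over k_1 <> ... <> k_r, the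
   empty word contributing F xi. *)
Section FreeProduct.
Context (F : fieldType) (K : choiceType) (V : K -> lmodType F).

(* The state vector is xi_k = (1, 0). *)
Definition sv_space (k : K) : lmodType F := (F^o * V k)%type.

Definition letter : choiceType := {k : K & V k}.
Definition alternating (s : seq letter) : bool :=
  sorted (fun a b => tag a != tag b) s.
Definition altword : choiceType := {s : seq letter | alternating s}.
Definition formal : lmodType F := monalg.malg altword F.

Definition empty_word : altword := exist _ [::] isT.

(* The formal simple tensor of an alternating word; the value 0 on other words
   makes the relations below trivial there. *)
Definition simple (s : seq letter) : formal :=
  if insub s is Some w then monalg.mkmalgU w 1 else 0.

Inductive tensor_rel : formal -> Prop :=
| tensor_rel0 : tensor_rel 0
| tensor_relD f g : tensor_rel f -> tensor_rel g -> tensor_rel (f + g)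
| tensor_relZ (a : F) f : tensor_rel f -> tensor_rel (a *: f)
| tensor_rel_linear (s t : seq letter) (k : K) (a : F) (x y : V k) :
    tensor_rel (simple (s ++ Tagged V (a *: x + y) :: t)
                - (a *: simple (s ++ Tagged V x :: t)
                   + simple (s ++ Tagged V y :: t))).

Definition tensor_pred (f : formal) : bool := `[< tensor_rel f >].

Fact tensor_pred_zmod_closed : zmod_closed tensor_pred.
Proof.
split; first exact/asboolP/tensor_rel0.
move=> f g /asboolP rf /asboolP rg; apply/asboolP.
by rewrite -scaleN1r; apply: tensor_relD => //; apply: tensor_relZ.
Qed.
HB.instance Definition _ :=
  GRing.isZmodClosed.Build formal tensor_pred tensor_pred_zmod_closed.

Definition free_product :=
  Quotient.quot (GRing.ZmodClosed.clone formal tensor_pred _).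
HB.instance Definition _ := GRing.Zmodule.on free_product.



Lemma fp_piP (f g : formal) :
  \pi_free_product f = \pi_free_product g <-> tensor_rel (f - g).
Proof.
have e : tensor_pred (f - g) = (\pi_free_product f == \pi_free_product g).
  exact: (Quotient.idealrBE (GRing.ZmodClosed.clone formal tensor_pred _) f g).
split=> [h|h]; first by apply/asboolP; move: e; rewrite /tensor_pred h eqxx.
by apply/eqP; move: e; rewrite /tensor_pred (introT (asboolP _) h) => /esym.
Qed.

Lemma fp_piD (f g : formal) :
  \pi_free_product (f + g) = \pi_free_product f + \pi_free_product g.
Proof. exact: pi_addr. Qed.

Lemma fp_repr (f : formal) :
  tensor_rel (repr (\pi_free_product f) - f).
Proof. by apply/fp_piP; rewrite reprK. Qed.

Definition fp_scale (a : F) (u : free_product) : free_product :=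
  \pi_free_product (a *: repr u).

Lemma fp_scale_pi (a : F) (f : formal) :
  fp_scale a (\pi_free_product f) = \pi_free_product (a *: f).
Proof.
apply: (fp_piP _ _).2; rewrite -scalerBr; apply: tensor_relZ; exact: fp_repr.
Qed.

Lemma fp_ind (P : free_product -> Prop) :
  (forall f, P (\pi_free_product f)) -> forall u, P u.
Proof. by move=> h u; rewrite -[u]reprK; apply: h. Qed.

Fact fp_scaleA a b u : fp_scale a (fp_scale b u) = fp_scale (a * b) u.
Proof.
elim/fp_ind: u => f.
by rewrite (fp_scale_pi b f) (fp_scale_pi a) (fp_scale_pi (a * b)) scalerA.
Qed.
Fact fp_scale1 : left_id 1 fp_scale.
Proof. by elim/fp_ind => f; rewrite (fp_scale_pi 1 f) scale1r. Qed.
Fact fp_scaleDr : right_distributive fp_scale +%R.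
Proof.
move=> a u v; elim/fp_ind: u => f; elim/fp_ind: v => g.
rewrite -(fp_piD f g) (fp_scale_pi a f) (fp_scale_pi a g) (fp_scale_pi a (f + g)).
by rewrite scalerDr fp_piD.
Qed.
Fact fp_scaleDl u : {morph fp_scale^~ u : a b / a + b}.
Proof.
move=> a b /=; elim/fp_ind: u => f.
by rewrite (fp_scale_pi a f) (fp_scale_pi b f) (fp_scale_pi (a + b)) scalerDl fp_piD.
Qed.
HB.instance Definition _ := GRing.Zmodule_isLmodule.Build F free_product
  fp_scaleA fp_scale1 fp_scaleDr fp_scaleDl.

Definition fp_vacuum : free_product := \pi_free_product (simple [::]).

(* The xi-coefficient: relations only involve nonempty words, so it does not
   depend on the representative (see fp_coef_pi). *)
Definition fp_coef (u : free_product) : F := monalg.mcoeff empty_word (repr u).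

Definition extend (h : seq letter -> formal) (f : formal) : formal :=
  \sum_(w <- monalg.msupp f) monalg.mcoeff w f *: h (val w).

(* On simple tensors, left_split k is V_k^-1 : X -> X_k (x) X(l,k): a leading
   letter (k, x) is split off as (0, x) in X_k, otherwise xi_k = (1, 0) is; and
   left_join is V_k, extended to all of X_k (x) X(l,k) by linearity in z.
   right_split and right_join are W_k^-1 and W_k. *)
Definition left_split (k : K) (s : seq letter) : sv_space k * seq letter :=
  if s is u :: t then
    if tag u == k then ((0, tagged_as (Tagged V (0 : V k)) u), t)
    else ((1, 0), s)
  else ((1, 0), s).

Definition left_join (k : K) (z : sv_space k) (s : seq letter) : formal :=
  z.1 *: simple s + simple (Tagged V z.2 :: s).

Definition right_split (k : K) (s : seq letter) : seq letter * sv_space k :=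
  let: (z, t) := left_split k (rev s) in (rev t, z).

Definition right_join (k : K) (s : seq letter) (z : sv_space k) : formal :=
  z.1 *: simple s + simple (rcons s (Tagged V z.2)).

Definition left_act (k : K) (T : {linear sv_space k -> sv_space k})
    (s : seq letter) : formal :=
  let: (z, t) := left_split k s in left_join (T z) t.

Definition right_act (k : K) (T : {linear sv_space k -> sv_space k})
    (s : seq letter) : formal :=
  let: (t, z) := right_split k s in right_join t (T z).

(* left_op T is lambda_k(T) and right_op T is rho_k(T); they do not depend on
   the choice of representatives (left_op_pi, right_op_pi). *)
Definition left_op (k : K) (T : {linear sv_space k -> sv_space k})
    (u : free_product) : free_product :=
  \pi_free_product (extend (left_act T) (repr u)).

Definition right_op (k : K) (T : {linear sv_space k -> sv_space k})
    (u : free_product) : free_product :=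
  \pi_free_product (extend (right_act T) (repr u)).


Lemma extend_sub (h : seq letter -> formal) (d : {fset altword}) (f : formal) :
  (monalg.msupp f `<=` d)%fset ->
  extend h f = \sum_(w <- d) monalg.mcoeff w f *: h (val w).
Proof.
move=> fd; rewrite /extend (big_fset_incl _ fd) //= => w _ wf.
by rewrite monalg.mcoeff_outdom // scale0r.
Qed.

Lemma extend_linear (h : seq letter -> formal) a f g :
  extend h (a *: f + g) = a *: extend h f + extend h g.
Proof.
pose d := (monalg.msupp f `|` monalg.msupp g)%fset.
have fd : (monalg.msupp f `<=` d)%fset by exact: fsubsetUl.
have gd : (monalg.msupp g `<=` d)%fset by exact: fsubsetUr.
have ad : (monalg.msupp (a *: f + g) `<=` d)%fset.
  apply/fsubsetP => w; rewrite -monalg.mcoeff_neq0 inE -!monalg.mcoeff_neq0.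
  rewrite monalg.mcoeffD monalg.mcoeffZ.
  apply: contraNT; rewrite negb_or !negbK => /andP[/eqP-> /eqP->].
  by rewrite mulr0 addr0.
rewrite (extend_sub h fd) (extend_sub h gd) (extend_sub h ad).
rewrite scaler_sumr -big_split /=; apply: eq_bigr => w _.
by rewrite monalg.mcoeffD monalg.mcoeffZ scalerDl scalerA.
Qed.

Lemma extend_simple (h : seq letter -> formal) (s : seq letter) :
  extend h (simple s) = if alternating s then h s else 0.
Proof.
rewrite /simple; case: insubP => [w sw ws|/negbTE ->]; last first.
  by rewrite /extend monalg.msupp0 big_nil.
rewrite sw -ws (@extend_sub h [fset w]%fset) ?monalg.msuppU_le //.
by rewrite big_seq_fset1 monalg.mcoeffUU scale1r.
Qed.

Lemma extend_tensor_rel (h : seq letter -> formal) :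
  (forall s t k a (x y : V k),
    tensor_rel (h (s ++ Tagged V (a *: x + y) :: t)
      - (a *: h (s ++ Tagged V x :: t) + h (s ++ Tagged V y :: t)))) ->
  forall f, tensor_rel f -> tensor_rel (extend h f).
Proof.
have ext0 : extend h 0 = 0 by rewrite /extend monalg.msupp0 big_nil.
move=> hh f; elim=> [|g g' _ rg _ rg'|a g _ rg|s t k a x y].
- by rewrite ext0; apply: tensor_rel0.
- by rewrite -[g]scale1r extend_linear scale1r; apply: tensor_relD.
- by rewrite -[a *: g]addr0 extend_linear ext0 addr0; apply: tensor_relZ.
- rewrite addrC -scaleN1r extend_linear extend_linear !extend_simple.
  have alt v w : alternating (s ++ Tagged V (v : V k) :: t) =
                 alternating (s ++ Tagged V (w : V k) :: t).
    rewrite /alternating; case: s => [|b s] /=; first by case: t.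
    by rewrite !cat_path /=; case: t.
  rewrite (alt (a *: x + y) x) (alt y x); case: ifP => _.
    by rewrite scaleN1r addrC; apply: hh.
  by rewrite !scaler0 !addr0 scaler0; apply: tensor_rel0.
Qed.

Lemma lin_rel (c a : F) (u1 u2 u3 v1 v2 v3 : formal) :
  tensor_rel (u1 - (a *: u2 + u3)) -> tensor_rel (v1 - (a *: v2 + v3)) ->
  tensor_rel ((c *: u1 + v1) - (a *: (c *: u2 + v2) + (c *: u3 + v3))).
Proof.
move=> ru rv; have := tensor_relD (tensor_relZ c ru) rv; congr tensor_rel.
rewrite scalerBr scalerDr scalerDr !scalerA [c * a]mulrC.
by rewrite [X in _ = _ - X]addrACA [in RHS]opprD [RHS]addrACA.
Qed.

Lemma left_join_rel k (z : sv_space k) (s t : seq letter) j a (x y : V j) :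
  tensor_rel (left_join z (s ++ Tagged V (a *: x + y) :: t)
    - (a *: left_join z (s ++ Tagged V x :: t)
       + left_join z (s ++ Tagged V y :: t))).
Proof.
apply: lin_rel; first exact: tensor_rel_linear.
exact: (tensor_rel_linear (Tagged V z.2 :: s)).
Qed.

Lemma right_join_rel k (z : sv_space k) (s t : seq letter) j a (x y : V j) :
  tensor_rel (right_join (s ++ Tagged V (a *: x + y) :: t) z
    - (a *: right_join (s ++ Tagged V x :: t) z
       + right_join (s ++ Tagged V y :: t) z)).
Proof.
apply: lin_rel; first exact: tensor_rel_linear.
by rewrite !rcons_cat !rcons_cons; exact: tensor_rel_linear.
Qed.

Lemma sv_linear k (T : {linear sv_space k -> sv_space k}) a (x y : V k) :
  T (0, a *: x + y) = a *: T (0, x) + T (0, y).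
Proof. by rewrite -linearP; congr (T (_, _)); rewrite /= scaler0 addr0. Qed.

Lemma left_act_rel k (T : {linear sv_space k -> sv_space k})
    (s t : seq letter) j a (x y : V j) :
  tensor_rel (left_act T (s ++ Tagged V (a *: x + y) :: t)
    - (a *: left_act T (s ++ Tagged V x :: t)
       + left_act T (s ++ Tagged V y :: t))).
Proof.
rewrite /left_act; case: s => [|u s] /=.
  have [ejk|_] := eqVneq j k; last exact: (left_join_rel _ [::]).
  subst j; rewrite !tagged_asE sv_linear /left_join.
  rewrite [(_ + _).1]/= [(_ + _).2]/=.
  set p := T (0, x); set q := T (0, y).
  have := tensor_rel_linear [::] t a p.2 q.2; congr tensor_rel => /=.
  move: (simple _) (simple _) (simple _) => b1 b2 b3.
  rewrite scalerDl -scalerA [a *: (_ + b2)]scalerDr.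
  by rewrite [X in _ = _ - X]addrACA [in RHS]opprD [RHS]addrACA subrr add0r.
by have [_|_] := eqVneq (tag u) k; [exact: left_join_rel|exact: (left_join_rel _ (u :: s))].
Qed.

Lemma right_split_rcons k s (u : letter) :
  right_split k (rcons s u) =
  if tag u == k then (s, (0, tagged_as (Tagged V (0 : V k)) u))
  else (rcons s u, (1, 0)).
Proof.
by rewrite /right_split rev_rcons /=; case: ifP; rewrite ?rev_cons revK.
Qed.

Lemma right_act_rel k (T : {linear sv_space k -> sv_space k})
    (s t : seq letter) j a (x y : V j) :
  tensor_rel (right_act T (s ++ Tagged V (a *: x + y) :: t)
    - (a *: right_act T (s ++ Tagged V x :: t)
       + right_act T (s ++ Tagged V y :: t))).
Proof.
rewrite /right_act; case/lastP: t => [|t u].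
  rewrite !cats1 !right_split_rcons /=; have [ejk|_] := eqVneq j k; last first.
    by rewrite -!cats1; exact: right_join_rel.
  subst j; rewrite !tagged_asE sv_linear /right_join.
  rewrite [(_ + _).1]/= [(_ + _).2]/=.
  set p := T (0, x); set q := T (0, y).
  have := tensor_rel_linear s [::] a p.2 q.2; rewrite !cats1.
  congr tensor_rel; move: (simple _) (simple _) (simple _) (simple _) => b1 b2 b3 b4.
  rewrite scalerDl -scalerA [a *: (_ + b3)]scalerDr.
  by rewrite [X in _ = _ - X]addrACA [in RHS]opprD [RHS]addrACA subrr add0r.
rewrite -!rcons_cons -!rcons_cat !right_split_rcons.
have [_|_] := eqVneq (tag u) k; first exact: right_join_rel.
by rewrite !rcons_cat !rcons_cons; exact: right_join_rel.
Qed.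

Lemma left_op_pi k (T : {linear sv_space k -> sv_space k}) (f : formal) :
  left_op T (\pi_free_product f) = \pi_free_product (extend (left_act T) f).
Proof.
apply: (fp_piP _ _).2; have := extend_tensor_rel (left_act_rel T) (fp_repr f).
by rewrite addrC -scaleN1r extend_linear scaleN1r addrC.
Qed.

Lemma right_op_pi k (T : {linear sv_space k -> sv_space k}) (f : formal) :
  right_op T (\pi_free_product f) = \pi_free_product (extend (right_act T) f).
Proof.
apply: (fp_piP _ _).2; have := extend_tensor_rel (right_act_rel T) (fp_repr f).
by rewrite addrC -scaleN1r extend_linear scaleN1r addrC.
Qed.

Lemma left_op_linear k (T : {linear sv_space k -> sv_space k}) :
  linear (left_op T).
Proof.
move=> a u v; elim/fp_ind: u => f; elim/fp_ind: v => g.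
have -> : a *: (\pi_free_product f : free_product) = \pi_free_product (a *: f).
  exact: fp_scale_pi.
rewrite -(fp_piD (a *: f) g) (left_op_pi T (_ + _)) extend_linear.
rewrite (fp_piD (a *: _)) (left_op_pi T f) (left_op_pi T g); congr (_ + _).
exact/esym/fp_scale_pi.
Qed.

Lemma right_op_linear k (T : {linear sv_space k -> sv_space k}) :
  linear (right_op T).
Proof.
move=> a u v; elim/fp_ind: u => f; elim/fp_ind: v => g.
have -> : a *: (\pi_free_product f : free_product) = \pi_free_product (a *: f).
  exact: fp_scale_pi.
rewrite -(fp_piD (a *: f) g) (right_op_pi T (_ + _)) extend_linear.
rewrite (fp_piD (a *: _)) (right_op_pi T f) (right_op_pi T g); congr (_ + _).
exact/esym/fp_scale_pi.
Qed.

Lemma fp_coef_pi (f : formal) :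
  fp_coef (\pi_free_product f) = monalg.mcoeff empty_word f.
Proof.
rewrite /fp_coef; apply/eqP; rewrite -subr_eq0 -monalg.mcoeffB; apply/eqP.
elim: (fp_repr f) => [|g g' _ eg _ eg'|a g _ eg|s t k a x y].
- exact: monalg.mcoeff0.
- by rewrite monalg.mcoeffD eg eg' addr0.
- by rewrite monalg.mcoeffZ eg mulr0.
have coef0 v : monalg.mcoeff empty_word (simple (s ++ Tagged V (v : V k) :: t)) = 0.
  rewrite /simple; case: insubP => [w _ we|_]; last exact: monalg.mcoeff0.
  rewrite monalg.mcoeffU; case: eqP => // ew; move: we; rewrite ew /=.
  by case: s.
by rewrite monalg.mcoeffB monalg.mcoeffD monalg.mcoeffZ !coef0 mulr0 addr0 subr0.
Qed.

End FreeProduct.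

(* Unital C*-algebras; algType is nontrivial, as the existence of a state
   requires anyway. *)
Record cstarAlgebra (R : realType) := CStarAlgebra {
  cstar_alg :> algType R[i];
  star : cstar_alg -> cstar_alg;
  cnorm : cstar_alg -> R;
  starK : involutive star;
  starD : {morph star : x y / x + y};
  starZ : forall (c : R[i]) x, star (c *: x) = Num.conj c *: star x;
  starM : forall x y, star (x * y) = star y * star x;
  cnorm_eq0 : forall x, cnorm x = 0 -> x = 0;
  cnormZ : forall (c : R[i]) x, cnorm (c *: x) = normc c * cnorm x;
  cnormD : forall x y, cnorm (x + y) <= cnorm x + cnorm y;
  cnormM : forall x y, cnorm (x * y) <= cnorm x * cnorm y;
  cnorm_star : forall x, cnorm (star x * x) = cnorm x ^+ 2;
  cnorm_complete : forall u : nat -> cstar_alg,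
    (forall e : R, 0 < e ->
       exists N, forall m n, (N <= m)%N -> (N <= n)%N -> cnorm (u m - u n) < e) ->
    exists l, forall e : R, 0 < e ->
       exists N, forall n, (N <= n)%N -> cnorm (u n - l) < e
}.

Definition is_state (R : realType) (A : cstarAlgebra R)
    (phi : {scalar A}) : Prop :=
  phi 1 = 1 /\ forall a : A, 0 <= phi (star a * a).

Definition unital_subalgebra (R : realType) (A : cstarAlgebra R)
    (B : set A) : Prop :=
  [/\ B 1, forall (c : R[i]) a b, B a -> B b -> B (c *: a + b)
    & forall a b, B a -> B b -> B (a * b)].

Definition gen_algebra (R : realType) (A : cstarAlgebra R) (S : set A) :
    set A := smallest (@unital_subalgebra R A) S.

Section Matrices.
Variable R : realType.

Definition vnorm d (v : 'cV[R[i]]_d) : R :=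
  Num.sqrt (\sum_i normc (v i 0) ^+ 2).

(* The operator norm for the Euclidean norm vnorm. *)
Definition opnorm d (B : 'M[R[i]]_d) : R :=
  sup [set vnorm (B *m v) | v in [set v : 'cV_d | vnorm v <= 1]].

Definition ntrace d (B : 'M[R[i]]_d) : R[i] := d%:R^-1 * \tr B.

(* Coordinates on the self-adjoint matrices in an orthonormal basis for
   <A, B> = Tr (A B): see sa_mx_hermitian, sa_mx_isometry and sa_mx_onto. *)
Definition sa_mx d (x : 'I_d -> 'I_d -> R) : 'M[R[i]]_d :=
  \matrix_(i, j)
    if i == j then (x i i)%:C
    else if (i < j)%N then (x i j / Num.sqrt 2) +i* (x j i / Num.sqrt 2)
    else (x j i / Num.sqrt 2) -i* (x i j / Num.sqrt 2).

(* Lebesgue measure on R^n, as an iterated product measure. *)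
Fixpoint lebesgue_tuple (n : nat) :
    set (n.-tuple (measurableTypeR R)) -> \bar R :=
  match n with
  | 0 => \d_[tuple]
  | m.+1 => pushforward (lebesgue_measure \x @lebesgue_tuple m)%E
              (fun p => [tuple of p.1 :: p.2])
  end.

(* The measure lambda_{d,#|P|} on P-indexed tuples of self-adjoint matrices:
   the image of Lebesgue measure under the isometry given by sa_mx. *)
Definition lebesgue_sa (P : finType) d (S : set (P -> 'M[R[i]]_d)) : \bar R :=
  @lebesgue_tuple #|{: P * 'I_d * 'I_d}|
    [set t | S (fun p => sa_mx (fun i j => tnth t (enum_rank (p, i, j))))].

End Matrices.

Lemma sa_mx_hermitian (R : realType) d (x : 'I_d -> 'I_d -> R) : sa_mx x \is hermsymmx.
Proof.
rewrite is_hermitianmxE expr0 scale1r; apply/eqP/matrixP => i j; rewrite !mxE.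
rewrite [j == i]eq_sym; case: eqVneq => [->|ij].
  by apply/eqP; rewrite eq_complex /= oppr0 !eqxx.
have := ij; rewrite -val_eqE neq_ltn /= => /orP[lt|lt];
  rewrite lt ltnNge (ltnW lt) /=; apply/eqP; rewrite eq_complex /= ?opprK ?eqxx//.
Qed.

Lemma sa_mx_isometry (R : realType) d (x y : 'I_d -> 'I_d -> R) :
  \tr (sa_mx x *m sa_mx y) = (\sum_i \sum_j x i j * y i j)%:C.
Proof.
rewrite /mxtrace; under eq_bigr do rewrite mxE.
pose f i j := sa_mx x i j * sa_mx y j i; pose g i j := (x i j * y i j)%:C.
rewrite rmorph_sum /=; under [RHS]eq_bigr do rewrite rmorph_sum /=.
rewrite -[LHS]/(\sum_i \sum_j f i j) -[RHS]/(\sum_i \sum_j g i j).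
have fg i j : f i j + f j i = g i j + g j i.
  rewrite /f /g !mxE [j == i]eq_sym; case: eqVneq => [->|ij].
    by rewrite -!rmorphM.
  have s2 : (Num.sqrt 2 : R)^-1 * (Num.sqrt 2)^-1 + (Num.sqrt 2)^-1 * (Num.sqrt 2)^-1 = 1.
    by rewrite -invfM -expr2 sqr_sqrtr ?ler0n//; field.
  have key (a b c e u : R) : u * u + u * u = 1 -> (u * u + u * u) * (a * b + c * e) = a * b + c * e.
    by move=> ->; rewrite mul1r.
  have := ij; rewrite -val_eqE neq_ltn /= => /orP[lt|lt];
    rewrite lt ltnNge (ltnW lt) /=; apply/eqP; rewrite eq_complex /=;
    apply/andP; split; apply/eqP; move: s2; move: (_^-1) (x i j) (x j i) (y i j) (y j i) => u a b a' b' uu.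
  - by rewrite -(key a a' b b' u uu); ring.
  - by ring.
  - by rewrite -(key a a' b b' u uu); ring.
  - by ring.
have ss h : \sum_i \sum_j h i j + \sum_i \sum_j h i j =
             \sum_(i < d) \sum_(j < d) (h i j + h j i) :> R[i].
  rewrite [X in _ + X]exchange_big -big_split; apply: eq_bigr => i _.
  by rewrite -big_split.
have := ss f; under [RHS]eq_bigr do under eq_bigr do rewrite fg.
rewrite -ss -!mulr2n => /eqP; rewrite -subr_eq0 -mulrnBl mulrn_eq0 subr_eq0.
by move/eqP.
Qed.

Lemma sa_mx_onto (R : realType) d (B : 'M[R[i]]_d) : B \is hermsymmx ->
  exists x, B = sa_mx x.
Proof.
rewrite is_hermitianmxE expr0 scale1r => /eqP/matrixP hB.
have s2 : (Num.sqrt 2 : R) != 0 by rewrite sqrtr_eq0 -ltNge ltr0n.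
exists (fun i j => if i == j then complex.Re (B i i) else
   (if (i < j)%N then complex.Re (B i j) else complex.Im (B j i)) * Num.sqrt 2).
apply/matrixP => i j; rewrite !mxE [j == i]eq_sym.
have := hB i j; rewrite !mxE; case: eqVneq => [->|ij].
  case: (B j j) => a b /= [e]; apply/eqP; rewrite eq_complex /= eqxx /=.
  by rewrite eqxx /= -[_ == 0]/((2 == 0)%N || (b == 0)) -mulrn_eq0 mulr2n {1}e addNr.
have := ij; rewrite -val_eqE neq_ltn /= => /orP[lt|lt];
  rewrite lt ltnNge (ltnW lt) /= !mulfK //.
  by move=> _; case: (B i j).
by move=> ->; case: (B j i).
Qed.

(* The left variables are indexed by I and the right variables by J; left
   matrices are B (inl i), right matrices are B (inr j). *)
Section Entropy.
Context (R : realType) (A : cstarAlgebra R) (phi : {scalar A}).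
Context (I J : finType) (X : I -> A) (Y : J -> A).

Definition microstates (r : R) (M : nat) (eps : R) (d : nat) :
    set (I + J -> 'M[R[i]]_d) :=
  [set B | (forall p, B p \is hermsymmx /\ opnorm (B p) <= r) /\
    forall (s : seq I) (t : seq J), (1 <= size s + size t <= M)%N ->
      `| phi ((\prod_(i <- s) X i) * (\prod_(j <- t) Y j))
         - ntrace ((\prod_(i <- s) B (inl i)) *m (\prod_(j <- rev t) B (inr j)))
       | < eps%:C ].
Local Open Scope ereal_scope.
Definition chi_d (r : R) (M d : nat) (eps : R) : \bar R :=
  lne (lebesgue_sa (@microstates r M eps d)).

(* The value at d = 0 is irrelevant to the limsup. *)
Definition chi_M (r : R) (M : nat) (eps : R) : \bar R :=
  limn_esup (fun d => (d%:R ^- 2)%:E * chi_d r M d eps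
                      + ((#|I| + #|J|)%:R / 2 * ln d%:R)%:E).
Definition chi_R (r : R) : \bar R :=
  ereal_inf [set chi_M r Me.1 Me.2 | Me in [set Me : nat * R | (0 < Me.2)%R]].
Definition chi : \bar R := ereal_sup [set chi_R r | r in [set r | (0 < r)%R]].
End Entropy.

Section BiFree.
Context (R : realType) (A : cstarAlgebra R) (phi : {scalar A}).

(* h need only be meaningful on B. *)
Definition unital_hom (B : set A) (W : lmodType R[i])
    (h : A -> {linear W -> W}) : Prop :=
  [/\ h 1 =1 id,
      forall (c : R[i]) a b, B a -> B b ->
        h (c *: a + b) =1 (fun x => c *: h a x + h b x)
    & forall a b, B a -> B b -> h (a * b) =1 h a \o h b].

(* A letter inl (k, a) of a word is a taken from C k, and inr (k, a) is a taken
   from D k. *)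
Definition bi_free (K : choiceType) (C D : K -> set A) : Prop :=
  exists (V : K -> lmodType R[i])
         (l r : forall k, A -> {linear sv_space V k -> sv_space V k}),
    [/\ forall k, unital_hom (C k) (l k),
        forall k, unital_hom (D k) (r k)
      & forall w : seq (K * A + K * A),
          (forall z, z \in w ->
             match z with inl ka => C ka.1 ka.2 | inr ka => D ka.1 ka.2 end) ->
          phi (\prod_(z <- w) match z with inl ka => ka.2 | inr ka => ka.2 end) =
          fp_coef (foldr (fun z u =>
            match z with
            | inl ka => left_op (l ka.1 ka.2) u
            | inr ka => right_op (r ka.1 ka.2) u
            end) (fp_vacuum V) w)].

Definition tracial_on (B : set A) : Prop :=
  forall a b, B a -> B b -> phi (a * b) = phi (b * a).

(* Commutation of left and right variables is only required in distribution. *)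
Definition tracially_bipartite (I J : finType) (X : I -> A) (Y : J -> A) : Prop :=
  let letter_val (z : I + J) :=
    match z with inl i => X i | inr j => Y j end in
  [/\ (forall i, star (X i) = X i) /\ (forall j, star (Y j) = Y j),
      forall (u v : seq (I + J)) i j,
        phi (\prod_(z <- u) letter_val z * (X i * Y j)
             * \prod_(z <- v) letter_val z) =
        phi (\prod_(z <- u) letter_val z * (Y j * X i)
             * \prod_(z <- v) letter_val z),
      tracial_on (gen_algebra (range X))
    & tracial_on (gen_algebra (range Y))].

Definition joint_family (l : nat) (n : 'I_l -> nat)
    (X : forall k, 'I_(n k) -> A) : {k : 'I_l & 'I_(n k)} -> A :=
  fun p => X (tag p) (tagged p).

End BiFree.

(* Main.v *)
(* Let d_k be the derivation of the free algebra with d_k p = p (x) 1 - 1 (x) p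
   for the letters p of the k-th family and d_k p = 0 for the others. Conjugating
   the matrices of the k-th family by a unitary preserves Lebesgue measure and
   the product of the microstate sets of the single families. Integration by
   parts along these orbits shows that, in this product, the set where
   |(tau_d (x) tau_d)(d_k w)| >= delta has relative measure at most
   exp (1 - kappa d^2). Traces of words are bounded by Cauchy-Schwarz through
   moments of single letters, so kappa does not depend on the cut-off R.
   Additivity of the entropy says that the joint microstates do not occupy an
   exponentially small (in d^2) part of the product, so some of them make finitely
   many of these functionals small. An ultralimit of their traces is a tracial
   functional tau with (tau (x) tau)(d_k w) = 0 for all k and w; by induction tau
   vanishes on alternating products of centred elements. Commutation of left and
   right letters expresses phi w as tau of the left letters of w followed by the
   right ones in reverse order. Finally take X_k = A = C 1 (+) ker phi for all k,
   every variable acting by left multiplication: moving the letters of w one at a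
   time onto alternating tensors computes the same values. *)

From HB Require Import structures.
From mathcomp Require Import all_boot all_order all_algebra.
From mathcomp Require Import finmap.
From mathcomp Require Import all_classical all_reals all_analysis.
From mathcomp Require Import complex ring lra zify.
From mathcomp Require Import measurable_realfun.
From mathcomp Require monalg.
Import (canonicals) monalg.
Require Import Defs.
Set Implicit Arguments.
Unset Strict Implicit.
Unset Printing Implicit Defensive.
Import Order.TTheory GRing.Theory Num.Theory.
Local Open Scope classical_set_scope.
Local Open Scope ring_scope.

(** * Lebesgue measure on tuples *)

(** The joint microstates constrain mixed moments, so they are invariant only under conjugating all
    families at once; the product of the single sets ignores mixed moments, which frees each block.
    On it, integrate by parts with the field A_p -> [W(v), A_p] and the test function F^q
    conj(F)^(q+1), where F is the functional of the word v. The divergence of the field is -d^2 F,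
    which gives d^2 E|F|^(2q+2) <= (2q+1) L E|F|^(2q). A variance estimate would be too weak:
    iterating up to q of order d^2 produces decay at speed d^2, the scale on which entropy sees
    volumes. Since [chi] is a supremum over cut-offs, the contradiction needs one deficit, here
    kappa/2, valid for every cut-off; hence the care to bound traces without operator norms. On the
    algebraic side, [bi_free] asks for homomorphisms on both faces, whereas right multiplication
    would reverse products. Left multiplication on the last tensor factor fits: tau reads right
    letters backwards, so multiplying by a right letter on the left in A appends it to the word read
    by tau. *)

Section MeasureInstances.
Context d (T : measurableType d) (R : realType) (mu : {measure set T -> \bar R}).
Hypothesis sf : sigma_finite setT mu.

(** A named copy of [mu], to which the structure of a sigma-finite measure can be attached from the
    hypothesis [sf]. *)
Definition sfm : set T -> \bar R := fun A => mu A.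
HB.instance Definition _ := Measure.copy sfm mu.
Let sfp : sigma_finite setT sfm := sf.
HB.instance Definition _ := Measure_isSigmaFinite.Build _ _ _ sfm sfp.

Lemma sigma_finite_ex :
  exists m : {sigma_finite_measure set T -> \bar R}, forall S, m S = mu S.
Proof. by exists sfm. Qed.
End MeasureInstances.

Lemma pushforward_ex d d' (T : measurableType d) (T' : measurableType d')
    (R : realType) (mu : {measure set T -> \bar R}) (f : T -> T') :
  measurable_fun setT f ->
  exists m : {measure set T' -> \bar R}, forall S, m S = mu (f @^-1` S).
Proof.
move=> mf.
by unshelve eexists (pushforward mu f : {measure set T' -> \bar R}).
Qed.

Section TupleMeasure.
Variable R : realType.
Local Notation M := (measurableTypeR R).
Local Notation T n := (n.-tuple M).

Definition tadd n (s t : T n) : T n := [tuple tnth s i + tnth t i | i < n].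
Definition topp n (t : T n) : T n := [tuple - tnth t i | i < n].
Definition tcube n (r : R) : set (T n) := [set t | forall i, `|tnth t i| <= r].

Lemma tupleP2 n (s t : T n) : (forall i, tnth s i = tnth t i) -> s = t.
Proof. by move=> h; apply/eq_from_tnth. Qed.

Lemma measurable_tupleP d (S : measurableType d) n (f : S -> T n) :
  (forall i, measurable_fun setT (fun x => tnth (f x) i)) ->
  measurable_fun setT f.
Proof. by move=> h; apply/measurable_fun_tnthP. Qed.

Lemma measurable_tnthc d (S : measurableType d) n (f : S -> T n) i :
  measurable_fun setT f -> measurable_fun setT (fun x => tnth (f x) i).
Proof. by move=> /measurable_fun_tnthP /(_ i). Qed.

Lemma measurable_tadd n : measurable_fun setT (fun p : T n * T n => tadd p.1 p.2).
Proof.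
apply: measurable_tupleP => i; under eq_fun do rewrite tnth_mktuple.
by apply: measurable_funD; apply: measurable_tnthc.
Qed.

Lemma measurable_topp n : measurable_fun setT (@topp n).
Proof.
apply: measurable_tupleP => i; under eq_fun do rewrite tnth_mktuple.
by apply: measurableT_comp => //; apply: measurable_tnth.
Qed.

Lemma measurable_preim d d' (S : measurableType d) (S' : measurableType d') (f : S -> S') B :
  measurable_fun setT f -> measurable B -> measurable (f @^-1` B).
Proof. by move=> mf mB; rewrite -[X in measurable X]setTI; exact: mf. Qed.

Lemma measurable_tcube n r : measurable (@tcube n r).
Proof.
rewrite (_ : tcube r = \bigcap_(i in [set: 'I_n]) [set t | `|tnth t i| <= r]); last first.
  by apply/seteqP; split => [t h i _|t h i]; [exact: h|exact: (h i)].
apply: fin_bigcap_measurable => //= i _.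
rewrite (_ : [set t | _] = (fun t : T n => `|tnth t i|) @^-1` [set x | x <= r]) //.
apply: measurable_preim.
  by apply: measurableT_comp => //; apply: measurable_tnth.
by rewrite (_ : [set x | x <= r] = `]-oo, r]%classic) //; apply/seteqP; split=> x /=; rewrite in_itv.
Qed.

Local Notation cons_t n := (fun p : M * T n => [tuple of p.1 :: p.2]).

Lemma measurable_cons_t n : measurable_fun setT (cons_t n).
Proof. exact: measurable_cons. Qed.

Lemma tcube_cons n r (x : M) (t : T n) :
  @tcube n.+1 r [tuple of x :: t] = (`|x| <= r /\ tcube r t).
Proof.
apply/propext; split=> [h|[hx ht] i].
  split; first by have := h ord0; rewrite tnth0.
  by move=> i; have := h (lift ord0 i); rewrite tnthS.
by case: (unliftP ord0 i) => [j|] ->; rewrite ?tnthS ?tnth0.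
Qed.

Lemma sigma_finite_cubes n (m : {measure set (T n) -> \bar R}) :
  (forall r : R, 0 <= r -> (m (tcube r) < +oo)%E) -> sigma_finite setT m.
Proof.
move=> h; exists (fun k => tcube k%:R); last first.
  by move=> k; split; [exact: measurable_tcube|exact: h].
apply/seteqP; split=> // t _.
exists (Num.trunc (\sum_i `|tnth t i|)).+1 => // i.
apply: ltW; apply: le_lt_trans (truncnS_gt _).
by rewrite (bigD1 i) //= lerDl sumr_ge0.
Qed.

(** [lebesgue_tuple] is a bare recursive set function. The induction rebuilds it as a measure and
    carries the volume of cubes along, since finiteness on cubes is what makes the next product
    sigma-finite. *)
Lemma ltm_exists n : exists m : {sigma_finite_measure set (T n) -> \bar R},
  (forall S, measurable S -> m S = @lebesgue_tuple R n S) /\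
  (forall r : R, 0 <= r -> m (tcube r) = ((2 * r) ^+ n)%:E).
Proof.
elim: n => [|n [m [mE mC]]].
  exists (dirac ([tuple] : T 0)); split => // r r0.
  by rewrite expr0 /= diracE mem_set //= => -[].
have [mu muE] := pushforward_ex (lebesgue_measure \x m)%E (@measurable_cons_t n).
have muC (r : R) : 0 <= r -> mu (tcube r) = ((2 * r) ^+ n.+1)%:E.
  move=> r0; rewrite muE (_ : _ @^-1` _ = (`[- r, r]%classic : set M) `*` tcube r); last first.
    apply/seteqP; split=> -[x t] /=; rewrite tcube_cons in_itv /= -ler_norml; by case.
  set B : set M := [set` _].
  transitivity (lebesgue_measure B * m (tcube r))%E.
    apply: (product_measure1E lebesgue_measure m); last exact: measurable_tcube.
    exact: measurable_itv.
  rewrite mC // exprS EFinM; congr (_ * _)%E.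
  rewrite lebesgue_measure_itv /= lte_fin opprK.
  case: ltP => [_|h]; first by rewrite -mulr2n mulr_natl.
  have -> : r = 0 by apply/eqP; rewrite eq_le r0 andbT; move: h; lra.
  by rewrite mulr0.
have [m' m'E] : exists m : {sigma_finite_measure set (T n.+1) -> \bar R}, forall S, m S = mu S.
  by apply: sigma_finite_ex; apply: sigma_finite_cubes => r r0; rewrite muC // ltry.
exists m'; split=> [S mS|r r0]; rewrite m'E ?muC // muE /=.
rewrite /pushforward /product_measure1; apply: eq_integral => x _ /=.
apply: mE; apply: measurable_xsection.
by apply: measurable_preim => //; exact: measurable_cons_t.
Qed.

Definition ltm n : {sigma_finite_measure set (T n) -> \bar R} := projT1 (cid (ltm_exists n)).

Lemma ltmE n S : measurable S -> ltm n S = @lebesgue_tuple R n S.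
Proof. by rewrite /ltm; case: cid => m /= [mE _] /mE. Qed.

Lemma ltm_cube n r : 0 <= r -> ltm n (tcube r) = ((2 * r) ^+ n)%:E.
Proof. by rewrite /ltm; case: cid => m /= [_ mC] /mC. Qed.

Lemma ltm_cons n S : measurable S ->
  ltm n.+1 S = (lebesgue_measure \x ltm n)%E (cons_t n @^-1` S).
Proof.
move=> mS; rewrite ltmE //= /pushforward /product_measure1; apply: eq_integral => x _ /=.
rewrite ltmE //; apply: measurable_xsection.
by apply: measurable_preim => //; exact: measurable_cons_t.
Qed.

(** The translated measure has the right values on half-open intervals, which determine Lebesgue
    measure. *)
Lemma lebesgue_measureD (a : R) (S : set M) : measurable S ->
  lebesgue_measure ((fun x : M => a + x : M) @^-1` S) = lebesgue_measure S.
Proof.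
move=> mS.
have mf : measurable_fun [set: M] (fun x : M => a + x : M).
  by apply: measurable_funD => //; exact: measurable_cst.
have [m mE] := pushforward_ex lebesgue_measure mf.
rewrite -mE; apply/esym/lebesgue_measure_unique => //= _ [[x y]] _ <-.
rewrite mE (_ : _ @^-1` _ = `](x - a), (y - a)]%classic); last first.
  by apply/seteqP; split=> z /=; rewrite !in_itv /= ltrBlDl lerBrDl.
apply: etrans (lebesgue_measure_itv `]x, y]) _.
apply/esym; apply: etrans (lebesgue_measure_itv `](x - a), (y - a)]) _.
rewrite /= !lte_fin; have -> : (x - a < y - a) = (x < y) by rewrite ltrD2r.
by case: ifP => // _; rewrite -!EFinB; congr EFin; ring.
Qed.

Lemma ltm_trans n (s : T n) (S : set (T n)) : measurable S ->
  ltm n ((fun t => tadd s t) @^-1` S) = ltm n S.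
Proof.
elim: n s S => [|n IH] s S mS.
  by congr (ltm 0 _); apply/seteqP; split=> t /=; rewrite (tuple0 t) (tuple0 (tadd _ _)).
have mD m (u : T m) : measurable_fun setT (fun t => tadd u t).
  apply: measurable_tupleP => i; under eq_fun do rewrite tnth_mktuple.
  by apply: measurable_funD; [exact: measurable_cst|exact: measurable_tnth].
rewrite !ltm_cons //; last by apply: (measurable_preim (mD _ s)).
set a := tnth s ord0; set s' := [tuple of behead s] : T n.
set Q := cons_t n @^-1` S.
have mQ : measurable Q by apply: measurable_preim => //; exact: measurable_cons_t.
have consE x (t : T n) : tadd s [tuple of x :: t] = [tuple of a + x :: tadd s' t].
  apply: tupleP2 => i; rewrite tnth_mktuple.
  case: (unliftP ord0 i) => [j|] ->; rewrite ?tnthS ?tnth0 ?tnth_mktuple //.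
  by congr (_ + _); rewrite [in LHS](tuple_eta s) tnthS.
rewrite /product_measure1.
transitivity ((\int[lebesgue_measure]_x (ltm n (xsection Q (a + x)%R))))%E.
  apply: eq_integral => x _ /=; rewrite -[RHS](IH s'); last exact: measurable_xsection.
  by congr (ltm n _); apply/seteqP; split=> t; rewrite /xsection /= !inE /Q /= consE.
have mg : measurable_fun setT (fun x : M => ltm n (xsection Q x)).
  exact: measurable_fun_xsection.
have mf : measurable_fun [set: M] (fun x : M => a + x : M).
  by apply: measurable_funD => //; exact: measurable_cst.
have g0 : {in [set: M], forall x, (0 <= ltm n (xsection Q x))%E} by move=> ? _; exact: measure_ge0.
have E := ge0_integral_pushforward mf lebesgue_measure measurableT mg g0.
rewrite preimage_setT in E; refine (eq_trans (esym E) _).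
by apply: eq_measure_integral => U mU _; exact: lebesgue_measureD.
Qed.

Lemma sections_swap d1 d2 (T1 : measurableType d1) (T2 : measurableType d2)
    (m1 : {sigma_finite_measure set T1 -> \bar R})
    (m2 : {sigma_finite_measure set T2 -> \bar R}) (Q : set (T1 * T2)) :
  measurable Q ->
  (\int[m1]_x m2 (xsection Q x) = \int[m2]_y m1 (ysection Q y))%E.
Proof.
move=> mQ; apply: (product_measure_unique (m' := (m1 \x^ m2)%E)) => //= A B mA mB.
exact: product_measure2E.
Qed.

Lemma integral_cond_cst d (S : measurableType d) (m : {measure set S -> \bar R})
    (D : set S) (c : \bar R) (f : S -> \bar R) : measurable D ->
  (forall x, D x -> f x = c) -> (forall x, ~ D x -> f x = 0%E) ->
  (\int[m]_x f x = c * m D)%E.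
Proof.
move=> mD f1 f0; rewrite -integral_cst // [RHS]integral_mkcond.
apply: eq_integral => x _; rewrite patchE; case: ifPn => [|] h.
  by apply: f1; apply: set_mem.
by apply: f0 => /mem_set; apply/negP.
Qed.

(** The uniqueness argument for Haar measure: compute the size of the set of pairs (x, y) with x + y
    in S and y in D in both orders. Translating y by x turns the conditions into y in S and y - x in
    D, whose x-sections are translates of -D. *)
Lemma trans_inv_swap n (m : {sigma_finite_measure set (T n) -> \bar R}) :
  (forall s S, measurable S -> m ((fun t => tadd s t) @^-1` S) = m S) ->
  forall S D, measurable S -> measurable D ->
  (m S * ltm n D = m (@topp n @^-1` D) * ltm n S)%E.
Proof.
move=> mT S D mS mD.
pose Q1 : set (T n * T n) := [set p | S (tadd p.1 p.2) /\ D p.2].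
pose Q2 : set (T n * T n) := [set p | S p.2 /\ D (tadd p.2 (topp p.1))].
have mQ1 : measurable Q1.
  apply: (@measurableI _ _ ((fun p => tadd p.1 p.2) @^-1` S) (snd @^-1` D)).
    by apply: measurable_preim => //; exact: measurable_tadd.
  exact: measurable_preim.
have mQ2 : measurable Q2.
  apply: (@measurableI _ _ (snd @^-1` S) ((fun p => tadd p.2 (topp p.1)) @^-1` D)).
    exact: measurable_preim.
  apply: measurable_preim => //.
  apply: (measurableT_comp (@measurable_tadd n) (g := fun p => (p.2, topp p.1))).
  apply: measurable_fun_pair => //=.
  by apply: measurableT_comp => //; exact: measurable_topp.
transitivity (\int[ltm n]_y m (ysection Q1 y))%E.
  apply/esym/integral_cond_cst => // y Dy.
    rewrite -[RHS](mT y) //; congr (m _); apply/seteqP; split=> x; rewrite /ysection /= inE /Q1 /=.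
      rewrite (_ : tadd x y = tadd y x); first by case.
      by apply: tupleP2 => i; rewrite !tnth_mktuple addrC.
    move=> ?; split=> //; rewrite (_ : tadd x y = tadd y x) //.
    by apply: tupleP2 => i; rewrite !tnth_mktuple addrC.
  rewrite (_ : ysection Q1 y = set0) ?measure0 //.
  by apply/seteqP; split=> x //; rewrite /ysection /= inE /Q1 /= => -[].
rewrite -sections_swap //.
transitivity (\int[m]_x ltm n (xsection Q2 x))%E.
  apply: eq_integral => x _; rewrite -(ltm_trans x (S := xsection Q2 x)); last exact: measurable_xsection.
  congr (ltm n _); apply/seteqP; split=> y; rewrite /xsection /= !inE /Q1 /Q2 /=.
    move=> [? ?]; split=> //; rewrite (_ : tadd _ _ = y) //.
    by apply: tupleP2 => i; rewrite !tnth_mktuple addrAC subrr add0r.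
  move=> [? h]; split=> //; move: h; rewrite (_ : tadd _ _ = y) //.
  by apply: tupleP2 => i; rewrite !tnth_mktuple addrAC subrr add0r.
rewrite sections_swap //; apply: integral_cond_cst => // z Sz; last first.
  rewrite (_ : ysection Q2 z = set0) ?measure0 //.
  by apply/seteqP; split=> x //; rewrite /ysection /= inE /Q2 /= => -[].
rewrite -(mT (topp z) (@topp n @^-1` D)); last first.
  by apply: measurable_preim => //; exact: measurable_topp.
have e x : topp (tadd (topp z) x) = tadd z (topp x).
  by apply: tupleP2 => i; rewrite !tnth_mktuple opprD opprK.
congr (m _); apply/seteqP; split=> x; rewrite /ysection /= inE /Q2 /= e //.
by case.
Qed.

(** For a symmetric [D] on which both measures agree, [trans_inv_swap] becomes an identity from
    which the finite positive number [ltm n D] cancels. *)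
Lemma trans_inv_unique n (m : {measure set (T n) -> \bar R}) (D : set (T n)) :
  (forall r : R, 0 <= r -> (m (tcube r) < +oo)%E) ->
  (forall s S, measurable S -> m ((fun t => tadd s t) @^-1` S) = m S) ->
  measurable D -> @topp n @^-1` D = D -> m D = ltm n D ->
  (0 < ltm n D < +oo)%E ->
  forall S, measurable S -> m S = ltm n S.
Proof.
move=> /sigma_finite_cubes /sigma_finite_ex [m' m'E] mT mD DD mDE /andP[D0 Doo] S mS.
have := @trans_inv_swap n m' _ S D mS mD.
rewrite DD !m'E mDE => /(_ _) h.
have {}h : (m S * ltm n D = ltm n D * ltm n S)%E.
  by apply: h => s S' mS'; rewrite !m'E; exact: mT.
have Df : ltm n D \is a fin_num by rewrite ge0_fin_numE.
have d0 : fine (ltm n D) != 0 by rewrite fine_eq0 // gt_eqF.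
move: h; rewrite muleC -(fineK Df) => h.
have : ((fine (ltm n D))^-1%:E * ((fine (ltm n D))%:E * m S) =
        (fine (ltm n D))^-1%:E * ((fine (ltm n D))%:E * ltm n S))%E by rewrite h.
by rewrite !muleA -!EFinM mulVf // !mul1e.
Qed.

Lemma topp_tcube n r : @topp n @^-1` (tcube r) = tcube r.
Proof.
by apply/seteqP; split=> t /= h i; have := h i; rewrite tnth_mktuple normrN.
Qed.

Lemma trans_inv_unique_cube n (m : {measure set (T n) -> \bar R}) :
  (forall r : R, 0 <= r -> (m (tcube r) < +oo)%E) ->
  (forall s S, measurable S -> m ((fun t => tadd s t) @^-1` S) = m S) ->
  m (tcube 1) = (2 ^+ n)%:E ->
  forall S, measurable S -> m S = ltm n S.
Proof.
move=> h1 h2 h3; apply: (@trans_inv_unique n m (tcube 1)) => //.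
- exact: measurable_tcube.
- exact: topp_tcube.
- by rewrite ltm_cube // mulr1.
- by rewrite ltm_cube // mulr1 lte_fin exprn_gt0 ?ltry.
Qed.

Definition tnorm2 n (t : T n) : R := \sum_i tnth t i ^+ 2.

Lemma measurable_tnorm2 n : measurable_fun setT (@tnorm2 n).
Proof.
apply: measurable_sum => i; apply: measurable_funX; exact: measurable_tnth.
Qed.

Lemma tnorm2_ge n (t : T n) i : tnth t i ^+ 2 <= tnorm2 t.
Proof.
by rewrite /tnorm2 (bigD1 i) //= lerDl sumr_ge0 // => j _; exact: sqr_ge0.
Qed.

Lemma measurable_ball_tnorm2 n (r : R) : measurable [set t : T n | tnorm2 t <= r].
Proof.
rewrite (_ : [set t | _] = (@tnorm2 n) @^-1` `]-oo, r]%classic); last first.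
  by apply/seteqP; split=> x /=; rewrite in_itv.
by apply: measurable_preim => //; exact: measurable_tnorm2.
Qed.

(** The unit ball serves as the symmetric reference set: a norm-preserving map leaves it fixed, so
    invariance follows from uniqueness, without determinants. *)
Lemma ltm_isometry n (f : T n -> T n) : measurable_fun setT f ->
  (forall s t, f (tadd s t) = tadd (f s) (f t)) ->
  (forall s, exists t, f t = s) ->
  (forall t, tnorm2 (f t) = tnorm2 t) ->
  forall S, measurable S -> ltm n (f @^-1` S) = ltm n S.
Proof.
move=> mf fD fs fn S mS.
have [m mE] := pushforward_ex (ltm n) mf.
rewrite -mE; apply: (@trans_inv_unique n m [set t | tnorm2 t <= 1]) => //.
- move=> r r0; rewrite mE.
  apply: (@le_lt_trans _ _ (ltm n (tcube (1 + n%:R * r ^+ 2)))).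
    apply: le_measure; rewrite ?inE.
    + by apply: measurable_preim => //; exact: measurable_tcube.
    + exact: measurable_tcube.
    + move=> t h i; have := tnorm2_ge t i; rewrite -fn /tnorm2 => h2.
      have {}h2 : tnth t i ^+ 2 <= n%:R * r ^+ 2.
        apply: le_trans h2 _; rewrite mulr_natl -[X in _ *+ X]card_ord -sumr_const.
        apply: ler_sum => j _; rewrite -[leLHS]real_normK ?num_real //.
        by rewrite ler_pXn2r ?nnegrE //; exact: h.
      rewrite -[_ ^+ 2]real_normK ?num_real // in h2.
      by move: (`|_|) (n%:R * _) (normr_ge0 (tnth t i)) h2 => a b; nra.
  by rewrite ltm_cube ?ltry // addr_ge0 // mulr_ge0 // sqr_ge0.
- move=> s S' mS'; rewrite !mE; have [s' <-] := fs s.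
  rewrite -[RHS](ltm_trans s'); last exact: measurable_preim.
  by congr (ltm n _); apply/seteqP; split=> t /=; rewrite fD.
- exact: measurable_ball_tnorm2.
- have e t : tnorm2 (@topp n t) = tnorm2 t.
    by apply: eq_bigr => i _; rewrite tnth_mktuple sqrrN.
  by apply/seteqP; split=> t /=; rewrite e.
- by rewrite mE; congr (ltm n _); apply/seteqP; split=> t /=; rewrite fn.
(* The ball contains the cube of half-side 1/(n+1) and lies in the cube of half-side 1. *)
- apply/andP; split.
    apply: (@lt_le_trans _ _ (ltm n (tcube (n.+1%:R^-1)))).
      by rewrite ltm_cube ?invr_ge0 // lte_fin exprn_gt0 // mulr_gt0 ?invr_gt0.
    apply: le_measure; rewrite ?inE; [exact: measurable_tcube|exact: measurable_ball_tnorm2|].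
    move=> t h /=; rewrite /tnorm2.
    have h2 i : tnth t i ^+ 2 <= n.+1%:R^-1.
      apply: (@le_trans _ _ (n.+1%:R^-1 ^+ 2)).
        rewrite -[leLHS]real_normK ?num_real //.
        by rewrite ler_pXn2r ?nnegrE ?invr_ge0 //; exact: h.
      by rewrite expr2 ler_piMl ?invr_ge0 // invf_le1 ?ltr0n // ler1n.
    apply: le_trans (ler_sum _ (fun i _ => h2 i)) _.
    rewrite sumr_const card_ord -[leLHS]mulr_natl ler_pdivrMr ?ltr0n // mul1r ler_nat //.
  apply: (@le_lt_trans _ _ (ltm n (tcube 1))); last by rewrite ltm_cube ?ltry.
  apply: le_measure; rewrite ?inE; [exact: measurable_ball_tnorm2|exact: measurable_tcube|].
  move=> t /= h i; have := le_trans (tnorm2_ge t i) h.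
  rewrite -[_ ^+ 2]real_normK ?num_real // => h2.
  by move: (`|_|) (normr_ge0 (tnth t i)) h2 => a; nra.
Qed.

End TupleMeasure.

(** * Product formula for coordinates split into groups *)

Section TupleProduct.
Variable R : realType.
Local Notation M := (measurableTypeR R).
Local Notation T n := (n.-tuple M).

Lemma product_trans n1 n2 (a : T n1) (b : T n2) (Q : set (T n1 * T n2)) :
  measurable Q ->
  ((ltm R n1 \x ltm R n2) ((fun p => (tadd a p.1, tadd b p.2)) @^-1` Q) =
   (ltm R n1 \x ltm R n2) Q)%E.
Proof.
move=> mQ; rewrite /product_measure1.
have mD m (u : T m) : measurable_fun setT (fun t => tadd u t).
  apply: measurable_tupleP => i; under eq_fun do rewrite tnth_mktuple.
  by apply: measurable_funD; [exact: measurable_cst|exact: measurable_tnth].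
transitivity (\int[ltm R n1]_x (ltm R n2 (xsection Q (tadd a x))))%E.
  apply: eq_integral => x _ /=; rewrite -[RHS](ltm_trans b); last exact: measurable_xsection.
  by congr (ltm R n2 _); apply/seteqP; split=> t; rewrite /xsection /= !inE.
have mg : measurable_fun setT (fun x : T n1 => ltm R n2 (xsection Q x)).
  exact: measurable_fun_xsection.
have g0 : {in [set: T n1], forall x, (0 <= ltm R n2 (xsection Q x))%E}.
  by move=> ? _; exact: measure_ge0.
have E := ge0_integral_pushforward (mD _ a) (ltm R n1) measurableT mg g0.
rewrite preimage_setT in E; refine (eq_trans (esym E) _).
apply: eq_measure_integral; first exact: mD.
by move=> ? U mU _; exact: (ltm_trans a mU).
Qed.

(** The two groups of coordinates may be interleaved, so the recursive construction does not apply.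
    The product measure, regrouped by [g], is translation invariant and has the right mass on the
    unit cube, which identifies it. *)
Lemma ltm_product n n1 n2 (i1 : 'I_n1 -> 'I_n) (i2 : 'I_n2 -> 'I_n)
    (s : 'I_n -> 'I_n1 + 'I_n2) :
  (forall i, match s i return Prop with inl j => i1 j = i | inr j => i2 j = i end) ->
  (forall j, s (i1 j) = inl j) -> (forall j, s (i2 j) = inr j) ->
  forall (S1 : set (T n1)) (S2 : set (T n2)), measurable S1 -> measurable S2 ->
  ltm R n [set t | S1 [tuple tnth t (i1 j) | j < n1] /\
                   S2 [tuple tnth t (i2 j) | j < n2]] =
  (ltm R n1 S1 * ltm R n2 S2)%E.
Proof.
move=> si s1 s2 S1 S2 mS1 mS2.
pose g (p : T n1 * T n2) : T n :=
  [tuple match s i with inl j => tnth p.1 j | inr j => tnth p.2 j end | i < n].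
have mg : measurable_fun setT g.
  apply: measurable_tupleP => i; under eq_fun do rewrite tnth_mktuple.
  by case: (s i) => j; apply: measurable_tnthc.
have [m mE] := pushforward_ex (ltm R n1 \x ltm R n2)%E mg.
have gcube r : g @^-1` (tcube r) = tcube r `*` tcube r.
  apply/seteqP; split=> [[a b] h|[a b] [ha hb] i].
    by split=> j /=; [have := h (i1 j)|have := h (i2 j)];
      rewrite tnth_mktuple ?s1 ?s2.
  by rewrite tnth_mktuple; case: (s i).
have cardn : n = (n1 + n2)%N.
  have h1 : {on predT, bijective s}.
    exists (fun z => match z with inl j => i1 j | inr j => i2 j end) => i _.
      by have := si i; case: (s i).
    by case: i.
  have /bij_eq_card : bijective s.
    by case: h1 => s' k1 k2; exists s' => x; [exact: k1|exact: k2].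
  by rewrite card_sum !card_ord.
have muC (r : R) : 0 <= r -> m (tcube r) = ((2 * r) ^+ n)%:E.
  move=> r0; rewrite mE gcube.
  transitivity (ltm R n1 (tcube r) * ltm R n2 (tcube r))%E.
    by apply: (product_measure1E (ltm R n1) (ltm R n2)); exact: measurable_tcube.
  by rewrite !ltm_cube // -EFinM cardn exprD.
have mS : measurable ([set t | S1 [tuple tnth t (i1 j) | j < n1] /\
                   S2 [tuple tnth t (i2 j) | j < n2]] : set (T n)).
  apply: (@measurableI _ _ ((fun t : T n => [tuple tnth t (i1 j) | j < n1]) @^-1` S1)
    ((fun t : T n => [tuple tnth t (i2 j) | j < n2]) @^-1` S2));
  apply: measurable_preim => //; apply: measurable_tupleP => i;
  under eq_fun do rewrite tnth_mktuple; exact: measurable_tnth.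
rewrite -(@trans_inv_unique_cube R n m) //.
- rewrite mE; transitivity ((ltm R n1 \x ltm R n2)%E (S1 `*` S2)); last first.
    exact: (product_measure1E (ltm R n1) (ltm R n2)).
  congr ((_ \x _)%E _).
  have e1 p : [tuple tnth (g p) (i1 j) | j < n1] = p.1.
    by apply: tupleP2 => j; rewrite !tnth_mktuple s1.
  have e2 p : [tuple tnth (g p) (i2 j) | j < n2] = p.2.
    by apply: tupleP2 => j; rewrite !tnth_mktuple s2.
  by apply/seteqP; split=> p /=; rewrite e1 e2.
- by move=> r r0; rewrite muC // ltry.
- move=> u S mS'; rewrite !mE.
  rewrite -[RHS](product_trans [tuple tnth u (i1 j) | j < n1] [tuple tnth u (i2 j) | j < n2]).
    congr ((_ \x _)%E _).
    have e p : g (tadd [tuple tnth u (i1 j) | j < n1] p.1,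
                  tadd [tuple tnth u (i2 j) | j < n2] p.2) = tadd u (g p).
      apply: tupleP2 => i; rewrite !tnth_mktuple.
      by have := si i; case: (s i) => j <-; rewrite !tnth_mktuple.
    by apply/seteqP; split=> p /=; rewrite e.
  exact: measurable_preim.
- by rewrite muC // mulr1.
Qed.

Lemma ltm_setT0 : ltm R 0 setT = 1%E.
Proof.
rewrite (_ : setT = tcube 1); first by rewrite ltm_cube // expr0.
by apply/seteqP; split=> // t _ [].
Qed.

(** Injectivity compares [j] and [j'] as natural numbers because their types depend on [k] and
    [k']. *)
Lemma ltm_bigproduct l : forall n (ns : 'I_l -> nat) (ii : forall k, 'I_(ns k) -> 'I_n),
  (forall i, exists k j, ii k j = i) ->
  (forall k k' j j', ii k j = ii k' j' -> k = k' /\ (j = j' :> nat)) ->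
  forall S : forall k, set (T (ns k)), (forall k, measurable (S k)) ->
  ltm R n [set t | forall k, S k [tuple tnth t (ii k j) | j < ns k]] =
  (\prod_(k < l) ltm R (ns k) (S k))%E.
Proof.
elim: l => [|l IH] n ns ii onto inj S mS.
  have n0 : n = 0%N by case: n ii onto {inj} => // n ii /(_ ord0) [[]].
  subst n; rewrite big_ord0 -[RHS]ltm_setT0; congr (ltm R 0 _).
  by apply/seteqP; split=> // t _ [].
(* The coordinates outside the first group, renumbered by their rank in [C], form the smaller tuple
   of the induction. *)
pose C := {i : 'I_n | i \notin codom (ii ord0)}.
pose n2 := #|{: C}|.
pose i2 (j : 'I_n2) : 'I_n := val (enum_val j : C).
pose s (i : 'I_n) : 'I_(ns ord0) + 'I_n2 :=
  match pselect (i \in codom (ii ord0)) with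
  | left h => inl (iinv h)
  | right h => inr (enum_rank (exist _ i (introN idP h) : C))
  end.
have si i : match s i return Prop with inl j => ii ord0 j = i | inr j => i2 j = i end.
  rewrite /s; case: pselect => h; first exact: f_iinv.
  by rewrite /i2 enum_rankK.
have s1 j : s (ii ord0 j) = inl j.
  rewrite /s; case: pselect => h; last by case: h; exact: codom_f.
  by congr inl; have /inj [_ e] := f_iinv h; exact/val_inj.
have s2 j : s (i2 j) = inr j.
  have := valP (enum_val j : C); rewrite /= -/(i2 j) /s => nj.
  case: pselect => h; first by rewrite h in nj.
  by congr inr; apply: enum_val_inj; rewrite enum_rankK; apply/val_inj.
clearbody s.
have nk k j : ii (lift ord0 k) j \notin codom (ii ord0).
  by apply/codomP => -[j' /inj [/eqP]]; rewrite eq_sym (negbTE (neq_lift _ _)).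
pose ii2 k (j : 'I_(ns (lift ord0 k))) : 'I_n2 := enum_rank (exist _ (ii (lift ord0 k) j) (nk k j) : C).
have i2E k j : i2 (@ii2 k j) = ii (lift ord0 k) j by rewrite /i2 /ii2 enum_rankK.
rewrite big_ord_recl /= -(IH n2 (fun k => ns (lift ord0 k)) ii2 _ _ (fun k => S (lift ord0 k))) //.
- rewrite -(@ltm_product n (ns ord0) n2 (ii ord0) i2 s si s1 s2) //.
    congr (ltm R n _); apply/seteqP; split=> t /=.
      move=> h; split=> [|k]; first exact: h.
      rewrite (_ : [tuple _ | _ < _] = [tuple tnth t (ii (lift ord0 k) j) | j < _]); first exact: h.
      by apply: tupleP2 => j; rewrite !tnth_mktuple i2E.
    move=> [h0 h] k; case: (unliftP ord0 k) => [k'|] -> //.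
    rewrite (_ : [tuple _ | _ < _] = [tuple tnth [tuple tnth t (i2 j0) | j0 < n2] (ii2 k' j) | j < _]); first exact: h.
    by apply: tupleP2 => j; rewrite !tnth_mktuple i2E.
  rewrite (_ : [set t | _] = \bigcap_(k in [set: 'I_l]) ((fun t : T n2 => [tuple tnth t (ii2 k j) | j < _]) @^-1` S (lift ord0 k))).
    apply: fin_bigcap_measurable => //= k _; apply: measurable_preim; last exact: mS.
    apply: measurable_tupleP => i; under eq_fun do rewrite tnth_mktuple; exact: measurable_tnth.
  apply/seteqP; split=> t h k //=; exact: (h k).
- move=> i; have [k [j e]] := onto (i2 i).
  case: (unliftP ord0 k) j e => [k'|] -> j e.
    by exists k', j; apply: (inr_inj (A := 'I_(ns ord0))); rewrite -s2 i2E e s2.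
  by have := s2 i; rewrite -e s1.
- move=> k k' j j' e; have : ii (lift ord0 k) j = ii (lift ord0 k') j' by rewrite -!i2E e.
  by move=> /inj [/lift_inj].
Qed.

End TupleProduct.

Local Open Scope complex_scope.
Local Notation Re := complex.Re.
Local Notation Im := complex.Im.

(** * Tuples of self-adjoint matrices and unitary conjugation *)

Section Normc.
Variable R : realType.
Local Notation C := R[i].
Implicit Types x y z : C.

Lemma normcE z : `|z| = (normc z)%:C.
Proof. by rewrite normc_def; case: z. Qed.
Lemma normc_ge0 z : 0 <= normc z.
Proof. by case: z => a b; exact: sqrtr_ge0. Qed.
Lemma normcD x y : normc (x + y) <= normc x + normc y.
Proof. by rewrite -lecR rmorphD /= -!normcE ler_normD. Qed.
Lemma normcM x y : normc (x * y) = normc x * normc y.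
Proof. by apply: (@complexI R); rewrite rmorphM /= -!normcE normrM. Qed.
Lemma normcN x : normc (- x) = normc x.
Proof. by apply: (@complexI R); rewrite -!normcE normrN. Qed.
Lemma normcB x y : normc (x - y) <= normc x + normc y.
Proof. by rewrite -[normc y]normcN normcD. Qed.
Lemma normcX x n : normc (x ^+ n) = normc x ^+ n.
Proof. by apply: (@complexI R); rewrite rmorphXn /= -!normcE normrX. Qed.
Lemma normc_conj x : normc (Num.conj x) = normc x.
Proof. by case: x => a b /=; rewrite sqrrN. Qed.
Lemma normc_real (a : R) : normc a%:C = `|a|.
Proof. by rewrite /= expr0n /= addr0 sqrtr_sqr. Qed.
Lemma normcMr (a : R) x : normc (a%:C * x) = `|a| * normc x.
Proof. by rewrite normcM normc_real. Qed.
Lemma normc0 : normc (0 : C) = 0.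
Proof. by rewrite (normc_real 0) normr0. Qed.
Lemma normc1 : normc (1 : C) = 1.
Proof. by rewrite (normc_real 1) normr1. Qed.
Lemma normc_eq0 x : normc x = 0 -> x = 0.
Proof. by move=> h; apply/eqP; rewrite -normr_eq0 normcE h. Qed.
Lemma normc_sum (I : Type) (r : seq I) (P : pred I) (F : I -> C) :
  normc (\sum_(i <- r | P i) F i) <= \sum_(i <- r | P i) normc (F i).
Proof.
elim/big_ind2: _ => [|x a y b h h'|//]; first by rewrite normc0.
by apply: le_trans (normcD _ _) _; apply: lerD.
Qed.
Lemma normc_sqr x : normc x ^+ 2 = Re x ^+ 2 + Im x ^+ 2.
Proof. by case: x => a b /=; rewrite sqr_sqrtr // addr_ge0 ?sqr_ge0. Qed.
Lemma normc_ge_Re x : `|Re x| <= normc x.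
Proof.
rewrite -(@ler_pXn2r _ 2) ?nnegrE ?normc_ge0 // normc_sqr real_normK ?num_real //.
by rewrite lerDl sqr_ge0.
Qed.
Lemma normc_ge_Im x : `|Im x| <= normc x.
Proof.
rewrite -(@ler_pXn2r _ 2) ?nnegrE ?normc_ge0 // normc_sqr real_normK ?num_real //.
by rewrite lerDr sqr_ge0.
Qed.
Lemma normc_le_ReIm x : normc x <= `|Re x| + `|Im x|.
Proof.
rewrite -(@ler_pXn2r _ 2) ?nnegrE ?normc_ge0 ?addr_ge0 // normc_sqr sqrrD !real_normK ?num_real //.
by rewrite addrAC lerDl mulrn_wge0 // mulr_ge0.
Qed.
Lemma ReD x y : Re (x + y) = Re x + Re y. Proof. by case: x; case: y. Qed.
Lemma ImD x y : Im (x + y) = Im x + Im y. Proof. by case: x; case: y. Qed.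
Lemma ReN x : Re (- x) = - Re x. Proof. by case: x. Qed.
Lemma ImN x : Im (- x) = - Im x. Proof. by case: x. Qed.
Lemma ReM x y : Re (x * y) = Re x * Re y - Im x * Im y.
Proof. by case: x; case: y. Qed.
Lemma ImM x y : Im (x * y) = Re x * Im y + Im x * Re y.
Proof. by case: x; case: y. Qed.
Lemma ReMr (a : R) x : Re (a%:C * x) = a * Re x.
Proof. by rewrite ReM /= mul0r subr0. Qed.
Lemma Re_conj x : Re (Num.conj x) = Re x. Proof. by case: x. Qed.
Lemma Im_conj x : Im (Num.conj x) = - Im x. Proof. by case: x. Qed.
Lemma mulC_conj x : x * Num.conj x = (normc x ^+ 2)%:C.
Proof. by rewrite -normCK normcE -rmorphXn. Qed.

Section CMeas.
Context d (T : measurableType d).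
Definition cmeas (g : T -> C) :=
  measurable_fun setT (fun t => Re (g t)) /\ measurable_fun setT (fun t => Im (g t)).

Lemma cmeas_cst c : cmeas (fun=> c).
Proof. by split; exact: measurable_cst. Qed.
Lemma cmeasD g h : cmeas g -> cmeas h -> cmeas (fun t => g t + h t).
Proof.
move=> [g1 g2] [h1 h2]; split.
  by under eq_fun do rewrite ReD; exact: measurable_funD.
by under eq_fun do rewrite ImD; exact: measurable_funD.
Qed.
Lemma cmeasM g h : cmeas g -> cmeas h -> cmeas (fun t => g t * h t).
Proof.
move=> [g1 g2] [h1 h2]; split.
  by under eq_fun do rewrite ReM; apply: measurable_funB; exact: measurable_funM.
by under eq_fun do rewrite ImM; apply: measurable_funD; exact: measurable_funM.
Qed.
Lemma cmeas_conj g : cmeas g -> cmeas (fun t => Num.conj (g t)).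
Proof.
move=> [g1 g2]; split; first by under eq_fun do rewrite Re_conj.
by under eq_fun do rewrite Im_conj; exact: measurableT_comp.
Qed.
Lemma cmeas_real (g : T -> R) : measurable_fun setT g -> cmeas (fun t => (g t)%:C).
Proof. by move=> mg; split=> //=; exact: measurable_cst. Qed.
Lemma cmeasMl c g : cmeas g -> cmeas (fun t => c * g t).
Proof. by move=> mg; apply: cmeasM => //; exact: cmeas_cst. Qed.
Lemma cmeasN g : cmeas g -> cmeas (fun t => - g t).
Proof. by move=> mg; under eq_fun do rewrite -mulN1r; exact: cmeasMl. Qed.
Lemma cmeasB g h : cmeas g -> cmeas h -> cmeas (fun t => g t - h t).
Proof. by move=> mg mh; apply: cmeasD => //; exact: cmeasN. Qed.
Lemma cmeasX g n : cmeas g -> cmeas (fun t => g t ^+ n).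
Proof.
move=> mg; elim: n => [|n IH]; first by under eq_fun do rewrite expr0; exact: cmeas_cst.
by under eq_fun do rewrite exprS; exact: cmeasM.
Qed.
Lemma cmeas_sum (I : Type) (r : seq I) (P : pred I) (F : I -> T -> C) :
  (forall i, cmeas (F i)) -> cmeas (fun t => \sum_(i <- r | P i) F i t).
Proof.
move=> mF; elim: r => [|i r IH]; first by under eq_fun do rewrite big_nil; exact: cmeas_cst.
under eq_fun do rewrite big_cons; case: (P i) => //; exact: cmeasD.
Qed.
Lemma cmeas_normc g : cmeas g -> measurable_fun setT (fun t => normc (g t) ^+ 2).
Proof.
move=> [g1 g2]; under eq_fun do rewrite normc_sqr.
by apply: measurable_funD; exact: measurable_funX.
Qed.
Definition mxmeas m n (g : T -> 'M[C]_(m, n)) := forall i j, cmeas (fun t => g t i j).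
Lemma mxmeas_cst m n (c : 'M[C]_(m, n)) : mxmeas (fun=> c).
Proof. by move=> i j; exact: cmeas_cst. Qed.
Lemma mxmeasM m n p (g : T -> 'M[C]_(m, n)) (h : T -> 'M[C]_(n, p)) :
  mxmeas g -> mxmeas h -> mxmeas (fun t => g t *m h t).
Proof.
move=> mg mh i j; under eq_fun do rewrite mxE.
by apply: cmeas_sum => k; exact: cmeasM.
Qed.
Lemma cmeas_tr n (g : T -> 'M[C]_n) : mxmeas g -> cmeas (fun t => \tr (g t)).
Proof. by move=> mg; rewrite /mxtrace; apply: cmeas_sum => i; exact: mg. Qed.
End CMeas.
End Normc.

Section Coordinates.
Variables (R : realType) (P : finType) (d : nat).
Local Notation C := R[i].
Local Notation Mt := (measurableTypeR R).
Local Notation N := #|{: P * 'I_d * 'I_d}|.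
Local Notation T := (N.-tuple Mt).

Definition adj m n (B : 'M[C]_(m, n)) : 'M[C]_(n, m) := map_mx Num.conj B^T.

Lemma adjM m n p (A : 'M[C]_(m, n)) (B : 'M[C]_(n, p)) : adj (A *m B) = adj B *m adj A.
Proof. by rewrite /adj trmx_mul map_mxM. Qed.
Lemma adjK m n (A : 'M[C]_(m, n)) : adj (adj A) = A.
Proof. by apply/matrixP => i j; rewrite !mxE conjCK. Qed.
Lemma adj_herm n (A : 'M[C]_n) : (A \is hermsymmx) = (adj A == A).
Proof. by rewrite is_hermitianmxE expr0 scale1r eq_sym. Qed.

Definition conf (t : T) (p : P) : 'M[C]_d :=
  sa_mx (fun i j => tnth t (enum_rank (p, i, j))).

Lemma adj_conf t p : adj (conf t p) = conf t p.
Proof. by apply/eqP; rewrite -adj_herm sa_mx_hermitian. Qed.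

(** The witness of [sa_mx_onto] as an explicit function, so that measurability and additivity of
    maps of matrices pass to coordinates. *)
Definition sa_coord (B : 'M[C]_d) (i j : 'I_d) : R :=
  if i == j then Re (B i i) else
   (if (i < j)%N then Re (B i j) else Im (B j i)) * Num.sqrt 2.

Let s2 : (Num.sqrt 2 : R) != 0. Proof. by rewrite sqrtr_eq0 -ltNge ltr0n. Qed.

Lemma sa_coordK B : adj B = B -> sa_mx (sa_coord B) = B.
Proof.
move=> hB; apply/matrixP => i j; rewrite !mxE /sa_coord [j == i]eq_sym.
have {hB} := congr1 (fun A : 'M[C]_d => A i j) hB; rewrite !mxE; case: eqVneq => [->|ij].
  by case: (B j j) => a b /= [e]; apply/eqP; rewrite eq_complex /= eqxx /=; lra.
have := ij; rewrite -val_eqE neq_ltn /= => /orP[lt|lt];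
  rewrite lt ltnNge (ltnW lt) /= !mulfK //.
  by move=> _; case: (B i j).
by move=> <-; case: (B j i).
Qed.

Lemma sa_mxK x i j : sa_coord (sa_mx x) i j = x i j.
Proof.
rewrite /sa_coord !mxE eqxx [j == i]eq_sym; case: eqVneq => [->|ij] //=.
have := ij; rewrite -val_eqE neq_ltn /= => /orP[lt|lt]; first by rewrite lt /= divfK.
by rewrite ltnNge (ltnW lt) /= lt /= divfK.
Qed.

Lemma sa_coordD A B i j : sa_coord (A + B) i j = sa_coord A i j + sa_coord B i j.
Proof.
by rewrite /sa_coord !mxE; case: (i == j); case: (i < j)%N; rewrite ?ReD ?ImD ?mulrDl.
Qed.

Lemma confD (s t : T) p : conf (tadd s t) p = conf s p + conf t p.
Proof.
apply/matrixP => i j; rewrite !mxE !tnth_mktuple; case: eqP => _; first by rewrite rmorphD.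
by case: ifP => _; apply/eqP; rewrite eq_complex /= !mulrDl ?opprD !eqxx.
Qed.

Lemma mxmeas_conf p : mxmeas (fun t : T => conf t p).
Proof.
move=> i j; under eq_fun do rewrite mxE.
have mt (q : 'I_N) (c : R) : measurable_fun [set: T] (fun t => tnth t q / c).
  by apply: measurable_funM => //; exact: measurable_tnth.
case: (i == j); first by apply: cmeas_real; exact: measurable_tnth.
by case: (i < j)%N; split => //=; apply: measurableT_comp => //; exact: mt.
Qed.

Lemma measurable_sa_coord d' (T' : measurableType d') (g : T' -> 'M[C]_d) i j :
  mxmeas g -> measurable_fun setT (fun t => sa_coord (g t) i j).
Proof.
move=> mg; rewrite /sa_coord; case: eqP => _; first by case: (mg i i).
apply: measurable_funM; last exact: measurable_cst.
by case: (i < j)%N; [case: (mg i j)|case: (mg j i)].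
Qed.

Definition unconf (B : P -> 'M[C]_d) : T :=
  [tuple sa_coord (B (enum_val q).1.1) (enum_val q).1.2 (enum_val q).2 | q < N].

Lemma unconfK B : (forall p, adj (B p) = B p) -> forall p, conf (unconf B) p = B p.
Proof.
move=> hB p; rewrite -[RHS]sa_coordK //; congr sa_mx; apply/funext => i; apply/funext => j.
by rewrite tnth_mktuple enum_rankK.
Qed.

Lemma confK t : unconf (conf t) = t.
Proof.
by apply: tupleP2 => q; rewrite tnth_mktuple sa_mxK -!surjective_pairing enum_valK.
Qed.

Lemma tnorm2_conf (t : T) : tnorm2 t = \sum_p Re (\tr (conf t p *m conf t p)).
Proof.
rewrite /tnorm2 (reindex (@enum_rank {: P * 'I_d * 'I_d})) /=; last first.
  by exists enum_val => x _; [exact: enum_rankK|exact: enum_valK].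
transitivity (\sum_p \sum_i \sum_j tnth t (enum_rank (p, i, j)) ^+ 2).
  by rewrite pair_bigA pair_bigA /=; apply: eq_bigr => -[[p i] j].
apply: eq_bigr => p _; rewrite sa_mx_isometry /=.
by apply: eq_bigr => i _; apply: eq_bigr => j _; rewrite expr2.
Qed.

Definition unitary (U : 'M[C]_d) := adj U *m U = 1%:M /\ U *m adj U = 1%:M.

Variable b : pred P.

Definition uconj (U : 'M[C]_d) (B : P -> 'M[C]_d) (p : P) : 'M[C]_d :=
  if b p then U *m B p *m adj U else B p.

Definition act (U : 'M[C]_d) (t : T) : T := unconf (uconj U (conf t)).

Lemma conf_act U t p : conf (act U t) p = uconj U (conf t) p.
Proof.
apply: unconfK => {}p; rewrite /uconj; case: (b p); last exact: adj_conf.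
by rewrite !adjM adjK adj_conf mulmxA.
Qed.

Lemma measurable_act U : measurable_fun setT (act U).
Proof.
apply: measurable_tupleP => q; under eq_fun do rewrite tnth_mktuple.
apply: measurable_sa_coord; rewrite /uconj; case: (b _); last exact: mxmeas_conf.
apply: mxmeasM; last exact: mxmeas_cst.
by apply: mxmeasM; [exact: mxmeas_cst|exact: mxmeas_conf].
Qed.

Lemma actK U t : adj U *m U = 1%:M -> act (adj U) (act U t) = t.
Proof.
move=> hU; rewrite -[RHS]confK; congr unconf; apply/funext => p.
rewrite /uconj conf_act /uconj; case: (b p) => //.
by rewrite adjK !mulmxA hU mul1mx -mulmxA hU mulmx1.
Qed.

(** In coordinates the squared norm is the sum of the Tr(A_p^2), which conjugation preserves. *)
Lemma ltm_act U S : unitary U -> measurable S ->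
  ltm R N (act U @^-1` S) = ltm R N S.
Proof.
move=> [hU hU'] mS; apply: ltm_isometry => //.
- exact: measurable_act.
- move=> s t; apply: tupleP2 => q; rewrite !tnth_mktuple -sa_coordD; congr sa_coord.
  by rewrite /uconj confD; case: (b _) => //; rewrite mulmxDr mulmxDl.
- by move=> s; exists (act (adj U) s); have := @actK (adj U) s; rewrite adjK; apply.
- move=> t; rewrite !tnorm2_conf; apply: eq_bigr => p _; rewrite conf_act /uconj.
  case: (b p) => //; congr (Re _).
  by rewrite -!mulmxA mxtrace_mulC !mulmxA -(mulmxA _ (adj U) U) hU mulmx1 -!mulmxA hU mulmx1.
Qed.

End Coordinates.

(** * Integration by parts along unitary conjugation *)

Section ComplexIntegral.
Context (R : realType) d0 (T : measurableType d0) (mu : {measure set T -> \bar R}).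
Local Notation C := R[i].
Variable S : set T.
Hypotheses (mS : measurable S) (Sfin : (mu S < +oo)%E).

(** Bounded measurable on [S]: a class of integrable functions closed under all operations used
    below, including products. *)
Definition cok (g : T -> C) :=
  cmeas g /\ exists K, forall t, S t -> normc (g t) <= K.
(** Only real parts are integrated; complex identities are recovered by inserting a complex factor,
    as in [IBP_span]. *)
Definition cI (g : T -> C) : R := \int[mu]_(t in S) Re (g t).

Lemma cok_cst c : cok (fun=> c).
Proof. by split; [exact: cmeas_cst|exists (normc c)]. Qed.
Lemma cokD g h : cok g -> cok h -> cok (fun t => g t + h t).
Proof.
move=> [mg [K hK]] [mh [L hL]]; split; first exact: cmeasD.
by exists (K + L) => t St; apply: le_trans (normcD _ _) _; apply: lerD; [exact: hK|exact: hL].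
Qed.
Lemma cokM g h : cok g -> cok h -> cok (fun t => g t * h t).
Proof.
move=> [mg [K hK]] [mh [L hL]]; split; first exact: cmeasM.
exists (K * L) => t St; rewrite normcM.
by apply: ler_pM; rewrite ?normc_ge0 //; [exact: hK|exact: hL].
Qed.
Lemma cok_conj g : cok g -> cok (fun t => Num.conj (g t)).
Proof.
move=> [mg [K hK]]; split; first exact: cmeas_conj.
by exists K => t St; rewrite normc_conj; exact: hK.
Qed.
Lemma cokX g n : cok g -> cok (fun t => g t ^+ n).
Proof.
move=> [mg [K hK]]; split; first exact: cmeasX.
exists (K ^+ n) => t St; rewrite normcX.
by have := hK t St => h; rewrite lerXn2r // nnegrE ?normc_ge0 //; apply: le_trans h; exact: normc_ge0.
Qed.
Lemma cok_sum (I : Type) (r : seq I) (F : I -> T -> C) :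
  (forall i, cok (F i)) -> cok (fun t => \sum_(i <- r) F i t).
Proof.
move=> mF; elim: r => [|i r IH]; first by under eq_fun do rewrite big_nil; exact: cok_cst.
by under eq_fun do rewrite big_cons; exact: cokD.
Qed.

Lemma cok_integrable g : cok g -> mu.-integrable S (EFin \o (fun t => Re (g t))).
Proof.
move=> [[mg _] [K hK]]; apply: measurable_bounded_integrable => //.
  exact: measurable_funS mg.
exists K; split; first exact: num_real.
by move=> M KM t St; apply: le_trans (normc_ge_Re _) (le_trans (hK t St) (ltW KM)).
Qed.

Lemma cID g h : cok g -> cok h -> cI (fun t => g t + h t) = cI g + cI h.
Proof.
move=> cg ch; rewrite /cI -RintegralD //; try exact: cok_integrable.
by apply: eq_Rintegral => t _; rewrite ReD.
Qed.
Lemma cIZ (a : R) g : cok g -> cI (fun t => a%:C * g t) = a * cI g.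
Proof.
move=> cg; rewrite /cI -RintegralZl //; last exact: cok_integrable.
by apply: eq_Rintegral => t _; rewrite ReMr.
Qed.
Lemma cI_sum (I : Type) (r : seq I) (F : I -> T -> C) :
  (forall i, cok (F i)) -> cI (fun t => \sum_(i <- r) F i t) = \sum_(i <- r) cI (F i).
Proof.
move=> mF; elim: r => [|i r IH].
  rewrite big_nil /cI (@eq_Rintegral _ _ R mu S (fun=> 0)) ?Rintegral_cst ?mul0r //.
  by move=> t _; rewrite big_nil.
rewrite big_cons -IH -cID //; last exact: cok_sum.
by apply: eq_Rintegral => t _; rewrite big_cons.
Qed.
Lemma cI_le g h : cok g -> cok h -> (forall t, S t -> Re (g t) <= Re (h t)) -> cI g <= cI h.
Proof. by move=> cg ch gh; apply: le_Rintegral => //; exact: cok_integrable. Qed.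
Lemma cI_eq g h : (forall t, S t -> g t = h t) -> cI g = cI h.
Proof. by move=> gh; apply: eq_Rintegral => t /set_mem St; rewrite gh. Qed.
Lemma cI_bound g K : cok g -> (forall t, S t -> normc (g t) <= K) ->
  `|cI g| <= K * fine (mu S).
Proof.
move=> cg hK; apply: le_trans (le_normr_Rintegral mS (cok_integrable cg)) _.
rewrite -Rintegral_cst //; apply: le_Rintegral => //.
- exact: (integrable_abse (cok_integrable cg)).
- apply: measurable_bounded_integrable => //; exists K; split; first exact: num_real.
  move=> M KM t St /=; apply: le_trans (ltW KM).
  by rewrite ger0_norm //; apply: le_trans (hK t St); exact: normc_ge0.
- by move=> t St; apply: le_trans (normc_ge_Re _) (hK t St).
Qed.
End ComplexIntegral.

Section Derivations.
Variables (R : realType) (P : finType) (d : nat) (b : pred P).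
Local Notation C := R[i].
Local Notation Mt := (measurableTypeR R).
Local Notation N := #|{: P * 'I_d * 'I_d}|.
Local Notation T := (N.-tuple Mt).
Local Notation mu := (ltm R N).
Local Notation Mx := 'M[C]_d.
Variable S : set T.
Hypotheses (mS : measurable S) (Sbd : exists2 r : R, 0 <= r & S `<=` tcube r).
Hypothesis SU : forall U t, unitary U -> S (act b U t) <-> S t.

Lemma Sfin : (mu S < +oo)%E.
Proof.
have [r r0 Sr] := Sbd; apply: (@le_lt_trans _ _ (mu (tcube r))).
  by apply: le_measure; rewrite ?inE //; exact: measurable_tcube.
by rewrite ltm_cube // ltry.
Qed.

(* For such H, exp (i x H) = cos x + i sin x H is [rot H (sin x)], so the unitary
   orbits need no matrix exponential; the matrices flip1 and flip2 below span. *)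
Definition reflection (H : Mx) := adj H = H /\ H *m H = 1%:M.
Definition rot (H : Mx) (s : R) : Mx :=
  ((Num.sqrt (1 - s ^+ 2))%:C)%:M + ('i * s%:C) *: H.

Lemma adj_rot H s : reflection H ->
  adj (rot H s) = ((Num.sqrt (1 - s ^+ 2))%:C)%:M - ('i * s%:C) *: H.
Proof.
move=> [hH _]; apply/matrixP => i j; have := congr1 (fun A : Mx => A i j) hH.
rewrite !mxE => <-; rewrite rmorphD rmorphM /=.
have -> : Num.conj ((Num.sqrt (1 - s ^+ 2))%:C *+ (j == i) : C) = (Num.sqrt (1 - s ^+ 2))%:C *+ (i == j).
  by rewrite rmorphMn eq_sym; congr (_ *+ _); apply/eqP; rewrite eq_complex /= oppr0 !eqxx.
congr (_ + _); rewrite -mulNr; congr (_ * _).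
by apply/eqP; rewrite eq_complex /=; apply/andP; split; apply/eqP; ring.
Qed.

Lemma ii_sqr : 'i * 'i = -1 :> C. Proof. by rewrite -expr2 sqr_i. Qed.

Lemma rot_unitary H s : 0 <= s <= 1 -> reflection H -> unitary (rot H s).
Proof.
move=> /andP[s0 s1] rH; have [hH HH] := rH.
have c2 : (Num.sqrt (1 - s ^+ 2))%:C * (Num.sqrt (1 - s ^+ 2))%:C = 1 - s%:C ^+ 2 :> C.
  rewrite -rmorphM -expr2 sqr_sqrtr; first by rewrite rmorphB rmorphXn.
  by rewrite subr_ge0 expr_le1.
rewrite /unitary adj_rot // /rot; move: c2; set c := (_)%:C => c2.
set z := 'i * s%:C; have z2 : z * z = - s%:C ^+ 2.
  by rewrite mulrACA ii_sqr mulN1r expr2.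
have key w : w * w = - s%:C ^+ 2 :> C -> (c%:M + w *: H) *m (c%:M - w *: H) = 1%:M.
  move=> w2; rewrite mulmxBr !mulmxDl !mul_scalar_mx !mul_mx_scalar.
  rewrite -scalemxAl -scalemxAr HH !scalerA.
  apply/matrixP => i j; rewrite !mxE -[c *+ _]mulr_natr w2 mulrA c2; ring.
split; last exact: key.
by have := key (- z); rewrite !scaleNr opprK; apply; rewrite mulrNN.
Qed.

(* [D E] is the derivative of g at the identity along conjugation of the block b
   by exp (s E), made complex linear in E. *)
Definition good (g : T -> C) (D : Mx -> T -> C) : Prop :=
  [/\ cok S g, (forall E, cok S (D E)),
     (forall a E E' t, D (a *: E + E') t = a * D E t + D E' t)
   & forall H, reflection H -> exists K, 0 <= K /\ forall t (s : R), S t -> 0 <= s <= 1 ->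
       normc (g (act b (rot H s) t) - g t - s%:C * D ('i *: H) t) <= K * s ^+ 2].

Lemma good_cst c : good (fun=> c) (fun _ _ => 0).
Proof.
split; [exact: cok_cst|move=> E; exact: cok_cst|by move=> *; rewrite mulr0 addr0|].
move=> H rH; exists 0; split=> // t s St s01.
by rewrite subrr mulr0 subr0 normc0 mul0r.
Qed.

Lemma goodD g D h D' : good g D -> good h D' ->
  good (fun t => g t + h t) (fun E t => D E t + D' E t).
Proof.
move=> [cg cD lD tg] [ch cD' lD' th]; split.
- exact: cokD.
- by move=> E; exact: cokD.
- by move=> a E E' t; rewrite lD lD' mulrDr addrACA.
- move=> H rH; have [K [K0 hK]] := tg H rH; have [L [L0 hL]] := th H rH.
  exists (K + L); split; first exact: addr_ge0.
  move=> t s St s01; rewrite mulrDl.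
  apply: le_trans (lerD (hK t s St s01) (hL t s St s01)); apply: le_trans (normcD _ _).
  by rewrite le_eqVlt; apply/orP; left; apply/eqP; congr normc; ring.
Qed.

Lemma cok_pos (g : T -> C) : cok S g -> exists2 K, 0 <= K & forall t, S t -> normc (g t) <= K.
Proof.
by move=> [_ [K hK]]; exists (`|K|) => // t St; apply: le_trans (hK t St) (ler_norm _).
Qed.

Lemma goodM g D h D' : good g D -> good h D' ->
  good (fun t => g t * h t) (fun E t => D E t * h t + g t * D' E t).
Proof.
move=> [cg cD lD tg] [ch cD' lD' th]; split.
- exact: cokM.
- by move=> E; apply: cokD; apply: cokM.
- by move=> a E E' t; rewrite lD lD'; ring.
- move=> H rH; have [K [K0 hK]] := tg H rH; have [L [L0 hL]] := th H rH.
  have [G G0 hG] := cok_pos cg; have [B B0 hB] := cok_pos ch.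
  have [DG DG0 hDG] := cok_pos (cD ('i *: H)); have [DB DB0 hDB] := cok_pos (cD' ('i *: H)).
  exists (DG * DB + K * B + (G + DG) * L); split.
    by rewrite !addr_ge0 // mulr_ge0 // addr_ge0.
  move=> t s St s01; have /andP[s0 s1] := s01.
  (* Invariance of [S] is what bounds [h] at the rotated point as well. *)
  have Sa : S (act b (rot H s) t) by apply/SU => //; exact: rot_unitary.
  have := hK t s St s01; have := hL t s St s01; have := hB _ Sa.
  have := hG _ St; have := hDG _ St; have := hDB _ St.
  set x := g t; set y := h t; set x' := g _; set y' := h _; set u := D _ _; set v := D' _ _.
  move=> nv nu nx ny' nr2 nr1.
  have -> : x' * y' - x * y - s%:C * (u * y + x * v) =
     s%:C * (s%:C * (u * v)) + (x' - x - s%:C * u) * y' + (x + s%:C * u) * (y' - y - s%:C * v).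
    by ring.
  rewrite [leRHS](_ : _ = DG * DB * s ^+ 2 + K * B * s ^+ 2 + (G + DG) * L * s ^+ 2); last by ring.
  apply: le_trans (normcD _ _) _; apply: lerD.
    apply: le_trans (normcD _ _) _; apply: lerD.
      rewrite !normcMr normcM ger0_norm // mulrA -expr2 mulrC.
      by apply: ler_wpM2r; [exact: sqr_ge0|apply: ler_pM; rewrite ?normc_ge0].
    rewrite normcM mulrAC; apply: ler_pM; rewrite ?normc_ge0 //.
  rewrite normcM -mulrA; apply: ler_pM; rewrite ?normc_ge0 //.
  apply: le_trans (normcD _ _) _; apply: lerD => //.
  rewrite normcMr ger0_norm //; apply: le_trans nu.
  by rewrite ler_piMl // normc_ge0.
Qed.

Lemma eq_good g D g' D' : (forall t, g t = g' t) -> (forall E t, D E t = D' E t) ->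
  good g D -> good g' D'.
Proof.
move=> /funext <- DD'; have -> // : D' = D.
by apply/funext => E; apply/funext => t.
Qed.

Lemma goodZ c g D : good g D -> good (fun t => c * g t) (fun E t => c * D E t).
Proof.
move=> hg; apply: eq_good (goodM (good_cst c) hg) => // E t.
by rewrite mul0r add0r.
Qed.

Lemma good_sum (I : Type) (r : seq I) (F : I -> T -> C) (DF : I -> Mx -> T -> C) :
  (forall i, good (F i) (DF i)) ->
  good (fun t => \sum_(i <- r) F i t) (fun E t => \sum_(i <- r) DF i E t).
Proof.
move=> hF; elim: r => [|i r IH].
  by apply: eq_good (good_cst 0) => [t|E t]; rewrite big_nil.
by apply: eq_good (goodD (hF i) IH) => [t|E t]; rewrite big_cons.
Qed.

(** Conjugation alone would make the derivative antilinear in [E]. The map E -> - adj E repairs this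
    and fixes the skew-adjoint directions ['i *: H], the only ones in which the expansion is
    tested. *)
Lemma good_conj g D : good g D ->
  good (fun t => Num.conj (g t)) (fun E t => Num.conj (D (- adj E) t)).
Proof.
move=> [cg cD lD tg]; split.
- exact: cok_conj.
- by move=> E; exact: cok_conj.
- move=> a E E' t; have -> : - adj (a *: E + E') = Num.conj a *: - adj E + - adj E'.
    by apply/matrixP => i j; rewrite !mxE rmorphD rmorphM opprD mulrN.
  by rewrite lD rmorphD rmorphM /= conjCK.
- move=> H rH; have [K [K0 hK]] := tg H rH; exists K; split=> // t s St s01.
  have -> : - adj ('i *: H) = 'i *: H.
    apply/matrixP => i j; have [hH _] := rH; have := congr1 (fun A : Mx => A i j) hH.
    rewrite !mxE rmorphM /= => ->; rewrite -mulNr; congr (_ * _).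
    by apply/eqP; rewrite eq_complex /= oppr0 opprK !eqxx.
  apply: le_trans (hK t s St s01); rewrite -normc_conj !rmorphB rmorphM /= !conjCK.
  rewrite (_ : Num.conj s%:C = s%:C :> C) //.
  by apply/eqP; rewrite eq_complex /= oppr0 !eqxx.
Qed.

Lemma goodX g D n : good g D -> 
  good (fun t => g t ^+ n) (fun E t => (g t ^+ n.-1 * D E t) *+ n).
Proof.
move=> hg; elim: n => [|n IH]; first exact: good_cst.
apply: eq_good (goodM hg IH) => [t|E t]; first by rewrite exprS.
rewrite /= mulrS mulrC; congr (_ + _).
case: n {IH} => [|n]; first by rewrite !mulr0n mulr0.
by rewrite /= -mulrnAr mulrA -exprS mulrnAr.
Qed.

Definition mgood (W : T -> Mx) (DW : Mx -> T -> Mx) :=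
  forall i j, good (fun t => W t i j) (fun E t => DW E t i j).

Lemma mgoodM W DW V DV : mgood W DW -> mgood V DV ->
  mgood (fun t => W t *m V t) (fun E t => DW E t *m V t + W t *m DV E t).
Proof.
move=> gW gV i j.
apply: eq_good (good_sum (index_enum _) (fun k => goodM (gW i k) (gV k j))) => [t|E t].
  by rewrite mxE.
by rewrite !mxE big_split.
Qed.

Lemma mgood_cst A : mgood (fun=> A) (fun _ _ => 0).
Proof. by move=> i j; apply: eq_good (good_cst (A i j)) => // E t; rewrite mxE. Qed.

Lemma good_tr W DW : mgood W DW -> good (fun t => \tr (W t)) (fun E t => \tr (DW E t)).
Proof. by move=> gW; rewrite /mxtrace; apply: good_sum => i; exact: gW. Qed.

Lemma cok_conf p i j : cok S (fun t => conf t p i j).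
Proof.
split; first exact: mxmeas_conf.
have [r r0 Sr] := Sbd.
have s2 : 1 <= (Num.sqrt 2 : R) by rewrite -[leLHS]sqrtr1 ler_sqrt // ler1n.
have h q t : S t -> `|tnth t q / Num.sqrt 2| <= r.
  move=> St; rewrite normrM; apply: le_trans (Sr t St q).
  by rewrite ler_piMr // ger0_norm ?invr_ge0 ?sqrtr_ge0 // invf_le1 // (lt_le_trans _ s2).
exists (r + r) => t St; rewrite mxE; apply: le_trans (normc_le_ReIm _) _.
case: (i == j) => /=; first by rewrite normr0; apply: lerD => //; exact: Sr.
by case: (i < j)%N => /=; rewrite ?normrN; apply: lerD; exact: h.
Qed.

Lemma cok_mxM (V W : T -> Mx) : (forall i j, cok S (fun t => V t i j)) ->
  (forall i j, cok S (fun t => W t i j)) -> forall i j, cok S (fun t => (V t *m W t) i j).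
Proof.
move=> cV cW i j; under eq_fun do rewrite mxE.
by apply: cok_sum => k; exact: cokM.
Qed.

(** With U = c + i s H and c^2 = 1 - s^2, the remainder U A U* - A - s i [H, A] equals - s^2 A + i s
    (c - 1) [H, A] + s^2 H A H, and 0 <= 1 - c <= s; every term is of order s^2 on [S]. *)
Lemma mgood_conf p : mgood (fun t => conf t p)
  (fun E t => if b p then E *m conf t p - conf t p *m E else 0).
Proof.
move=> i j; split.
- exact: cok_conf.
- move=> E; case: (b p); last by under eq_fun do rewrite mxE; exact: cok_cst.
  under eq_fun do rewrite mxE [X in _ + X]mxE -mulN1r.
  apply: cokD; first by apply: cok_mxM => *; [exact: cok_cst|exact: cok_conf].
  apply: cokM; first exact: cok_cst.
  by apply: cok_mxM => *; [exact: cok_conf|exact: cok_cst].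
- move=> a E E' t; case: (b p); last by rewrite !mxE mulr0 addr0.
  rewrite mulmxDl mulmxDr -scalemxAl -scalemxAr opprD addrACA -scalerBr.
  by rewrite [LHS]mxE [X in X + _]mxE.
- move=> H rH; case bp : (b p); last first.
    exists 0; split=> // t s St s01; rewrite conf_act /uconj bp subrr sub0r.
    by rewrite [X in _ * X]mxE mulr0 oppr0 normc0 mul0r.
  have [k0 k0p h0] := cok_pos (cok_conf p i j).
  have [k1 k1p h1] : exists2 K, 0 <= K & forall t, S t ->
      normc ((H *m conf t p - conf t p *m H) i j) <= K.
    apply: cok_pos; under eq_fun do rewrite mxE [X in _ + X]mxE -mulN1r.
    apply: cokD; first by apply: cok_mxM => *; [exact: cok_cst|exact: cok_conf].
    apply: cokM; first exact: cok_cst.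
    by apply: cok_mxM => *; [exact: cok_conf|exact: cok_cst].
  have [k2 k2p h2] : exists2 K, 0 <= K & forall t, S t ->
      normc ((H *m conf t p *m H) i j) <= K.
    apply: cok_pos; apply: cok_mxM => *; last exact: cok_cst.
    by apply: cok_mxM => *; [exact: cok_cst|exact: cok_conf].
  exists (k0 + k1 + k2); split; first by rewrite !addr_ge0.
  move=> t s St /andP[s0 s1]; rewrite conf_act /uconj bp adj_rot // /rot.
  have cc : (Num.sqrt (1 - s ^+ 2)) ^+ 2 = 1 - s ^+ 2.
    by rewrite sqr_sqrtr // subr_ge0 expr_le1.
  move: (h0 t St) (h1 t St) (h2 t St) cc (sqrtr_ge0 (1 - s ^+ 2)).
  move: (conf t p) (Num.sqrt _) => A c nA nB nH cc c0.
  have e : (c%:C%:M + ('i * s%:C) *: H) *m A *m (c%:C%:M - ('i * s%:C) *: H) - A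
     - s%:C *: ('i *: H *m A - A *m ('i *: H)) =
     - (s%:C ^+ 2) *: A + ('i * (s * (c - 1))%:C) *: (H *m A - A *m H) + (s%:C ^+ 2) *: (H *m A *m H).
    have c2 : c%:C * c%:C = 1 - s%:C ^+ 2 :> C by rewrite -rmorphM -expr2 cc rmorphB rmorphXn.
    have z2 : 'i * s%:C * ('i * s%:C) = - (s%:C ^+ 2) :> C.
      by rewrite mulrACA ii_sqr mulN1r expr2.
    rewrite rmorphM rmorphB /= rmorph1.
    rewrite !mulmxDl !mulmxBr !mul_scalar_mx -!scalemxAl -!scalemxAr !mul_mx_scalar.
    rewrite !scalerBr !scalerA c2.
    move: (H *m A) (A *m H) (H *m A *m H) => X Y Z.
    apply/matrixP => i' j'; rewrite !mxE z2.
    by ring.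
  have -> : ((c%:C%:M + ('i * s%:C) *: H) *m A *m (c%:C%:M - ('i * s%:C) *: H)) i j - A i j
     - s%:C * ('i *: H *m A - A *m ('i *: H)) i j =
    (- (s%:C ^+ 2) *: A + ('i * (s * (c - 1))%:C) *: (H *m A - A *m H) + (s%:C ^+ 2) *: (H *m A *m H)) i j.
    rewrite -e; set X := _ *m _ *m _; set Y := _ *m A - _.
    by rewrite [RHS]mxE [X in _ = X + _]mxE [X in _ = _ + X + _]mxE; congr (_ + _); rewrite !mxE.
  have -> : forall X Y Z : Mx, (- (s%:C ^+ 2) *: X + ('i * (s * (c - 1))%:C) *: Y + (s%:C ^+ 2) *: Z) i j
     = - (s%:C ^+ 2) * X i j + ('i * (s * (c - 1))%:C) * Y i j + (s%:C ^+ 2) * Z i j.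
    by move=> X Y Z; rewrite mxE [X in X + _]mxE; congr (_ + _ + _); rewrite mxE.
  rewrite [leRHS](_ : _ = k0 * s ^+ 2 + k1 * s ^+ 2 + k2 * s ^+ 2); last by ring.
  apply: le_trans (normcD _ _) _; apply: lerD; last first.
    rewrite -rmorphXn normcMr ger0_norm ?sqr_ge0 // mulrC.
    by apply: ler_wpM2r => //; exact: sqr_ge0.
  apply: le_trans (normcD _ _) _; apply: lerD.
    rewrite mulNr normcN -rmorphXn normcMr ger0_norm ?sqr_ge0 // mulrC.
    by apply: ler_wpM2r => //; exact: sqr_ge0.
  rewrite !normcM normc_real mulrC; apply: ler_pM; rewrite ?normc_ge0 // ?mulr_ge0 ?normc_ge0 //.
  have -> : normc ('i : C) = 1 by rewrite /= expr0n /= expr1n add0r sqrtr1.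
  by rewrite mul1r ler_norml; apply/andP; split; nra.
Qed.

Lemma cI_act (g : T -> C) U : unitary U -> cok S g ->
  cI mu S (fun t => g (act b U t)) = cI mu S g.
Proof.
move=> hU cg; have mf := measurable_act b U.
have pS : act b U @^-1` S = S.
  by apply/seteqP; split=> t /=; [move=> /(SU _ hU)|move=> h; apply/(SU _ hU)].
have [[mg _] _] := cg.
have mg' : measurable_fun setT (EFin \o (fun t => Re (g t))) by exact/measurable_EFinP.
have ig : mu.-integrable (act b U @^-1` S) ((EFin \o (fun t => Re (g t))) \o act b U).
  rewrite pS.
  apply: (@cok_integrable _ _ _ mu S mS Sfin (fun t => g (act b U t))).
  have [[mg1 mg2] [K hK]] := cg; split.
    by split; [apply: (measurableT_comp mg1)|apply: (measurableT_comp mg2)].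
  by exists K => t St; apply: hK; apply/SU.
have := integral_pushforward mf mg' ig mS; rewrite pS => E.
rewrite /cI /Rintegral; congr fine; refine (eq_trans (esym E) _).
by apply: eq_measure_integral => A mA _; exact: (ltm_act b hU mA).
Qed.

Lemma cok_act (g : T -> C) U : unitary U -> cok S g -> cok S (fun t => g (act b U t)).
Proof.
move=> hU [[mg1 mg2] [K hK]]; have mf := measurable_act b U; split.
  by split; [apply: (measurableT_comp mg1)|apply: (measurableT_comp mg2)].
by exists K => t St; apply: hK; apply/SU.
Qed.

(** By invariance g and its rotation have equal integrals, so the first-order term s cI(D) is
    cancelled up to a remainder of order s^2; divide by s and let s tend to 0. *)
Lemma IBP_reflection g D H : good g D -> reflection H -> cI mu S (D ('i *: H)) = 0.
Proof.
move=> [cg cD lD tg] rH; have [K [K0 hK]] := tg H rH.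
set m := fine (mu S); have m0 : 0 <= m by apply: fine_ge0.
have key s : 0 < s -> s <= 1 -> `|cI mu S (D ('i *: H))| <= K * m * s.
  move=> s0 s1; have s01 : 0 <= s <= 1 by rewrite ltW.
  have hU := rot_unitary s01 rH.
  have c1 := cok_act hU cg.
  have c2 : cok S (fun t => (-1)%:C * g t) by apply: cokM => //; exact: cok_cst.
  have c3 : cok S (fun t => (-s)%:C * D ('i *: H) t) by apply: cokM => //; exact: cok_cst.
  have c4 := cokD c1 c2; have c5 := cokD c4 c3.
  have := cI_bound mS Sfin c5 (K := K * s ^+ 2) _.
  rewrite !(cID mS Sfin) // !(cIZ mS Sfin) // (cI_act hU) // mulN1r subrr add0r normrM.
  rewrite normrN (gtr0_norm s0) => h.
  have {h} : s * `|cI mu S (D ('i *: H))| <= K * s ^+ 2 * m.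
    apply: h => t St; apply: le_trans (hK t s St s01).
    rewrite le_eqVlt; apply/orP; left; apply/eqP; congr normc.
    by rewrite !rmorphN rmorph1; ring.
  by rewrite (_ : K * s ^+ 2 * m = s * (K * m * s)) ?ler_pM2l //; ring.
apply/eqP; rewrite -normr_le0; apply/ler_addgt0Pr => e e0; rewrite add0r.
have KM : 0 <= K * m by exact: mulr_ge0.
pose s := Num.min 1 (e / (K * m + 1)).
have s0 : 0 < s by rewrite lt_min ltr01 divr_gt0 // ltr_wpDl.
apply: le_trans (key s s0 _) _; first by rewrite ge_min lexx.
apply: (@le_trans _ _ (K * m * (e / (K * m + 1)))).
  by apply: ler_wpM2l => //; rewrite ge_min lexx orbT.
by rewrite mulrA ler_pdivrMr ?ltr_wpDl // mulrC mulrDr mulr1 lerDl ltW.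
Qed.

Lemma IBP_span g D (c : C) H : good g D -> reflection H ->
  cI mu S (fun t => c * D H t) = 0.
Proof.
move=> hg rH; have [_ _ lD _] := hg.
(* Scaling [g] by - c i compensates the factor i of the direction ['i *: H]. *)
have := IBP_reflection (goodZ (- c * 'i) hg) rH => <-.
apply: cI_eq => t _; have := lD 'i H 0 t; rewrite addr0 => ->.
have -> : D 0 t = 0.
  by have := lD (-1) H H t; rewrite scaleN1r addNr mulN1r addNr.
by rewrite addr0 mulrA -[- c * 'i * 'i]mulrA ii_sqr mulrN1 opprK.
Qed.

Definition flip1 (j : 'I_d) : Mx := 1%:M - 2 *: delta_mx j j.

Lemma adj_delta (i j : 'I_d) : adj (delta_mx i j : Mx) = delta_mx j i.
Proof. by apply/matrixP => k l; rewrite !mxE andbC; case: (_ && _); rewrite ?conjC1 ?conjC0. Qed.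

Lemma adjD m n (A B : 'M[C]_(m, n)) : adj (A + B) = adj A + adj B.
Proof. by apply/matrixP => i j; rewrite !mxE rmorphD. Qed.
Lemma adjN m n (A : 'M[C]_(m, n)) : adj (- A) = - adj A.
Proof. by apply/matrixP => i j; rewrite !mxE rmorphN. Qed.
Lemma adjZ m n a (A : 'M[C]_(m, n)) : adj (a *: A) = Num.conj a *: adj A.
Proof. by apply/matrixP => i j; rewrite !mxE rmorphM. Qed.
Lemma adj1 n : adj (1%:M : 'M[C]_n) = 1%:M.
Proof. by rewrite /adj trmx1 map_mx1. Qed.

Lemma reflection_flip1 j : reflection (flip1 j).
Proof.
split; first by rewrite adjD adjN adjZ adj1 adj_delta conjC_nat.
rewrite /flip1 mulmxBl mul1mx mulmxBr mulmx1 -!scalemxAl -!scalemxAr mul_delta_mx scalerA.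
apply/matrixP => k l; rewrite !mxE; ring.
Qed.

Definition flip2 (z : C) (i j : 'I_d) : Mx :=
  1%:M - delta_mx i i - delta_mx j j + z *: delta_mx i j + Num.conj z *: delta_mx j i.

Lemma reflection_flip2 z i j : z * Num.conj z = 1 -> i != j -> reflection (flip2 z i j).
Proof.
move=> z1 ij; split.
  by rewrite /flip2 adjD adjZ adj_delta (conjCK z) adjD adjZ adj_delta adjD adjN adj_delta adjD adjN adj_delta adj1 addrAC.
have ji : j != i by rewrite eq_sym.
have z1' : Num.conj z * z = 1 by rewrite mulrC.
rewrite /flip2 !(mulmxDl, mulmxBl, mulmxDr, mulmxBr, mulmxN, mulNmx, mul1mx, mulmx1).
rewrite -!scalemxAl -!scalemxAr !mul_delta_mx_cond !(negbTE ij) !(negbTE ji) !eqxx.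
rewrite !(mulr0n, mulr1n, scaler0, scalerA) z1 z1'.
move: (delta_mx i i) (delta_mx j j) (delta_mx i j) (delta_mx j i) 1%:M => e f x y o.
by apply/matrixP => k l; rewrite !mxE; ring.
Qed.

Lemma reflection1 : reflection 1%:M.
Proof. by split; rewrite ?adj1 ?mulmx1. Qed.

(** The matrix units are complex combinations of the reflections 1, [flip1] and [flip2], and [D] is
    complex linear in its direction. *)
Lemma IBP g D i j : good g D -> cI mu S (D (delta_mx i j)) = 0.
Proof.
move=> hg; have [_ cD lD _] := hg.
have D0 t : D 0 t = 0.
  by have := lD (-1) 1%:M 1%:M t; rewrite scaleN1r addNr mulN1r addNr.
have DD E E' t : D (E + E') t = D E t + D E' t.
  by have := lD 1 E E' t; rewrite scale1r mul1r.
have DZ a E t : D (a *: E) t = a * D E t.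
  by have := lD a E 0 t; rewrite addr0 D0 addr0.
have sp c H := @IBP_span g D c H hg.
have ck c E : cok S (fun t => c * D E t) by apply: cokM => //; exact: cok_cst.
have diag k c : cI mu S (fun t => c * D (delta_mx k k) t) = 0.
  rewrite (cI_eq mu (h := fun t => c * 2^-1 * D 1%:M t + - c * 2^-1 * D (flip1 k) t)).
    rewrite (cID mS Sfin) // !sp //; [by rewrite addr0|exact: reflection_flip1|exact: reflection1].
  move=> t _; rewrite /flip1 DD -scaleNr DZ.
  have n2 : 2 != 0 :> C by rewrite pnatr_eq0.
  by field.
have [->|ij] := eqVneq i j.
  by rewrite -(diag j 1); apply: cI_eq => t _; rewrite mul1r.
have i1 : 'i * Num.conj 'i = 1 :> C.
  by rewrite mulC_conj /= expr0n /= expr1n add0r sqrtr1 expr1n.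
have r1 : reflection (flip2 1 i j).
  by apply: reflection_flip2 ij; rewrite conjC1 mulr1.
have r2 := reflection_flip2 i1 ij.
have key c : cI mu S (fun t => c * (D (delta_mx i i) t + D (delta_mx j j) t - D 1%:M t)) = 0.
  rewrite (cI_eq mu (h := fun t => c * D (delta_mx i i) t + (c * D (delta_mx j j) t + - c * D 1%:M t))).
    rewrite !(cID mS Sfin) //; last by apply: cokD.
    by rewrite !diag sp ?addr0 //; exact: reflection1.
  by move=> t _; ring.
(* Polarization with the phases 1 and i: in p - i q the unit x occurs twice and y cancels; the
   diagonal part is removed by the last summand. *)
have solve (h u x y p q e f o : C) : h + h = 1 -> u = o - e - f ->
    p = u + 1 * x + 1 * y -> q = u + 'i * x + - 'i * y ->
    x = h * p + - 'i * h * q + (h - 'i * h) * (e + f - o).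
  move=> hh -> -> ->.
  rewrite [RHS](_ : _ = h * (1 - 'i * 'i) * x + h * (1 + 'i * 'i) * y); last by ring.
  by rewrite ii_sqr subrr mulr0 mul0r addr0 opprK mulrDr mulr1 hh mul1r.
have Df z w t : Num.conj z = w -> D (flip2 z i j) t =
   (D 1%:M t - D (delta_mx i i) t - D (delta_mx j j) t) + z * D (delta_mx i j) t + w * D (delta_mx j i) t.
  have DN E : D (- E) t = - D E t by rewrite -scaleN1r DZ mulN1r.
  by move=> <-; rewrite /flip2 DD DZ DD DZ DD DN DD DN.
have ci : Num.conj 'i = - 'i :> C by apply/eqP; rewrite eq_complex /= oppr0 !eqxx.
have hh : 2^-1 + 2^-1 = 1 :> C by rewrite [RHS](splitr 1) mul1r.
rewrite (cI_eq mu (h := fun t => (2^-1 * D (flip2 1 i j) t + (- 'i * 2^-1) * D (flip2 'i i j) t)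
   + (2^-1 - 'i * 2^-1) * (D (delta_mx i i) t + D (delta_mx j j) t - D 1%:M t))); last first.
  by move=> t _; apply: solve hh (erefl _) (Df 1 1 t (conjC1 _)) (Df 'i (- 'i) t ci).
have cc : cok S (fun t => (2^-1 - 'i * 2^-1) * (D (delta_mx i i) t + D (delta_mx j j) t - D 1%:M t)).
  apply: cokM; first exact: cok_cst.
  apply: cokD; first exact: cokD.
  by under eq_fun do rewrite -mulN1r.
rewrite (cID mS Sfin (cokD (ck _ _) (ck _ _)) cc) key addr0.
exact: etrans (cID mS Sfin (ck _ _) (ck _ _)) (etrans (congr2 +%R (sp _ _ r1) (sp _ _ r2)) (addr0 0)).
Qed.

End Derivations.

(** * Concentration of the Schwinger-Dyson functionals *)

Arguments ComplexField.Normc.normc : simpl never.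

Section Words.
Variables (R : realType) (P : finType).
Local Notation C := R[i].

(* [sd tau b [::] v] is (tau (x) tau) applied to the derivation sending a letter
   p of the block [b] to p (x) 1 - 1 (x) p and the other letters to 0. *)
Fixpoint sd (tau : seq P -> C) (b : pred P) (x v : seq P) : C :=
  if v is a :: v' then
    (if b a then tau (rcons x a) * tau v' - tau x * tau v else 0) + sd tau b (rcons x a) v'
  else 0.

(** The Leibniz rule for [sd], with [dtau] the derivative of [tau]. *)
Fixpoint dsd (tau dtau : seq P -> C) (b : pred P) (x v : seq P) : C :=
  if v is a :: v' then
    (if b a then dtau (rcons x a) * tau v' + tau (rcons x a) * dtau v'
                 - (dtau x * tau v + tau x * dtau v) else 0)
      + dsd tau dtau b (rcons x a) v'
  else 0.

Lemma dsd_bound tau dtau b (K L : R) n x v : 0 <= K -> 0 <= L ->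
  (size x + size v <= n)%N ->
  (forall w, (size w <= n)%N -> normc (tau w) <= K) ->
  (forall w, (size w <= n)%N -> normc (dtau w) <= L) ->
  normc (dsd tau dtau b x v) <= (4 * K * L) *+ size v.
Proof.
move=> K0 L0 + hK hL; elim: v x => [|a v IH] x /= sz; first by rewrite normc0.
rewrite mulrS; apply: le_trans (normcD _ _) _; apply: lerD; last first.
  by apply: IH; rewrite size_rcons; move: sz; lia.
case: (b a); last by rewrite normc0 !mulr_ge0.
have h1 w w' : (size w <= n)%N -> (size w' <= n)%N -> normc (tau w * dtau w') <= K * L.
  by move=> hw hw'; rewrite normcM; apply: ler_pM; rewrite ?normc_ge0 ?hK ?hL.
rewrite [leRHS](_ : _ = K * L + K * L + (K * L + K * L)); last by ring.
have h2 w w' : (size w <= n)%N -> (size w' <= n)%N -> normc (dtau w * tau w') <= K * L.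
  by move=> hw hw'; rewrite mulrC; exact: h1.
apply: le_trans (normcB _ _) _; apply: lerD; apply: le_trans (normcD _ _) _;
  apply: lerD; first [apply: h1|apply: h2]; rewrite ?size_rcons /=; move: sz; lia.
Qed.

Section Matrices.
Variable d : nat.
Local Notation Mx := 'M[C]_d.
Implicit Types B : P -> Mx.

Fixpoint wmx B (v : seq P) : Mx := if v is a :: v' then B a *m wmx B v' else 1%:M.

Definition wtr B v : C := ntrace (wmx B v).

Fixpoint dwmx B (b : pred P) (E : Mx) (v : seq P) : Mx :=
  if v is a :: v' then
    (if b a then E *m B a - B a *m E else 0) *m wmx B v' + B a *m dwmx B b E v'
  else 0.

Lemma wmx_cat B u v : wmx B (u ++ v) = wmx B u *m wmx B v.
Proof. by elim: u => [|a u IH] /=; rewrite ?mul1mx // IH mulmxA. Qed.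

Lemma wmx_rcons B u a : wmx B (rcons u a) = wmx B u *m B a.
Proof. by rewrite -cats1 wmx_cat /= mulmx1. Qed.

Lemma adj_wmx B v : (forall p, adj (B p) = B p) -> adj (wmx B v) = wmx B (rev v).
Proof.
move=> hB; elim: v => [|a v IH] /=; first by rewrite /adj trmx1 map_mx1.
by rewrite adjM IH hB rev_cons wmx_rcons.
Qed.

Lemma ntraceC (A B : Mx) : ntrace (A *m B) = ntrace (B *m A).
Proof. by rewrite /ntrace mxtrace_mulC. Qed.

Lemma wtrC B u v : wtr B (u ++ v) = wtr B (v ++ u).
Proof. by rewrite /wtr !wmx_cat ntraceC. Qed.

Lemma ntraceD (A B : Mx) : ntrace (A + B) = ntrace A + ntrace B.
Proof. by rewrite /ntrace raddfD mulrDr. Qed.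
Lemma ntraceN (A : Mx) : ntrace (- A) = - ntrace A.
Proof. by rewrite /ntrace raddfN mulrN. Qed.

(** When the direction is itself the matrix of a word, each letter of [v] contributes at most two
    traces of words. Hence moments alone control the derivative, and no operator norm enters. *)
Lemma dwmx_bound B b (K : R) n x y v : 0 <= K -> (size x + size y + size v <= n)%N ->
  (forall w, (size w <= n)%N -> normc (wtr B w) <= K) ->
  normc (ntrace (wmx B y *m dwmx B b (wmx B x) v)) <= (2 * K) *+ size v.
Proof.
move=> K0 + hK; elim: v y => [|a v IH] y /= sz; first by rewrite mulmx0 /ntrace raddf0 mulr0 normc0.
rewrite mulrS mulmxDr ntraceD.
apply: le_trans (normcD _ _) _; apply: lerD; last first.
  by rewrite mulmxA -wmx_rcons; apply: IH; rewrite size_rcons; move: sz; lia.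
case: (b a); last by rewrite mul0mx mulmx0 /ntrace raddf0 mulr0 normc0 mulr_ge0.
rewrite mulmxA mulmxBr mulmxBl ntraceD ntraceN mulr2n mulrDl mul1r.
apply: le_trans (normcB _ _) _; apply: lerD.
  rewrite -wmx_rcons -!wmx_cat; apply: hK.
  by rewrite ?(size_cat, size_rcons); move: sz; lia.
rewrite mulmxA -!wmx_rcons -!wmx_cat; apply: hK.
by rewrite ?(size_cat, size_rcons); move: sz; lia.
Qed.

(* The divergence of the field A_p |-> [W(v), A_p] on the block. *)
Lemma sum_dwmx_delta B b y v : (0 < d)%N ->
  \sum_i \sum_j (wmx B y *m dwmx B b (delta_mx i j) v) i j
  = - d%:R ^+ 2 * sd (wtr B) b y v.
Proof.
move=> d0; have dn : d%:R != 0 :> C by rewrite pnatr_eq0 -lt0n.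
(* Summing U e_ij V over matrix units splits one trace into two: this is the origin of tau (x)
   tau. *)
have trd (U V : Mx) : \sum_i \sum_j (U *m delta_mx i j *m V) i j = \tr U * \tr V.
  rewrite /mxtrace mulr_suml; apply: eq_bigr => i _; rewrite mulr_sumr; apply: eq_bigr => j _.
  rewrite -mulmxA mxE (bigD1 i) //= big1 ?addr0; last first.
    move=> k ki; rewrite mxE big1 ?mulr0 // => k' _.
    by rewrite mxE (negbTE ki) mul0r.
  rewrite mxE (bigD1 j) //= big1 ?addr0; last first.
    by move=> k kj; rewrite mxE (negbTE kj) andbF mul0r.
  by rewrite mxE !eqxx mul1r.
elim: v y => [|a v IH] y /=.
  by rewrite mulr0 big1 // => i _; rewrite big1 // => j _; rewrite mulmx0 mxE.
have -> : \sum_i \sum_j (wmx B y *m ((if b a then delta_mx i j *m B a - B a *m delta_mx i j else 0) *m wmx B v + B a *m dwmx B b (delta_mx i j) v)) i j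
  = \sum_i \sum_j (wmx B y *m ((if b a then delta_mx i j *m B a - B a *m delta_mx i j else 0) *m wmx B v)) i j
   + \sum_i \sum_j (wmx B (rcons y a) *m dwmx B b (delta_mx i j) v) i j.
  rewrite -big_split; apply: eq_bigr => i _; rewrite -big_split; apply: eq_bigr => j _.
  by rewrite mulmxDr wmx_rcons mulmxA [LHS]mxE !mulmxA.
rewrite IH mulrDr; congr (_ + _); case: (b a); last first.
  by rewrite mulr0 big1 // => i _; rewrite big1 // => j _; rewrite mul0mx mulmx0 mxE.
have -> : \sum_i \sum_j (wmx B y *m ((delta_mx i j *m B a - B a *m delta_mx i j) *m wmx B v)) i j
  = \sum_i \sum_j (wmx B y *m delta_mx i j *m (B a *m wmx B v)) i j
   - \sum_i \sum_j (wmx B (rcons y a) *m delta_mx i j *m wmx B v) i j.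
  rewrite -sumrB; apply: eq_bigr => i _; rewrite -sumrB; apply: eq_bigr => j _.
  rewrite wmx_rcons mulmxBl mulmxBr [LHS]mxE [X in _ + X]mxE !mulmxA //.
by rewrite !trd /wtr /ntrace /=; field.
Qed.

End Matrices.
End Words.

Section Concentration.
Variables (R : realType) (P : finType) (d : nat) (b : pred P).
Local Notation C := R[i].
Local Notation Mt := (measurableTypeR R).
Local Notation N := #|{: P * 'I_d * 'I_d}|.
Local Notation T := (N.-tuple Mt).
Local Notation mu := (ltm R N).
Local Notation Mx := 'M[C]_d.
Variable S : set T.
Hypotheses (mS : measurable S) (Sbd : exists2 r : R, 0 <= r & S `<=` tcube r).
Hypothesis SU : forall U t, unitary U -> S (act b U t) <-> S t.

Local Notation good := (good b S).
Local Notation mgood := (mgood b S).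

Lemma mgood_wmx v : mgood (fun t => wmx (conf t) v) (fun E t => dwmx (conf t) b E v).
Proof.
elim: v => [|a v IH] /=; first exact: mgood_cst.
exact: mgoodM (mgood_conf _ _ _) IH.
Qed.

Lemma good_wtr v : good (fun t => wtr (conf t) v)
  (fun E t => ntrace (dwmx (conf t) b E v)).
Proof. exact: goodZ (good_tr (mgood_wmx v)). Qed.

Local Arguments dwmx : simpl never.
Local Arguments wmx : simpl never.

Lemma good_sd x v : good (fun t => sd (wtr (conf t)) b x v)
  (fun E t => dsd (wtr (conf t)) (fun w => ntrace (dwmx (conf t) b E w)) b x v).
Proof.
elim: v x => [|a v IH] x /=; first exact: good_cst.
apply: goodD (IH _); case: (b a); last exact: good_cst.
apply: eq_good (goodD (goodM SU (good_wtr _) (good_wtr _))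
   (goodZ SU (-1) (goodM SU (good_wtr _) (good_wtr _)))) => [t|E t]; by rewrite mulN1r.
Qed.

Variables (v : seq P) (K : R).
Hypotheses (d0 : (0 < d)%N) (K0 : 0 <= K).
Hypothesis hK : forall t w, S t -> (size w <= 2 * size v)%N ->
  normc (wtr (conf t) w) <= K.

Let F (t : T) := sd (wtr (conf t)) b [::] v.
Let DF (E : Mx) (t : T) :=
  dsd (wtr (conf t)) (fun w => ntrace (dwmx (conf t) b E w)) b [::] v.
(** For words of length at most |v|, [dwmx_bound] gives 2 K |v|; inserting this in [dsd_bound] gives
    4 K (2 K |v|) for each letter of v. Words of length up to 2 |v| occur, as [hK] anticipates. *)
Let L : R := 8 * (size v)%:R ^+ 2 * K ^+ 2.

Let L0 : 0 <= L. Proof. by rewrite !mulr_ge0 // ?exprn_ge0. Qed.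

Lemma DF_bound t x : S t -> size x = size v -> normc (DF (wmx (conf t) x) t) <= L.
Proof.
move=> St sx; apply: le_trans (@dsd_bound _ _ _ _ _ K ((2 * K) *+ size v) (size v) _ _ K0 _ _ _ _) _.
- by rewrite mulrn_wge0 // mulr_ge0.
- by rewrite add0n.
- by move=> w hw; apply: hK => //; move: hw; lia.
- move=> w hw; rewrite -[dwmx _ _ _ _]mul1mx -[1%:M]/(wmx (conf t) [::]).
  apply: le_trans (@dwmx_bound _ _ _ _ _ K (2 * size v) _ _ _ K0 _ _) _.
  + by rewrite sx /=; move: hw; lia.
  + by move=> w' hw'; apply: hK.
  + by apply: ler_wpMn2l => //; rewrite mulr_ge0.
- rewrite /L le_eqVlt; apply/orP; left; apply/eqP.
  by rewrite -[(2 * K) *+ _]mulr_natr -[LHS]mulr_natr; ring.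
Qed.

Let Fb (t : T) := Num.conj (F t).
Let DFb (E : Mx) (t : T) := Num.conj (DF (- adj E) t).

Let goodF : good F DF. Proof. exact: good_sd. Qed.
Let goodFb : good Fb DFb. Proof. exact: good_conj. Qed.

Lemma DFb_bound t : S t -> normc (DFb (wmx (conf t) v) t) <= L.
Proof.
move=> St; rewrite /DFb normc_conj adj_wmx; last by move=> p; exact: adj_conf.
have [_ _ lD _] := goodF.
have D0 : DF 0 t = 0.
  by have := lD (-1) 0 0 t; rewrite scaleN1r oppr0 addr0 mulN1r addNr.
have -> : DF (- wmx (conf t) (rev v)) t = - DF (wmx (conf t) (rev v)) t.
  by have := lD (-1) (wmx (conf t) (rev v)) 0 t; rewrite scaleN1r addr0 D0 addr0 mulN1r.
by rewrite normcN; apply: DF_bound => //; rewrite size_rev.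
Qed.

Let G q (t : T) : C := (normc (F t) ^+ (2 * q))%:C.

Let GE q t : G q t = F t ^+ q * Fb t ^+ q.
Proof. by rewrite /G -exprMn /Fb mulC_conj -rmorphXn exprM. Qed.

Let cokG q : cok S (G q).
Proof.
have [cF _ _ _] := goodF; have [cFb _ _ _] := goodFb.
rewrite (_ : G q = fun t => F t ^+ q * Fb t ^+ q); last by apply/funext => t; exact: GE.
by apply: cokM; exact: cokX.
Qed.

(** Integrate by parts the entries of W(v) times [h]. The divergence of the field times h is - d^2
    |F|^(2q+2); the derivative of h has q terms from F and q + 1 from its conjugate, each at most L
    |F|^(2q). *)
Lemma moment_step q : d%:R ^+ 2 * cI mu S (G q.+1) <= (2 * q).+1%:R * L * cI mu S (G q).
Proof.
have [cF cDF lF _] := goodF; have [cFb cDFb lFb _] := goodFb.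
pose h (t : T) := F t ^+ q * Fb t ^+ q.+1.
pose Dh E (t : T) := (F t ^+ q.-1 * DF E t) *+ q * Fb t ^+ q.+1
             + F t ^+ q * ((Fb t ^+ q * DFb E t) *+ q.+1).
have goodh : good h Dh := goodM SU (goodX SU q goodF) (goodX SU q.+1 goodFb).
have [ch cDh lDh _] := goodh.
pose W (t : T) : Mx := wmx (conf t) v.
have gW := mgood_wmx v.
have gij i j := goodM SU (gW i j) goodh.
have := fun i j => IBP mS Sbd SU i j (gij i j) => ibp.
have cij i j E : cok S (fun t => dwmx (conf t) b E v i j * h t + W t i j * Dh E t).
  by have [_ ] := gij i j.
have Z : cI mu S (fun t => \sum_i \sum_j
   (dwmx (conf t) b (delta_mx i j) v i j * h t + W t i j * Dh (delta_mx i j) t)) = 0.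
  rewrite (cI_sum mS (Sfin mS Sbd)); last by move=> i; apply: cok_sum => j; exact: cij.
  rewrite big1 // => i _; rewrite (cI_sum mS (Sfin mS Sbd)); last by move=> j; exact: cij.
  by rewrite big1 // => j _; exact: ibp.
(* By linearity in the direction, the sum over matrix units with coefficients W_ij is one derivative
   in the direction W, to which the bounds on words apply. *)
have DhW t : Dh (W t) t = \sum_i \sum_j W t i j * Dh (delta_mx i j) t.
  have D0 : Dh 0 t = 0.
    by have := lDh (-1) 0 0 t; rewrite scaleN1r oppr0 addr0 mulN1r addNr.
  rewrite {1}[W t]matrix_sum_delta.
  have Ds (I : Type) (r : seq I) (E : I -> Mx) : Dh (\sum_(i <- r) E i) t = \sum_(i <- r) Dh (E i) t.
    elim: r => [|i r IH]; first by rewrite !big_nil.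
    by rewrite !big_cons -IH; have := lDh 1 (E i) (\sum_(i <- r) E i) t; rewrite scale1r mul1r.
  rewrite Ds; apply: eq_bigr => i _; rewrite Ds; apply: eq_bigr => j _.
  by have := lDh (W t i j) (delta_mx i j) 0 t; rewrite addr0 D0 addr0.
have cDhW : cok S (fun t => Dh (W t) t).
  under eq_fun do rewrite DhW; apply: cok_sum => i; apply: cok_sum => j; apply: cokM => //.
  by have [] := gW i j.
have E1 : cI mu S (fun t => (- (d%:R ^+ 2))%:C * G q.+1 t + Dh (W t) t) = 0.
  rewrite -Z; apply: cI_eq => t _; rewrite DhW.
  under [RHS]eq_bigr do rewrite big_split /=.
  rewrite big_split /=; congr (_ + _).
  under [RHS]eq_bigr do rewrite -mulr_suml.
  rewrite -mulr_suml; have := @sum_dwmx_delta R P d (conf t) b [::] v d0.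
  under eq_bigr do under eq_bigr do rewrite mul1mx.
  move=> ->; rewrite GE -/(F t) /h [F t ^+ q.+1]exprS.
  have -> : (- d%:R ^+ 2)%:C = - (d%:R) ^+ 2 :> C.
    by rewrite rmorphN rmorphXn /= rmorph_nat.
  by rewrite !mulrA.
move: E1; rewrite (cID mS (Sfin mS Sbd)) //; last first.
  by apply: cokM => //; exact: cok_cst.
rewrite (cIZ mS (Sfin mS Sbd)) // mulNr => /eqP; rewrite addrC subr_eq0 => /eqP <-.
rewrite -(cIZ mS (Sfin mS Sbd)) //; apply: (cI_le mS (Sfin mS Sbd)) => //.
  by apply: cokM => //; exact: cok_cst.
move=> t St; rewrite ReMr /=.
apply: le_trans (ler_norm _) (le_trans (normc_ge_Re _) _).
have nFb : normc (Fb t) = normc (F t) by rewrite normc_conj.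
have f0 := normc_ge0 (F t).
apply: le_trans (normcD _ _) _; rewrite !normcM.
have nMn (z : C) m : normc (z *+ m) = normc z *+ m.
  by rewrite -[LHS]/(normc (z *+ m)) -mulr_natl -(rmorph_nat (real_complex R)) normcMr normr_nat mulr_natl.
rewrite !nMn !normcM !normcX nFb.
have -> : (2 * q).+1%:R * L * normc (F t) ^+ (2 * q) =
  (normc (F t) ^+ (2 * q) * L) *+ q + (normc (F t) ^+ (2 * q) * L) *+ q.+1.
  rewrite -mulrnDr -[RHS]mulr_natl (_ : (q + q.+1 = (2 * q).+1)%N); last by lia.
  by rewrite -mulrA [L * _]mulrC.
apply: lerD.
  have := DF_bound St (erefl (size v)); rewrite -/(W t).
  move: (DF (W t) t) => D hD; move: (normc D) (normc (F t)) hD f0 => nD f hD f0.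
  (* At q = 0 the truncated exponent [q.-1] is harmless, as the term has multiplicity 0. *)
  case: (q) => [|q1]; first by rewrite !mulr0n mul0r.
  rewrite mulrnAl; apply: ler_wMn2r.
  rewrite mulrAC -exprD (_ : q1.+1.-1 + q1.+2 = 2 * q1.+1)%N; last by rewrite /=; lia.
  by apply: ler_wpM2l; first exact: exprn_ge0.
rewrite mulrnAr; apply: ler_wMn2r; rewrite mulrA -exprD addnn mul2n.
by apply: ler_wpM2l; [exact: exprn_ge0|exact: DFb_bound].
Qed.

(** The product of the odd factors from [moment_step] is bounded crudely by (2q)^q, which costs only
    a constant in the exponent below. *)
Lemma moment_bound q : cI mu S (G q) <= ((2 * q)%:R * (L / d%:R ^+ 2)) ^+ q * fine (mu S).
Proof.
have dd : 0 < d%:R ^+ 2 :> R by rewrite exprn_gt0 // ltr0n.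
have m0 : 0 <= fine (mu S) by apply: fine_ge0.
elim: q => [|q IH].
  rewrite expr0 mul1r; apply: le_trans (ler_norm _) _; rewrite -[leRHS]mul1r.
  apply: (cI_bound mS (Sfin mS Sbd)) => // t St.
  by rewrite /G expr0 normc1.
have L1 : 0 <= L / d%:R ^+ 2 by rewrite divr_ge0 // ltW.
have h := moment_step q; rewrite mulrC -ler_pdivlMr // in h.
apply: le_trans h _.
have -> : (2 * q).+1%:R * L * cI mu S (G q) / d%:R ^+ 2 =
  (2 * q).+1%:R * (L / d%:R ^+ 2) * cI mu S (G q) by rewrite mulrAC mulrA.
rewrite [((2 * q.+1)%:R * _) ^+ q.+1]exprS -[leRHS]mulrA; apply: ler_pM => //.
- by rewrite mulr_ge0.
- by apply: Rintegral_ge0 => t _ /=; rewrite exprn_ge0 // normc_ge0.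
- by apply: ler_wpM2r => //; rewrite ler_nat; lia.
- apply: le_trans IH _; apply: ler_wpM2r => //.
  apply: lerXn2r; rewrite ?nnegrE ?mulr_ge0 //.
  by apply: ler_wpM2r => //; rewrite ler_nat; lia.
Qed.

(* Markov's inequality for the moment of order 2q, q the integer part of kap d^2. *)
Lemma concentration (dl kap : R) : 0 < dl -> 0 <= kap ->
  2 * kap * L * expR 1 <= dl ^+ 2 ->
  (mu (S `&` [set t | (dl <= normc (F t))%R]) <= (expR (1 - kap * d%:R ^+ 2)%R)%:E * mu S)%E.
Proof.
move=> dl0 kap0 hkap; set B := _ `&` _.
have [[mF1 mF2] _] : cok S F by have [] := goodF.
have mB : measurable B.
  apply: measurableI => //.
  rewrite (_ : [set t | _] = (fun t => normc (F t) ^+ 2) @^-1` `[dl ^+ 2, +oo[%classic).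
    by apply: measurable_preim => //; exact: cmeas_normc.
  apply/seteqP; split=> t /=; rewrite in_itv /= andbT => h.
    by apply: lerXn2r => //; rewrite nnegrE ?normc_ge0 // ltW.
  by rewrite -(@ler_pXn2r _ 2) ?nnegrE ?normc_ge0 // ltW.
have Sf := Sfin mS Sbd.
have Bf : (mu B < +oo)%E.
  by apply: le_lt_trans Sf; apply: le_measure; rewrite ?inE //; exact: subIsetl.
have dd : 0 < d%:R ^+ 2 :> R by rewrite exprn_gt0 // ltr0n.
pose q := Num.trunc (kap * d%:R ^+ 2).
have kd0 : 0 <= kap * d%:R ^+ 2 by rewrite mulr_ge0 // ltW.
have q1 : q%:R <= kap * d%:R ^+ 2 by rewrite truncn_le.
have q2 : kap * d%:R ^+ 2 <= q.+1%:R by apply: ltW; exact: truncnS_gt.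
have cheb : dl ^+ (2 * q) * fine (mu B) <= cI mu S (G q).
  have c1 : cok S (fun t => (\1_B t)%:C : C).
    split; first by apply: cmeas_real; exact: measurable_indic.
    exists 1 => t _; rewrite normc_real indicE; case: (_ \in _); rewrite /= ?normr1 ?normr0 //.
  have -> : fine (mu B) = cI mu S (fun t => (\1_B t)%:C : C).
    rewrite /cI /Rintegral /= integral_indic //; congr (fine (mu _)).
    by rewrite setIidl //; exact: subIsetl.
  rewrite -(cIZ mS Sf) //; apply: (cI_le mS Sf) => //.
    by apply: cokM => //; exact: cok_cst.
  move=> t St; rewrite ReMr /= indicE; case: (boolP (t \in B)) => [/set_mem [_ /= h]|_].
    by rewrite mulr1; apply: lerXn2r => //; rewrite nnegrE ?normc_ge0 //; exact: ltW.
  by rewrite mulr0 exprn_ge0 // normc_ge0.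
have Sn : mu S \is a fin_num by rewrite ge0_fin_numE.
have Bn : mu B \is a fin_num by rewrite ge0_fin_numE.
rewrite -(fineK Sn) -(fineK Bn) -EFinM lee_fin.
have m0 : 0 <= fine (mu S) by apply: fine_ge0.
have dlq : 0 < dl ^+ (2 * q) by exact: exprn_gt0.
have e0 := @expR_gt0 R 1.
(* Since q <= kap d^2, the base 2 q L / d^2 is at most 2 kap L, hence at most dl^2 / e by
   hypothesis: each of the q factors gains 1/e. *)
have step : ((2 * q)%:R * (L / d%:R ^+ 2)) ^+ q <= dl ^+ (2 * q) * expR (- q%:R).
  have -> : expR (- q%:R) = (expR 1)^-1 ^+ q :> R.
    by rewrite -expRN -expRM_natl mulrN1.
  rewrite exprM -exprMn; apply: lerXn2r; rewrite ?nnegrE.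
  - by rewrite mulr_ge0 // divr_ge0 // ltW.
  - by rewrite mulr_ge0 // ?exprn_ge0 ?invr_ge0 // ltW.
  rewrite ler_pdivlMr // mulrA mulrAC ler_pdivrMr //.
  apply: (@le_trans _ _ (2 * kap * L * expR 1 * d%:R ^+ 2)).
    rewrite natrM; have Le : 0 <= L * expR 1 by rewrite mulr_ge0 // ltW.
    rewrite [leLHS](_ : _ = 2 * (L * expR 1) * q%:R); last by ring.
    rewrite [leRHS](_ : _ = 2 * (L * expR 1) * (kap * d%:R ^+ 2)); last by ring.
    by apply: ler_wpM2l => //; rewrite mulr_ge0.
  by apply: ler_wpM2r => //; exact: ltW.
rewrite -(ler_pM2l dlq); apply: le_trans (le_trans cheb (moment_bound q)) _.
rewrite [leRHS]mulrA; apply: ler_wpM2r => //; apply: le_trans step _.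
apply: ler_wpM2l; first exact: ltW.
(* Rounding kap d^2 down to q loses less than 1; this is the 1 in the exponent. *)
by rewrite ler_expR; move: q2; rewrite -natr1; lra.
Qed.

End Concentration.

(** * Moment bounds independent of the cut-off *)

Section CauchySchwarz.
Variable R : realType.
Local Notation C := R[i].

Lemma sum_cauchy_schwarz (I : finType) (a b : I -> R) :
  (\sum_i a i * b i) ^+ 2 <= (\sum_i a i ^+ 2) * (\sum_i b i ^+ 2).
Proof.
(* Lagrange's identity. *)
have key : 0 <= \sum_i \sum_j (a i * b j - a j * b i) ^+ 2.
  by apply: sumr_ge0 => i _; apply: sumr_ge0 => j _; exact: sqr_ge0.
have e1 : \sum_i \sum_j (a i ^+ 2 * b j ^+ 2) = (\sum_i a i ^+ 2) * (\sum_i b i ^+ 2).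
  by rewrite mulr_suml; apply: eq_bigr => i _; rewrite mulr_sumr.
have e2 : \sum_i \sum_j ((a i * b i) * (a j * b j)) = (\sum_i a i * b i) ^+ 2.
  by rewrite expr2 mulr_suml; apply: eq_bigr => i _; rewrite mulr_sumr.
have e3 : \sum_i \sum_j (a j ^+ 2 * b i ^+ 2) = (\sum_i a i ^+ 2) * (\sum_i b i ^+ 2).
  by rewrite exchange_big.
have : \sum_i \sum_j (a i * b j - a j * b i) ^+ 2 =
  \sum_i \sum_j (a i ^+ 2 * b j ^+ 2) - 2 * (\sum_i \sum_j ((a i * b i) * (a j * b j)))
   + \sum_i \sum_j (a j ^+ 2 * b i ^+ 2).
  rewrite mulr_sumr -sumrB -big_split; apply: eq_bigr => i _ /=.
  rewrite mulr_sumr -sumrB -big_split; apply: eq_bigr => j _ /=; ring.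
by move=> E; move: key; rewrite E e1 e2 e3; lra.
Qed.

Lemma normc_cauchy_schwarz (I : finType) (x y : I -> C) :
  normc (\sum_i x i * y i) ^+ 2 <= (\sum_i normc (x i) ^+ 2) * (\sum_i normc (y i) ^+ 2).
Proof.
apply: le_trans (sum_cauchy_schwarz (fun i => normc (x i)) (fun i => normc (y i))).
rewrite ler_pXn2r ?nnegrE ?normc_ge0 //; last first.
  by apply: sumr_ge0 => i _; rewrite mulr_ge0 ?normc_ge0.
by apply: le_trans (normc_sum _ _ _) _; apply: ler_sum => i _; rewrite normcM.
Qed.

Definition hs2 m n (A : 'M[C]_(m, n)) : R := \sum_i \sum_j normc (A i j) ^+ 2.

Lemma hs2_ge0 m n (A : 'M[C]_(m, n)) : 0 <= hs2 A.
Proof. by apply: sumr_ge0 => i _; apply: sumr_ge0 => j _; exact: sqr_ge0. Qed.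

Lemma tr_adj n (A : 'M[C]_n) : \tr (A *m adj A) = (hs2 A)%:C.
Proof.
rewrite /mxtrace /hs2 rmorph_sum; apply: eq_bigr => i _.
by rewrite mxE rmorph_sum; apply: eq_bigr => j _; rewrite !mxE mulC_conj.
Qed.

Lemma tr_cauchy_schwarz n (A B : 'M[C]_n) :
  normc (\tr (A *m B)) ^+ 2 <= hs2 A * hs2 B.
Proof.
have -> : \tr (A *m B) = \sum_(p : 'I_n * 'I_n) A p.1 p.2 * B p.2 p.1.
  rewrite -(pair_bigA _ (fun i j => A i j * B j i)) /=; apply: eq_bigr => i _.
  by rewrite mxE.
apply: le_trans (normc_cauchy_schwarz _ _) _.
rewrite -(pair_bigA _ (fun i j => normc (A i j) ^+ 2)) /=.
rewrite -(pair_bigA _ (fun i j => normc (B j i) ^+ 2)) /=.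
by rewrite [X in _ * X]exchange_big.
Qed.

Lemma vnorm_ge0 d (v : 'cV[C]_d) : 0 <= vnorm v.
Proof. exact: sqrtr_ge0. Qed.

Lemma vnorm2 d (v : 'cV[C]_d) : vnorm v ^+ 2 = hs2 v.
Proof.
rewrite /vnorm sqr_sqrtr; last by apply: sumr_ge0 => i _; exact: sqr_ge0.
by apply: eq_bigr => i _; rewrite big_ord1.
Qed.

Lemma vnormM d (A : 'M[C]_d) (v : 'cV[C]_d) : vnorm (A *m v) ^+ 2 <= hs2 A * vnorm v ^+ 2.
Proof.
rewrite !vnorm2 /hs2 mulr_suml; apply: ler_sum => i _; rewrite big_ord1 mxE.
apply: le_trans (normc_cauchy_schwarz (fun j => A i j) (fun j => v j 0)) _.
by under [X in _ <= _ * X]eq_bigr do rewrite big_ord1.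
Qed.

Lemma vnorm_tr d (v : 'cV[C]_d) : \tr (adj v *m v) = (vnorm v ^+ 2)%:C.
Proof. by rewrite mxtrace_mulC vnorm2 /hs2 /mxtrace rmorph_sum; apply: eq_bigr => i _;
  rewrite mxE rmorph_sum; apply: eq_bigr => j _; rewrite !mxE mulC_conj. Qed.

Lemma vnorm_unitary d (U : 'M[C]_d) (v : 'cV[C]_d) : adj U *m U = 1%:M ->
  vnorm (U *m v) = vnorm v.
Proof.
move=> hU; apply/eqP; rewrite -(@eqrXn2 _ 2) ?vnorm_ge0 //; apply/eqP.
apply: (@complexI R); rewrite -!vnorm_tr adjM -!mulmxA (mulmxA (adj U)) hU mul1mx //.
Qed.

Lemma vnormD d (u v : 'cV[C]_d) : vnorm (u + v) <= vnorm u + vnorm v.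
Proof.
rewrite -(@ler_pXn2r _ 2) ?nnegrE ?addr_ge0 ?vnorm_ge0 //.
have cs : (\sum_i normc (u i 0) * normc (v i 0)) <= vnorm u * vnorm v.
  rewrite -(@ler_pXn2r _ 2) ?nnegrE ?mulr_ge0 ?vnorm_ge0 //; last first.
    by apply: sumr_ge0 => i _; rewrite mulr_ge0 ?normc_ge0.
  rewrite exprMn !vnorm2 /hs2; under [X in _ <= X * _]eq_bigr do rewrite big_ord1.
  under [X in _ <= _ * X]eq_bigr do rewrite big_ord1.
  exact: sum_cauchy_schwarz.
apply: (@le_trans _ _ (hs2 u + 2 * (\sum_i normc (u i 0) * normc (v i 0)) + hs2 v)).
  rewrite vnorm2 /hs2 mulr_sumr -!big_split; apply: ler_sum => i _ /=; rewrite !big_ord1 mxE.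
  apply: (@le_trans _ _ ((normc (u i 0) + normc (v i 0)) ^+ 2)).
    by rewrite ler_pXn2r ?nnegrE ?addr_ge0 ?normc_ge0 // normcD.
  by rewrite le_eqVlt; apply/orP; left; apply/eqP; ring.
by rewrite sqrrD !vnorm2 -mulr_natl; lra.
Qed.

Lemma vnorm0 d : vnorm (0 : 'cV[C]_d) = 0.
Proof. by rewrite /vnorm big1 ?sqrtr0 // => i _; rewrite mxE normc0 expr0n. Qed.

Lemma vnormZ d (c : C) (v : 'cV[C]_d) : vnorm (c *: v) = normc c * vnorm v.
Proof.
apply/eqP; rewrite -(@eqrXn2 _ 2) ?mulr_ge0 ?normc_ge0 ?vnorm_ge0 //; apply/eqP.
rewrite exprMn !vnorm2 /hs2 mulr_sumr; apply: eq_bigr => i _.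
by rewrite !big_ord1 mxE normcM exprMn.
Qed.

Lemma opnorm_leP d (B : 'M[C]_d) (r : R) : 0 <= r ->
  opnorm B <= r <-> (forall v, vnorm (B *m v) <= r * vnorm v).
Proof.
move=> r0; have ne : [set vnorm (B *m v) | v in [set v : 'cV_d | vnorm v <= 1]] !=set0.
  by exists 0; exists 0; rewrite /= ?vnorm0 // mulmx0 vnorm0.
(* The Hilbert-Schmidt norm bounds the set, so that [sup] is a genuine supremum. *)
have ub : ubound [set vnorm (B *m v) | v in [set v : 'cV_d | vnorm v <= 1]] (Num.sqrt (hs2 B)).
  move=> _ [v /= v1 <-]; rewrite -(@ler_pXn2r _ 2) ?nnegrE ?vnorm_ge0 ?sqrtr_ge0 //.
  apply: le_trans (vnormM _ _) _; rewrite [leRHS]sqr_sqrtr ?hs2_ge0 //.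
  by rewrite ler_piMr ?hs2_ge0 // expr_le1 ?vnorm_ge0.
split=> [h v|h].
  have [v0|v0] := eqVneq (vnorm v) 0.
    rewrite v0 mulr0 -(@ler_pXn2r _ 2) ?nnegrE ?vnorm_ge0 //.
    by apply: le_trans (vnormM _ _) _; rewrite v0 expr0n mulr0.
  have vp : 0 < vnorm v by rewrite lt_def v0 vnorm_ge0.
  have : vnorm (B *m ((vnorm v)^-1%:C *: v)) <= opnorm B.
    apply: sup_ubound; first by exists (Num.sqrt (hs2 B)).
    exists ((vnorm v)^-1%:C *: v) => //=.
    by rewrite vnormZ normc_real ger0_norm ?invr_ge0 ?vnorm_ge0 // mulVf.
  move=> /le_trans /(_ h); rewrite -scalemxAr vnormZ normc_real ger0_norm ?invr_ge0 ?vnorm_ge0 //.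
  by rewrite mulrC ler_pdivrMr.
apply: sup_le_ub => // _ [v /= v1 <-]; apply: le_trans (h v) _.
by rewrite ler_piMr.
Qed.

Lemma entry_le_opnorm d (B : 'M[C]_d) r i j : 0 <= r -> opnorm B <= r -> normc (B i j) <= r.
Proof.
move=> r0 /(opnorm_leP _ r0) /(_ (delta_mx j 0)) h.
have e1 : vnorm (delta_mx j 0 : 'cV[C]_d) = 1.
  rewrite /vnorm (bigD1 j) //= mxE !eqxx normc1 expr1n big1 ?addr0 ?sqrtr1 //.
  by move=> k kj; rewrite mxE (negbTE kj) normc0 expr0n.
rewrite e1 mulr1 in h; apply: le_trans h.
rewrite -(@ler_pXn2r _ 2) ?nnegrE ?vnorm_ge0 ?normc_ge0 // vnorm2 /hs2 (bigD1 i) //= big_ord1.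
rewrite -colE mxE lerDl; apply: sumr_ge0 => k _; apply: sumr_ge0 => k' _; exact: sqr_ge0.
Qed.

Lemma opnorm_unitary d (U B : 'M[C]_d) r : 0 <= r -> unitary U -> opnorm B <= r ->
  opnorm (U *m B *m adj U) <= r.
Proof.
move=> r0 [hU hU'] /(opnorm_leP _ r0) h; apply/(opnorm_leP _ r0) => v.
rewrite -!mulmxA vnorm_unitary //; apply: le_trans (h _) _.
by rewrite vnorm_unitary // adjK.
Qed.
End CauchySchwarz.

Section TraceHolder.
Variables (R : realType) (d : nat).
Local Notation C := R[i].
Local Notation Mx := 'M[C]_d.

Lemma wtr_cauchy_schwarz (P : finType) (B : P -> Mx) u v : (forall p, adj (B p) = B p) ->
  normc (wtr B (u ++ v)) ^+ 2 <= normc (wtr B (rev u ++ u)) * normc (wtr B (v ++ rev v)).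
Proof.
move=> hB; rewrite /wtr !wmx_cat -!adj_wmx //.
rewrite [ntrace (adj _ *m _)]ntraceC /ntrace !tr_adj.
set c : C := d%:R^-1; have e (x y z : C) : normc x ^+ 2 <= normc y * normc z ->
    normc (c * x) ^+ 2 <= normc (c * y) * normc (c * z).
  move=> h; rewrite !normcM (_ : _ * _ * _ = normc c ^+ 2 * (normc y * normc z)); last by ring.
  by rewrite exprMn; apply: ler_wpM2l => //; exact: sqr_ge0.
apply: e; rewrite !normc_real !ger0_norm ?hs2_ge0 //; exact: tr_cauchy_schwarz.
Qed.

(* A word of length 2^a maximizing |tau| can be chosen with ever longer constant
   initial runs: Cauchy-Schwarz replaces it by u* u, which doubles the run. *)
Lemma wtr_pow2_bound (P : finType) (B : P -> Mx) a (K : R) : (forall p, adj (B p) = B p) ->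
  0 <= K -> (forall p, normc (wtr B (nseq (2 ^ a) p)) <= K) ->
  forall w, size w = (2 ^ a)%N -> normc (wtr B w) <= K.
Proof.
move=> hB K0 hK w sw.
pose W := in_tuple w; rewrite /= in W.
have [w0 sw0 w0max] : exists2 w0 : seq P, size w0 = (2 ^ a)%N &
    forall w', size w' = (2 ^ a)%N -> normc (wtr B w') <= normc (wtr B w0).
  pose wt : (2 ^ a)%N.-tuple P := tcast sw W.
  case: (@Order.TotalTheory.arg_maxP _ _ _ wt xpredT (fun t : (2 ^ a)%N.-tuple P => normc (wtr B t)) isT) => t0 _ h.
  exists t0; first by rewrite size_tuple.
  by move=> w' sw'; have := h (tcast sw' (in_tuple w')) isT; rewrite val_tcast.
set K1 := normc (wtr B w0) in w0max.
apply: le_trans (w0max w sw) _.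
have [K10|K10] := eqVneq K1 0; first by rewrite K10.
have K1p : 0 < K1 by rewrite lt_def K10 normc_ge0.
have run i : (i <= a)%N -> exists q rest, size (nseq (2 ^ i) q ++ rest) = (2 ^ a)%N /\
    normc (wtr B (nseq (2 ^ i) q ++ rest)) = K1.
  elim: i => [|i IH] ia.
    case e : w0 sw0 => [|q rest] sw0; first by have := expn_gt0 2 a; rewrite -sw0.
    by exists q, rest; rewrite /K1 e.
  have [q [rest [sz eq]]] := IH (ltnW ia).
  have h2 : (2 ^ a = 2 ^ a.-1 + 2 ^ a.-1)%N.
    by rewrite addnn -mul2n -expnS prednK //; exact: leq_ltn_trans ia.
  have ile : (2 ^ i <= 2 ^ a.-1)%N by rewrite leq_exp2l // -ltnS prednK //; exact: leq_ltn_trans ia.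
  pose u' := take (2 ^ a.-1 - 2 ^ i) rest; pose v := drop (2 ^ a.-1 - 2 ^ i) rest.
  pose u := nseq (2 ^ i) q ++ u'.
  have euv : nseq (2 ^ i) q ++ rest = u ++ v by rewrite /u -catA cat_take_drop.
  move: sz; rewrite size_cat size_nseq => sz.
  have su' : size u' = (2 ^ a.-1 - 2 ^ i)%N by rewrite size_takel //; lia.
  have sv : size v = (2 ^ a.-1)%N by rewrite size_drop; lia.
  exists q, (u' ++ rev u').
  have erot : normc (wtr B (nseq (2 ^ i.+1) q ++ u' ++ rev u')) = normc (wtr B (rev u ++ u)).
    have rn : rev (nseq (2 ^ i) q) = nseq (2 ^ i) q.
      apply: (@eq_from_nth _ q) => [|j]; rewrite size_rev ?size_nseq // => jl.
      by rewrite nth_rev ?size_nseq // !nth_nseq jl ifT // ltn_subrL; lia.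
    (* The two runs of q meet in the middle of u* u; traciality then rotates the doubled run to the
       front. *)
    have -> : rev u ++ u = rev u' ++ (nseq (2 ^ i.+1) q ++ u').
      by rewrite /u rev_cat rn expnS mul2n -addnn nseqD -!catA.
    by rewrite [in RHS]wtrC -catA.
  split; first by rewrite size_cat size_nseq size_cat size_rev su' expnS; lia.
  rewrite erot; apply/eqP; rewrite eq_le; apply/andP; split.
    by apply: w0max; rewrite size_cat size_rev /u size_cat size_nseq su'; lia.
  have := wtr_cauchy_schwarz u v hB; rewrite -euv eq => h.
  have hv : normc (wtr B (v ++ rev v)) <= K1.
    by apply: w0max; rewrite size_cat size_rev sv; lia.
  have : K1 ^+ 2 <= normc (wtr B (rev u ++ u)) * K1.
    by apply: le_trans h _; apply: ler_wpM2l => //; exact: normc_ge0.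
  by rewrite expr2 ler_pM2r.
have [q [rest [sz <-]]] := run a (leqnn a).
have -> : rest = [::] by apply: size0nil; move: sz; rewrite size_cat size_nseq; lia.
by rewrite cats0.
Qed.

(** Shorter words are padded to length 2^a with an extra letter [None] standing for the identity
    matrix. The condition 1 <= K covers the constant word in this letter, whose normalized trace is
    1, or 0 if d = 0. *)
Lemma wtr_bound (P : finType) (B : P -> Mx) a (K : R) : (forall p, adj (B p) = B p) ->
  1 <= K -> (forall p, normc (wtr B (nseq (2 ^ a) p)) <= K) ->
  forall w, (size w <= 2 ^ a)%N -> normc (wtr B w) <= K.
Proof.
move=> hB K1 hK w sw; have K0 : 0 <= K by exact: le_trans K1.
pose B' (p : option P) : Mx := if p is Some q then B q else 1%:M.
have eS v : wmx B' (map Some v) = wmx B v by elim: v => [//|x v IH] /=; rewrite IH.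
have eN n : wmx B' (nseq n None) = 1%:M by elim: n => [//|n IH] /=; rewrite IH mul1mx.
have := @wtr_pow2_bound _ B' a K _ K0 _ (map Some w ++ nseq (2 ^ a - size w) None).
rewrite /wtr wmx_cat eS eN mulmx1; apply.
- by case=> [p|] /=; [exact: hB|rewrite /adj trmx1 map_mx1].
- case=> [p|].
    have -> : nseq (2 ^ a) (Some p) = map Some (nseq (2 ^ a) p) by rewrite map_nseq.
    by rewrite eS; exact: hK.
  rewrite eN /ntrace mxtrace1 normcM; have [->|d0] := eqVneq (d%:R : C) 0.
    by rewrite normc0 mulr0.
  by rewrite -normcM mulVf // normc1.
- by rewrite size_cat size_map size_nseq subnKC.
Qed.

End TraceHolder.

(** * Microstate sets *)

Lemma measurable_forall d (T : measurableType d) (I : countType) (S : I -> set T) :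
  (forall i, measurable (S i)) -> measurable [set t | forall i, S i t].
Proof.
move=> mS.
rewrite (_ : [set t | _] = \bigcap_n (if @choice.unpickle I n is Some i then S i else setT)).
  by apply: bigcapT_measurable => n; case: (choice.unpickle n).
apply/seteqP; split=> t h.
  by move=> n _; case: (choice.unpickle n).
by move=> i; have := h (choice.pickle i) Logic.I; rewrite choice.pickleK.
Qed.

Section RationalVectors.
Variables (R : realType) (d : nat).
Local Notation C := R[i].

(** A countable dense family of vectors: it turns the operator norm condition, a supremum over
    uncountably many vectors, into countably many measurable conditions. *)
Definition ratvec (f : {ffun 'I_d -> rat * rat}) : 'cV[C]_d :=
  \col_i (ratr (f i).1 +i* ratr (f i).2).

Lemma vnorm_le_sum (v : 'cV[C]_d) : vnorm v <= \sum_i normc (v i 0).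
Proof.
have s0 : 0 <= \sum_i normc (v i 0) by apply: sumr_ge0 => i _; exact: normc_ge0.
rewrite -(@ler_pXn2r _ 2) ?nnegrE ?vnorm_ge0 // vnorm2 /hs2 expr2 mulr_suml.
apply: ler_sum => i _; rewrite big_ord1 expr2; apply: ler_wpM2l; first exact: normc_ge0.
by rewrite (bigD1 i) //= lerDl; apply: sumr_ge0 => j _; exact: normc_ge0.
Qed.

Lemma ratvec_dense (v : 'cV[C]_d) (e : R) : 0 < e -> exists f, vnorm (v - ratvec f) <= e.
Proof.
move=> e0; pose dl := e / (2 * d.+1%:R).
have dl0 : 0 < dl by rewrite divr_gt0 // mulr_gt0.
have /choice [q hq] (x : R) : exists q : rat, `|x - ratr q| <= dl.
  have [q] := @rat_in_itvoo R (x - dl) (x + dl) ltac:(by rewrite ltrBlDr -addrA ltrDl addr_gt0).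
  rewrite in_itv /= => /andP[h1 h2]; exists q.
  by rewrite ler_norml; apply/andP; split; lra.
exists [ffun i => (q (Re (v i 0)), q (Im (v i 0)))].
apply: le_trans (vnorm_le_sum _) _.
have h i : normc ((v - ratvec [ffun i => (q (Re (v i 0)), q (Im (v i 0)))]) i 0) <= 2 * dl.
  rewrite !mxE ffunE /=; apply: le_trans (normc_le_ReIm _) _.
  rewrite ReD ImD ReN ImN /= mulr2n mulrDl mul1r; apply: lerD; exact: hq.
apply: le_trans (ler_sum _ (fun i _ => h i)) _.
rewrite sumr_const card_ord /dl -mulr_natr.
have dn : d.+1%:R != 0 :> R by rewrite pnatr_eq0.
rewrite [leLHS](_ : _ = e * (d%:R / d.+1%:R)); last first.
  by move: (d.+1%:R) dn => D dn; field.
apply: ler_piMr; first exact: ltW.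
by rewrite ler_pdivrMr ?ltr0n // mul1r ler_nat.
Qed.

(** The inequality passes from nearby rational vectors to v because [B] is continuous, with the
    Hilbert-Schmidt norm as Lipschitz constant. Squares make both sides free of roots in the entries
    of B. *)
Lemma opnorm_ratP (B : 'M[C]_d) (r : R) : 0 <= r -> opnorm B <= r <->
  forall f, vnorm (B *m ratvec f) ^+ 2 <= (r * vnorm (ratvec f)) ^+ 2.
Proof.
move=> r0; rewrite opnorm_leP //; split=> [h f|h v].
  by rewrite ler_pXn2r ?nnegrE ?mulr_ge0 ?vnorm_ge0.
apply/ler_addgt0Pr => e e0.
pose H := Num.sqrt (hs2 B); have H0 : 0 <= H by exact: sqrtr_ge0.
have [f hf] := @ratvec_dense v (e / (H + r + 1)) (divr_gt0 e0 (ltr_wpDl (addr_ge0 H0 r0) ltr01)).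
have hB w : vnorm (B *m w) <= H * vnorm w.
  rewrite -(@ler_pXn2r _ 2) ?nnegrE ?mulr_ge0 ?vnorm_ge0 // exprMn [X in _ <= X * _]sqr_sqrtr ?hs2_ge0 //.
  exact: vnormM.
have {h} h : vnorm (B *m ratvec f) <= r * vnorm (ratvec f).
  by have := h f; rewrite ler_pXn2r ?nnegrE ?mulr_ge0 ?vnorm_ge0.
have e1 : B *m v = B *m ratvec f + B *m (v - ratvec f) by rewrite -mulmxDr addrC subrK.
have e2 : vnorm (ratvec f) <= vnorm v + vnorm (v - ratvec f).
  have e3 : ratvec f = v + (-1) *: (v - ratvec f) by rewrite scaleN1r opprB addrC subrK.
  by rewrite {1}e3; apply: le_trans (vnormD _ _) _; rewrite vnormZ normcN normc1 mul1r.
rewrite e1; apply: le_trans (vnormD _ _) _.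
apply: (@le_trans _ _ (r * (vnorm v + vnorm (v - ratvec f)) + H * vnorm (v - ratvec f))).
  by apply: lerD; [apply: le_trans h _; exact: ler_wpM2l|exact: hB].
rewrite mulrDr -addrA lerD2l -mulrDl.
apply: (@le_trans _ _ ((r + H) * (e / (H + r + 1)))).
  by apply: ler_wpM2l => //; rewrite addr_ge0.
rewrite mulrA ler_pdivrMr; last by rewrite ltr_wpDl // addr_ge0.
by rewrite mulrC ler_pM2l // [r + H]addrC lerDl.
Qed.

End RationalVectors.

Section Microstates.
Context (R : realType) (A : cstarAlgebra R) (phi : {scalar A}).
Context (I J : finType) (X : I -> A) (Y : J -> A).
Local Notation C := R[i].
Local Notation P := (I + J)%type.

(** The word whose matrix trace a microstate compares with [phiw s t]: right letters come in reverse
    order. *)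
Definition mword (s : seq I) (t : seq J) : seq P := map inl s ++ map inr (rev t).
Definition phiw (s : seq I) (t : seq J) : C :=
  phi ((\prod_(i <- s) X i) * (\prod_(j <- t) Y j)).

Variables (d : nat) (r : R) (M : nat) (eps : R).
Hypotheses (r0 : 0 <= r) (eps0 : 0 < eps).
Local Notation N := #|{: P * 'I_d * 'I_d}|.
Local Notation T := (N.-tuple (measurableTypeR R)).

Lemma wmx_prod (B : P -> 'M[C]_d) s t :
  wmx B (mword s t) = (\prod_(i <- s) B (inl i)) *m (\prod_(j <- rev t) B (inr j)).
Proof.
rewrite wmx_cat; congr (_ *m _).
  by elim: s => [|i s IH]; rewrite ?big_nil ?big_cons //= IH.
by elim: (rev t) => [|i u IH]; rewrite ?big_nil ?big_cons //= IH.
Qed.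

Lemma microstatesP (B : P -> 'M[C]_d) : microstates phi X Y r M eps B <->
  (forall p, adj (B p) = B p /\ opnorm (B p) <= r) /\
  forall s t, (1 <= size s + size t <= M)%N -> normc (phiw s t - wtr B (mword s t)) < eps.
Proof.
split=> -[h1 h2]; split=> [p|s t hst].
- by have [h h'] := h1 p; split=> //; apply/eqP; rewrite -adj_herm.
- by have := h2 s t hst; rewrite normcE ltcR /wtr wmx_prod.
- by have [h h'] := h1 p; split=> //; rewrite adj_herm h eqxx.
- by have := h2 s t hst; rewrite normcE ltcR /wtr wmx_prod.
Qed.

Definition ms : set T := [set t | microstates phi X Y r M eps (conf t)].

Lemma mxmeas_wmx (v : seq P) : mxmeas (fun t : T => wmx (conf t) v).
Proof.
elim: v => [|a v IH] /=; first exact: mxmeas_cst.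
by apply: mxmeasM => //; exact: mxmeas_conf.
Qed.

Lemma measurable_ms : measurable ms.
Proof.
rewrite (_ : ms = [set t | forall p, opnorm (conf t p) <= r] `&`
   [set t : T | forall st : seq I * seq J, (1 <= size st.1 + size st.2 <= M)%N ->
       normc (phiw st.1 st.2 - wtr (conf t) (mword st.1 st.2)) < eps]); last first.
  apply/seteqP; split=> t.
    move=> /microstatesP [h1 h2]; split; first by move=> p; case: (h1 p).
    by move=> [s u] /= /h2.
  move=> [h1 h2]; apply/microstatesP; split; first by move=> p; split; [exact: adj_conf|exact: h1].
  by move=> s u hsu; exact: (h2 (s, u)).
apply: measurableI.
  apply: (@measurable_forall _ _ _ (fun p => [set t : T | opnorm (conf t p) <= r])) => p.
  rewrite (_ : [set t | _] = [set t : T | forall f, vnorm (conf t p *m ratvec R f) ^+ 2 <= (r * vnorm (ratvec R f)) ^+ 2]); last first.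
    by apply/seteqP; split=> t /=; [move/(opnorm_ratP _ r0)|move=> h; apply/(opnorm_ratP _ r0)].
  apply: (@measurable_forall _ _ _ (fun f => [set t : T | vnorm (conf t p *m ratvec R f) ^+ 2 <= (r * vnorm (ratvec R f)) ^+ 2])) => f.
  rewrite (_ : [set t | _] = (fun t : T => vnorm (conf t p *m ratvec R f) ^+ 2) @^-1` `]-oo, (r * vnorm (ratvec R f)) ^+ 2]%classic); last first.
    by apply/seteqP; split=> t /=; rewrite in_itv.
  apply: measurable_preim => //; under eq_fun do rewrite vnorm2.
  apply: measurable_sum => i; apply: measurable_sum => j; apply: cmeas_normc.
  by apply: mxmeasM; [exact: mxmeas_conf|exact: mxmeas_cst].
apply: (@measurable_forall _ _ _ (fun st : seq I * seq J => [set t : T | (1 <= size st.1 + size st.2 <= M)%N ->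
   normc (phiw st.1 st.2 - wtr (conf t) (mword st.1 st.2)) < eps])) => -[s u] /=.
case: (boolP (1 <= size s + size u <= M)%N) => hsu; last first.
  by rewrite (_ : [set t | _] = setT) //; apply/seteqP; split.
rewrite (_ : [set t | _] = (fun t : T => normc (phiw s u - wtr (conf t) (mword s u)) ^+ 2) @^-1` `]-oo, eps ^+ 2[%classic); last first.
  apply/seteqP; split=> t /=; rewrite in_itv /=.
    by move=> /(_ isT) h; rewrite ltr_pXn2r ?nnegrE ?normc_ge0 // ltW.
  by move=> h _; move: h; rewrite ltr_pXn2r ?nnegrE ?normc_ge0 // ltW.
apply: measurable_preim => //; apply: cmeas_normc; apply: cmeasB; first exact: cmeas_cst.
by apply: cmeasMl; apply: cmeas_tr; exact: mxmeas_wmx.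
Qed.

Lemma ltm_ms : ltm R N ms = lebesgue_sa (@microstates R A phi I J X Y r M eps d).
Proof. by rewrite ltmE //; exact: measurable_ms. Qed.

Lemma ms_bounded : ms `<=` tcube (2 * r).
Proof.
move=> t /microstatesP [h1 _] q.
have -> : tnth t q = sa_coord (conf t (enum_val q).1.1) (enum_val q).1.2 (enum_val q).2.
  by rewrite /conf sa_mxK -!surjective_pairing enum_valK.
set i := (enum_val q).1.2; set j := (enum_val q).2.
have [_ ho] := h1 (enum_val q).1.1.
have he i' j' := entry_le_opnorm i' j' r0 ho.
have s2 : (Num.sqrt 2 : R) <= 2.
  rewrite -(@ler_pXn2r _ 2) ?nnegrE ?sqrtr_ge0 // sqr_sqrtr // expr2.
  by rewrite -[leLHS]mulr1 ler_pM2l // ler1n.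
rewrite /sa_coord; case: (i == j).
  by apply: le_trans (normc_ge_Re _) _; apply: le_trans (he _ _) _; rewrite mulr_natl mulr2n lerDl.
rewrite normrM (ger0_norm (sqrtr_ge0 _)) mulrC; apply: ler_pM => //.
case: (i < j)%N; [apply: le_trans (normc_ge_Re _) _|apply: le_trans (normc_ge_Im _) _]; exact: he.
Qed.

Lemma wmx_unitary (U : 'M[C]_d) (B : P -> 'M[C]_d) v : unitary U ->
  wmx (fun p => U *m B p *m adj U) v = U *m wmx B v *m adj U.
Proof.
move=> [hU hU']; elim: v => [|a v IH] /=; first by rewrite mulmx1 hU'.
by rewrite IH !mulmxA -[_ *m adj U *m U]mulmxA hU mulmx1.
Qed.

Lemma microstates_unitary (U : 'M[C]_d) (B : P -> 'M[C]_d) : unitary U ->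
  microstates phi X Y r M eps B -> microstates phi X Y r M eps (fun p => U *m B p *m adj U).
Proof.
move=> hU /microstatesP [h1 h2]; apply/microstatesP; split=> [p|s t hst].
  have [ha ho] := h1 p; split; first by rewrite !adjM adjK ha mulmxA.
  exact: opnorm_unitary.
rewrite /wtr wmx_unitary // ntraceC mulmxA; have [-> _] := hU.
by rewrite mul1mx; exact: h2.
Qed.

End Microstates.

Section Pull.
Variables (R : realType) (P P' : finType) (e : P' -> P) (d : nat).
Local Notation N := #|{: P * 'I_d * 'I_d}|.
Local Notation N' := #|{: P' * 'I_d * 'I_d}|.
Local Notation T := (N.-tuple (measurableTypeR R)).
Local Notation T' := (N'.-tuple (measurableTypeR R)).

Definition pull_idx (q : 'I_N') : 'I_N :=
  enum_rank (e (enum_val q).1.1, (enum_val q).1.2, (enum_val q).2).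
Definition pull (t : T) : T' := [tuple tnth t (pull_idx q) | q < N'].

Lemma conf_pull t p : conf (pull t) p = conf t (e p).
Proof.
congr sa_mx; apply/funext => i; apply/funext => j.
by rewrite tnth_mktuple /pull_idx enum_rankK.
Qed.

Lemma measurable_pull : measurable_fun setT pull.
Proof.
apply: measurable_tupleP => q; under eq_fun do rewrite tnth_mktuple.
exact: measurable_tnth.
Qed.
End Pull.

(** * Volume estimates from the entropy *)

Section Limsup.
Variable R : realType.
Implicit Type u : nat -> \bar R.

Lemma limn_esup_le_near u (c : \bar R) n0 :
  (forall n, (n0 <= n)%N -> (u n <= c)%E) -> (limn_esup u <= c)%E.
Proof.
move=> h; apply: ereal_inf_le; exists (ereal_sup (u @` [set n | (n0 <= n)%N])).
  by exists [set n | (n0 <= n)%N] => //; exists n0.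
by apply: ub_ereal_sup => _ [n /= hn <-]; exact: h.
Qed.

Lemma limn_esup_lt_near u (c : \bar R) : (limn_esup u < c)%E ->
  exists n0, forall n, (n0 <= n)%N -> (u n < c)%E.
Proof.
move=> /ereal_inf_lt[_ [B [n0 _ hB] <-] h]; exists n0 => n hn.
by apply: le_lt_trans h; apply: ereal_sup_ubound; exists n => //; exact: hB.
Qed.

(** Translates entropy bounds into volume bounds. At v = 0 the logarithm is -oo and both sides hold;
    at v = +oo both fail. *)
Lemma normalized_lne_le (d : nat) (v : \bar R) (q c : R) : (0 < d)%N -> (0 <= v)%E ->
  ((d%:R ^- 2)%:E * lne v + q%:E <= c%:E)%E = (v <= (expR (d%:R ^+ 2 * (c - q)))%:E)%E.
Proof.
move=> d0; have dd : 0 < (d%:R : R) ^- 2 by rewrite invr_gt0 exprn_gt0 // ltr0n.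
have dd' : 0 < (d%:R : R) ^+ 2 by rewrite exprn_gt0 // ltr0n.
case: v => [v| |] // v0; last first.
  by rewrite /lne gt0_muley ?lte_fin // addye // !leye_eq.
rewrite lee_fin in v0; have [->|vn] := eqVneq v 0.
  rewrite le0_lneNy ?lexx // gt0_muleNy ?lte_fin // addNye leNye lee_fin.
  by apply/esym/ltW; exact: expR_gt0.
have vp : 0 < v by rewrite lt_def vn.
rewrite lne_EFin // -EFinM -EFinD !lee_fin -lerBrDr mulrC ler_pdivrMr // [_ * d%:R ^+ 2]mulrC.
by rewrite -[in RHS](lnK vp) ler_expR.
Qed.

End Limsup.

(** * Volume of balls by comparison with a Gaussian density *)

Section Gauss.
Variable R : realType.
Local Notation Mt := (measurableTypeR R).
Local Notation T n := (n.-tuple Mt).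

Lemma measurable_prod_tuple n (g : R -> R) : measurable_fun setT g ->
  measurable_fun setT (fun t : T n => \prod_i g (tnth t i)).
Proof.
move=> mg.
have h (r : seq 'I_n) : measurable_fun setT (fun t : T n => \prod_(i <- r) g (tnth t i)).
  elim: r => [|i r IH]; first by under eq_fun do rewrite big_nil; exact: measurable_cst.
  under eq_fun do rewrite big_cons; apply: measurable_funM => //.
  by apply: (measurableT_comp mg); exact: measurable_tnth.
exact: h.
Qed.

Lemma integral_prod_tuple n (g : R -> R) : measurable_fun setT g -> (forall x, 0 <= g x) ->
  (\int[lebesgue_measure]_x (g x)%:E = 1)%E ->
  (\int[ltm R n]_t (\prod_i g (tnth t i))%:E = 1)%E.
Proof.
move=> mg g0 g1; elim: n => [|n IH].
  under eq_integral do rewrite big_ord0.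
  by rewrite integral_cst // mul1e; exact: ltm_setT0.
pose F (t : T n.+1) := (\prod_i g (tnth t i))%:E.
have mF : measurable_fun setT F by apply/measurable_EFinP; exact: measurable_prod_tuple.
have F0 t : (0 <= F t)%E by rewrite lee_fin; apply: prodr_ge0.
have mc := @measurable_cons_t R n.
have mn0 : {in [set: T n.+1], forall y, (0 <= F y)%E} by move=> ? _.
have E := ge0_integral_pushforward mc (lebesgue_measure \x ltm R n)%E measurableT mF mn0.
rewrite preimage_setT in E.
transitivity (\int[pushforward (lebesgue_measure \x ltm R n)%E (fun p : Mt * T n => [tuple of p.1 :: p.2])]_t F t)%E.
  by apply: eq_measure_integral => B mB _; exact: ltm_cons.
rewrite E fubini_tonelli1 /=; last 2 first.
- by apply: (measurableT_comp mF).
- by move=> x; exact: F0.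
rewrite -g1; apply: eq_integral => x _; rewrite /fubini_F.
transitivity (\int[ltm R n]_t ((g x)%:E * (\prod_i g (tnth t i))%:E))%E.
  apply: eq_integral => t _; rewrite /F /= -EFinM big_ord_recl tnth0; congr (_ * _)%:E.
  by apply: eq_bigr => i _; rewrite tnthS.
rewrite ge0_integralZl //.
- by rewrite IH mule1.
- by apply/measurable_EFinP; exact: measurable_prod_tuple.
- by move=> t _; rewrite lee_fin prodr_ge0.
- by rewrite lee_fin.
Qed.

(** The centred Gaussian density of variance s^2 has total mass 1 and is at least [c] on the ball,
    so the ball has volume at most 1/c. *)
Lemma ball_volume_le n (rho s : R) : 0 < s ->
  (ltm R n [set t | (tnorm2 t <= rho)%R]
     <= (expR (rho / (s ^+ 2 *+ 2)) * (normal_peak s)^-1 ^+ n)%:E)%E.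
Proof.
move=> s0; set D := [set t | _].
have mD : measurable D by exact: measurable_ball_tnorm2.
have sn : s != 0 by rewrite gt_eqF.
pose g := normal_pdf 0 s.
have mg : measurable_fun setT g by exact: measurable_normal_pdf.
have g0 x : 0 <= g x by exact: normal_pdf_ge0.
have g1 : (\int[lebesgue_measure]_x (g x)%:E = 1)%E by exact: integral_normal_pdf.
have pk := normal_peak_gt0 sn.
have gE x : g x = normal_peak s * expR (- x ^+ 2 / (s ^+ 2 *+ 2)).
  by rewrite /g normal_pdfE // -[in RHS](subr0 x).
pose c := normal_peak s ^+ n * expR (- rho / (s ^+ 2 *+ 2)).
have c0 : 0 < c by rewrite mulr_gt0 ?exprn_gt0 ?expR_gt0.
have s2 : 0 < s ^+ 2 *+ 2 by rewrite mulrn_wgt0 // exprn_gt0.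
have hc t : D t -> c <= \prod_i g (tnth t i).
  move=> /= Dt; have -> : \prod_i g (tnth t i) = normal_peak s ^+ n * expR (- tnorm2 t / (s ^+ 2 *+ 2)).
    under eq_bigr do rewrite gE; rewrite big_split /=.
    rewrite prodr_const card_ord; congr (_ * _).
    rewrite -expR_sum; congr expR; rewrite /tnorm2 mulNr mulr_suml -sumrN.
    by apply: eq_bigr => i _; rewrite mulNr.
  rewrite ler_pM2l ?exprn_gt0 // ler_expR !mulNr lerN2.
  by rewrite ler_pM2r // invr_gt0.
have : (c%:E * ltm R n D <= 1)%E.
  rewrite -integral_cst // -[leRHS](integral_prod_tuple n mg g0 g1).
  apply: (@le_trans _ _ (\int[ltm R n]_(t in D) (\prod_i g (tnth t i))%:E)%E).
    apply: ge0_le_integral => //.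
    - by move=> t _; rewrite lee_fin ltW.
    - by apply: measurable_funTS; apply/measurable_EFinP; exact: measurable_prod_tuple.
  apply: ge0_subset_integral => //.
  - by apply/measurable_EFinP; exact: measurable_prod_tuple.
  - by move=> t _; rewrite lee_fin prodr_ge0.
move=> h; have -> : expR (rho / (s ^+ 2 *+ 2)) * (normal_peak s)^-1 ^+ n = c^-1.
  by rewrite /c invfM mulrC -exprVn; congr (_ * _); rewrite mulNr expRN invrK.
have -> : ltm R n D = (c^-1%:E * (c%:E * ltm R n D))%E.
  by rewrite muleA -EFinM mulVf ?mul1e // gt_eqF.
rewrite -[leRHS]mule1; apply: lee_pmul => //.
- by rewrite lee_fin invr_ge0 ltW.
- by rewrite mule_ge0 // lee_fin ltW.
Qed.

End Gauss.

Section EntropyFinite.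
Context (R : realType) (A : cstarAlgebra R) (phi : {scalar A}).
Context (I J : finType) (X : I -> A) (Y : J -> A).
Local Notation C := R[i].
Local Notation P := (I + J)%type.

Lemma chi_dE r M d eps : 0 <= r -> 0 < eps ->
  chi_d phi X Y r M d eps = lne (ltm R _ (ms phi X Y r M eps (d := d))).
Proof. by move=> r0 e0; rewrite /chi_d -ltm_ms. Qed.

Lemma chi_M_le r M eps c n0 : 0 <= r -> 0 < eps ->
  (forall d, (n0 <= d)%N -> (0 < d)%N ->
    (ltm R _ (ms phi X Y r M eps (d := d)) <=
      (expR (d%:R ^+ 2 * (c - (#|I| + #|J|)%:R / 2 * ln d%:R)))%:E)%E) ->
  (chi_M phi X Y r M eps <= c%:E)%E.
Proof.
move=> r0 e0 h; apply: (@limn_esup_le_near _ _ _ (maxn 1 n0)) => d; rewrite geq_max => /andP[d1 dn].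
by rewrite chi_dE // normalized_lne_le // h.
Qed.

Lemma chi_M_lt r M eps c : 0 <= r -> 0 < eps -> (chi_M phi X Y r M eps < c%:E)%E ->
  exists n0, forall d, (n0 <= d)%N -> (0 < d)%N ->
    (ltm R _ (ms phi X Y r M eps (d := d)) <=
      (expR (d%:R ^+ 2 * (c - (#|I| + #|J|)%:R / 2 * ln d%:R)))%:E)%E.
Proof.
move=> r0 e0 /limn_esup_lt_near[n0 h]; exists n0 => d dn d0.
by rewrite -normalized_lne_le // -chi_dE //; apply/ltW/h.
Qed.

Definition lval (p : P) : C := phi (match p with inl i => X i * X i | inr j => Y j * Y j end).

(** Makes each [chi] a real number once it exceeds -oo. Second moments alone confine microstates to
    a ball whose radius does not depend on the cut-off. *)
Lemma chi_lty : (chi phi X Y < +oo)%E.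
Proof.
pose cs := \sum_(p : P) (normc (lval p) + 1).
(* The exponent left by the Gaussian bound at squared radius d cs and variance 1/d: per d^2 it is
   cs/2, plus half a ln(2 pi / d) for each variable. *)
pose c : R := cs / 2 + (#|I| + #|J|)%:R / 2 * ln (pi *+ 2).
suff h r : 0 < r -> (chi_R phi X Y r <= c%:E)%E.
  by apply: le_lt_trans (ltry c); apply: ub_ereal_sup => _ [r /= r0 <-]; exact: h.
move=> r0; apply: ereal_inf_le; exists (chi_M phi X Y r 2 1).
  by exists (2%N, 1) => //=.
apply: (@chi_M_le _ _ _ _ 0) => //; first exact: ltW.
move=> d _ d0; have dp : 0 < d%:R :> R by rewrite ltr0n.
set N := #|{: P * 'I_d * 'I_d}|.
have Ne : N = ((#|I| + #|J|) * d ^ 2)%N.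
  by rewrite /N !card_prod card_sum !card_ord -mulnA mulnn.
apply: (@le_trans _ _ (ltm R N [set t | (tnorm2 t <= d%:R * cs)%R])).
  apply: le_measure; rewrite ?inE.
  - by apply: measurable_ms => //; exact: ltW.
  - exact: measurable_ball_tnorm2.
  move=> t /microstatesP [_ h] /=; rewrite tnorm2_conf /cs mulr_sumr; apply: ler_sum => p _.
  have hp : normc (wtr (conf t) [:: p; p]) <= normc (lval p) + 1.
    have hp : normc (lval p - wtr (conf t) [:: p; p]) < 1.
      case: p => [i|j]; rewrite /lval.
        have := h [:: i; i] [::] isT; rewrite /phiw !big_cons !big_nil !mulr1.
        by rewrite /mword /=.
      have := h [::] [:: j; j] isT; rewrite /phiw !big_cons !big_nil mulr1 mul1r.
      by rewrite /mword /=.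
    have -> : wtr (conf t) [:: p; p] = lval p - (lval p - wtr (conf t) [:: p; p]).
      by rewrite opprB addrC subrK.
    by apply: le_trans (normcB _ _) _; rewrite lerD2l ltW.
  apply: (@le_trans _ _ (d%:R * normc (wtr (conf t) [:: p; p]))); last by rewrite ler_pM2l.
  apply: le_trans (ler_norm _) (le_trans (normc_ge_Re _) _).
  have -> : \tr (conf t p *m conf t p) = d%:R * wtr (conf t) [:: p; p].
    by rewrite /wtr /ntrace /= mulmx1 mulrA mulfV ?mul1r // pnatr_eq0 -lt0n.
  by rewrite normcM -(rmorph_nat (real_complex R)) normc_real normr_nat.
pose s : R := (Num.sqrt d%:R)^-1.
have s0 : 0 < s by rewrite invr_gt0 sqrtr_gt0.
have s2 : s ^+ 2 = d%:R^-1 by rewrite exprVn sqr_sqrtr // ltW.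
apply: le_trans (ball_volume_le N (d%:R * cs) s0) _; rewrite lee_fin.
have p2 : 0 < pi *+ 2 :> R by rewrite mulrn_wgt0 // pi_gt0.
have pp : 0 < (pi *+ 2) / d%:R :> R by rewrite divr_gt0.
have -> : (normal_peak s)^-1 = expR (2^-1 * (ln (pi *+ 2) - ln d%:R)).
  rewrite /normal_peak invrK s2 -mulrnAr mulrC -ln_div ?posrE //.
  by rewrite -powR12_sqrt ?ltW // /powR gt_eqF.

rewrite -expRM_natl -expRD ler_expR le_eqVlt; apply/orP; left; apply/eqP.
rewrite s2 Ne /c natrM natrX -[d%:R^-1 *+ 2]mulr_natr.
have dn : d%:R != 0 :> R by rewrite gt_eqF.
by field.
Qed.

Lemma chi_M_mono r M M' eps eps' d : (M <= M')%N -> eps' <= eps ->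
  ms phi X Y r M' eps' (d := d) `<=` ms phi X Y r M eps (d := d).
Proof.
move=> MM ee t /microstatesP [h1 h2]; apply/microstatesP; split=> // s u hsu.
apply: lt_le_trans ee; apply: h2; move: hsu => /andP[-> h]; exact: leq_trans MM.
Qed.

(** The bound is made stable under larger M and smaller eps, so that finitely many families can
    later share one pair of parameters. *)
Lemma chi_volume_bound (x : R) r : 0 < r -> (chi phi X Y < x%:E)%E ->
  exists M eps n0, 0 < eps /\ forall M' eps' d, (M <= M')%N -> 0 < eps' <= eps ->
   (n0 <= d)%N -> (0 < d)%N ->
   (ltm R _ (ms phi X Y r M' eps' (d := d)) <=
      (expR (d%:R ^+ 2 * (x - (#|I| + #|J|)%:R / 2 * ln d%:R)))%:E)%E.
Proof.
move=> r0 hx.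
have : (chi_R phi X Y r < x%:E)%E.
  by apply: le_lt_trans hx; apply: ereal_sup_ubound; exists r.
move=> /ereal_inf_lt[_ [[M eps] /= e0 <-] h].
have [n0 hn] := chi_M_lt (ltW r0) e0 h.
exists M, eps, n0; split=> // M' eps' d MM /andP[e0' ee] dn d0.
apply: le_trans (hn d dn d0); apply: le_measure; rewrite ?inE; last exact: chi_M_mono.
- by apply: measurable_ms => //; exact: ltW.
- by apply: measurable_ms => //; exact: ltW.
Qed.

End EntropyFinite.

(** * Microstates with small Schwinger-Dyson functionals *)

Lemma measure_cover_seq d (T : measurableType d) (R : realType)
    (mu : {measure set T -> \bar R}) (I : Type) (L : seq I) (D : I -> set T) (B : set T) :
  measurable B -> (forall i, measurable (D i)) ->
  B `<=` [set t | List.Exists (fun i => D i t) L] ->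
  (mu B <= \sum_(i <- L) mu (D i))%E.
Proof.
move=> + mD; elim: L B => [|i L IH] B mB hB.
  rewrite big_nil (_ : B = set0) ?measure0 //.
  by apply/seteqP; split=> // t /hB /= h; inversion h.
rewrite big_cons; apply: (@le_trans _ _ (mu (D i `|` (B `\` D i)))).
  apply: le_measure; rewrite ?inE //.
    by apply: measurableU => //; exact: measurableD.
  by move=> t Bt; have [?|?] := pselect (D i t); [left|right].
apply: le_trans (measureU2 _ _ _) _ => //; first exact: measurableD.
apply: leeD => //; apply: IH; first exact: measurableD.
by move=> t [/hB /= h nD]; inversion h.
Qed.

Section Joint.
Context (R : realType) (A : cstarAlgebra R) (phi : {scalar A}).
Context (l : nat) (n m : 'I_l -> nat).
Context (X : forall k, 'I_(n k) -> A) (Y : forall k, 'I_(m k) -> A).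
Local Notation C := R[i].
Local Notation I := {k : 'I_l & 'I_(n k)}.
Local Notation J := {k : 'I_l & 'I_(m k)}.
Local Notation P := (I + J)%type.
Local Notation Pk k := ('I_(n k) + 'I_(m k))%type.
Local Notation jX := (joint_family X).
Local Notation jY := (joint_family Y).

Definition key (p : P) : 'I_l := match p with inl i => tag i | inr j => tag j end.
Definition emb k (p : Pk k) : P :=
  match p with
  | inl i => inl (Tagged (fun k => 'I_(n k)) i)
  | inr j => inr (Tagged (fun k => 'I_(m k)) j)
  end.

Lemma key_emb k (p : Pk k) : key (emb p) = k.
Proof. by case: p. Qed.

Lemma emb_onto (p : P) : exists k (p' : Pk k), emb p' = p.
Proof. by case: p => -[k i]; exists k; [exists (inl i)|exists (inr i)]. Qed.

Lemma emb_inj k : injective (@emb k).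
Proof.
move=> [i|j] [i'|j'] // h; congr (_ _).
  have := congr1 (fun p : P => match p with
    inl u => tagged_as (Tagged (fun k => 'I_(n k)) i) u | inr _ => i end) h.
  by rewrite /= !tagged_asE.
have := congr1 (fun p : P => match p with
  inr u => tagged_as (Tagged (fun k => 'I_(m k)) j) u | inl _ => j end) h.
by rewrite /= !tagged_asE.
Qed.

Lemma wmx_map d (P1 P2 : finType) (f : P1 -> P2) (B : P2 -> 'M[C]_d) v :
  wmx B (map f v) = wmx (fun p => B (f p)) v.
Proof. by elim: v => [//|p v IH] /=; rewrite IH. Qed.

Lemma mword_emb k (s : seq 'I_(n k)) (t : seq 'I_(m k)) :
  map (@emb k) (mword s t) = mword (map (Tagged (fun k => 'I_(n k))) s) (map (Tagged (fun k => 'I_(m k))) t).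
Proof. by rewrite /mword map_cat -map_rev -!map_comp. Qed.

Lemma phiw_emb k (s : seq 'I_(n k)) (t : seq 'I_(m k)) : phiw phi jX jY (map (Tagged (fun k => 'I_(n k))) s)
   (map (Tagged (fun k => 'I_(m k))) t) = phiw phi (@X k) (@Y k) s t.
Proof. by rewrite /phiw !big_map. Qed.

Lemma microstates_restr d r M eps (B : P -> 'M[C]_d) k :
  microstates phi jX jY r M eps B ->
  microstates phi (@X k) (@Y k) r M eps (fun p => B (emb p)).
Proof.
move=> /microstatesP [h1 h2]; apply/microstatesP; split=> // s t hst.
rewrite /wtr -wmx_map mword_emb -phiw_emb; apply: h2.
by rewrite !size_map.
Qed.

Section FixedDimension.
Variables (d : nat) (r : R) (M : nat) (eps : R).
Hypotheses (r0 : 0 <= r) (eps0 : 0 < eps).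
Local Notation N := #|{: P * 'I_d * 'I_d}|.
Local Notation T := (N.-tuple (measurableTypeR R)).

(** The product of the single microstate sets, written in joint coordinates. It imposes no relation
    between different families. *)
Definition block_ms : set T :=
  [set t | forall k, ms phi (@X k) (@Y k) r M eps (pull (@emb k) t)].

Lemma block_msP (t : T) : block_ms t <->
  forall k, microstates phi (@X k) (@Y k) r M eps (fun p => conf t (emb p)).
Proof.
have e k : (fun p => conf t (@emb k p)) = conf (pull (@emb k) t).
  by apply/funext => p; rewrite conf_pull.
by split=> h k; have := h k; rewrite /ms /= e.
Qed.

Lemma ms_block_ms : ms phi jX jY r M eps (d := d) `<=` block_ms.
Proof. by move=> t h; apply/block_msP => k; exact: microstates_restr. Qed.

Lemma measurable_block_ms : measurable block_ms.
Proof.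
apply: (@measurable_forall _ _ _ (fun k => [set t : T | ms phi (@X k) (@Y k) r M eps (pull (@emb k) t)])) => k.
apply: (measurable_preim (@measurable_pull R _ _ (@emb k) d)).
exact: measurable_ms.
Qed.

Lemma pull_idx_onto (i : 'I_N) : exists k (j : 'I_#|{: Pk k * 'I_d * 'I_d}|), pull_idx (@emb k) j = i.
Proof.
have [k [p e]] := emb_onto (enum_val i).1.1.
exists k, (enum_rank (p, (enum_val i).1.2, (enum_val i).2)).
by rewrite /pull_idx enum_rankK /= e -!surjective_pairing enum_valK.
Qed.

Lemma pull_idx_inj k k' (j : 'I_#|{: Pk k * 'I_d * 'I_d}|) (j' : 'I_#|{: Pk k' * 'I_d * 'I_d}|) :
  pull_idx (@emb k) j = pull_idx (@emb k') j' ->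
  k = k' /\ (j = j' :> nat).
Proof.
move=> /enum_rank_inj []; case e : (enum_val j) => [[p a] b]; case e' : (enum_val j') => [[p' a'] b'] /=.
move=> ep ea eb; have ek : k = k' by rewrite -(key_emb p) ep key_emb.
split=> //; subst k' a' b'; have ep' := emb_inj ep; subst p'.
by congr nat_of_ord; apply: enum_val_inj; rewrite e e'.
Qed.

Lemma ltm_block_ms :
  ltm R N block_ms = (\prod_(k < l) ltm R _ (ms phi (@X k) (@Y k) r M eps (d := d)))%E.
Proof.
apply: (@ltm_bigproduct R l N _ (fun k => @pull_idx P (Pk k) (@emb k) d) pull_idx_onto pull_idx_inj
  (fun k => ms phi (@X k) (@Y k) r M eps (d := d))) => k; exact: measurable_ms.
Qed.

Lemma block_ms_bounded : block_ms `<=` tcube (2 * r).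
Proof.
move=> t h i; have [k [j <-]] := pull_idx_onto i.
by have := ms_bounded r0 (h k) j; rewrite tnth_mktuple.
Qed.

Lemma block_ms_act k (U : 'M[C]_d) (t : T) : unitary U ->
  block_ms (act (fun p => key p == k) U t) <-> block_ms t.
Proof.
have fwd (U' : 'M[C]_d) (t' : T) : unitary U' -> block_ms t' -> block_ms (act (fun p => key p == k) U' t').
  move=> hU /block_msP h; apply/block_msP => k'.
  have [e|ne] := boolP (k' == k).
    rewrite (_ : (fun p => _) = (fun p => U' *m conf t' (@emb k' p) *m adj U')).
      exact: microstates_unitary.
    by apply/funext => p; rewrite conf_act /uconj key_emb e.
  rewrite (_ : (fun p => _) = (fun p => conf t' (@emb k' p))) //.
  by apply/funext => p; rewrite conf_act /uconj key_emb (negbTE ne).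
move=> hU; split; last exact: fwd.
have hU' : unitary (adj U) by case: hU => u1 u2; split; rewrite adjK.
by move=> /(fwd _ _ hU'); rewrite actK //; case: hU.
Qed.

End FixedDimension.

Hypothesis chi_fin : forall k, (-oo < chi phi (@X k) (@Y k))%E.
Hypothesis chi_add : chi phi jX jY = (\sum_(k < l) chi phi (@X k) (@Y k))%E.

Definition powval N (p : P) : C :=
  match p with inl i => phiw phi jX jY (nseq N i) [::] | inr j => phiw phi jX jY [::] (nseq N j) end.

(** The powers of order 2^a of single letters are among the moments prescribed for each family once
    2^a <= M. Their values under phi, up to 1, bound all traces uniformly in r and d. *)
Lemma wtr_block_bound d r M eps a (B : P -> 'M[C]_d) :
  0 < eps <= 1 -> (2 ^ a <= M)%N -> (forall p, adj (B p) = B p) ->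
  (forall k, microstates phi (@X k) (@Y k) r M eps (fun p => B (emb p))) ->
  forall w, (size w <= 2 ^ a)%N -> normc (wtr B w) <= 1 + \sum_p (normc (powval (2 ^ a) p) + 1).
Proof.
move=> /andP[e0 e1] aM adjB h; apply: wtr_bound => //.
  by rewrite lerDl; apply: sumr_ge0 => p _; rewrite addr_ge0 ?normc_ge0.
move=> p; apply: (@le_trans _ _ (normc (powval (2 ^ a) p) + 1)); last first.
  rewrite (bigD1 p) //= addrCA lerDl addr_ge0 //.
  by apply: sumr_ge0 => q _; rewrite addr_ge0 ?normc_ge0.
have hp : normc (powval (2 ^ a) p - wtr B (nseq (2 ^ a) p)) < eps.
  have a0 : (1 <= 2 ^ a)%N by rewrite expn_gt0.
  case: p => -[k i] /=; have /microstatesP[_ hk] := h k.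
    have := hk (nseq (2 ^ a) i) [::]; rewrite size_nseq addn0 a0 aM => /(_ isT).
    by rewrite -phiw_emb /wtr -(wmx_map (@emb k)) /mword cats0 !map_nseq.
  have := hk [::] (nseq (2 ^ a) i); rewrite size_nseq add0n a0 aM => /(_ isT).
  by rewrite -phiw_emb /wtr -(wmx_map (@emb k)) /mword /= rev_nseq !map_nseq.
rewrite -(subKr (powval (2 ^ a) p) (wtr _ _)); apply: le_trans (normcB _ _) _.
by rewrite lerD2l ltW // (lt_le_trans hp).
Qed.

(** If no such microstate existed, the bad sets would cover the joint microstates. Their volume is
    smaller than that of the product by a factor exp(- kap d^2) up to constants, so [chi] would fall
    below the sum by kap/2. *)
Theorem exists_sd_small (L : seq (seq P * 'I_l)) (dl : R) (M0 : nat) (eps0 : R) :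
  0 < dl -> 0 < eps0 ->
  exists (d : nat) (r : R) (B : P -> 'M[C]_d),
    [/\ (0 < d)%N, (forall p, adj (B p) = B p), microstates phi jX jY r M0 eps0 B
      & forall vk, List.In vk L -> normc (sd (wtr B) (fun p => key p == vk.2) [::] vk.1) < dl].
Proof.
move=> dl0 e00; apply: contrapT => noB.
pose x k := fine (chi phi (@X k) (@Y k)).
have xE k : chi phi (@X k) (@Y k) = (x k)%:E.
  by rewrite /x fineK // fin_numElt chi_fin chi_lty.
pose sx := \sum_k x k.
have chiE : chi phi jX jY = sx%:E by rewrite chi_add (eq_bigr (fun k => (x k)%:E)) ?sumEFin.
(* Any exponent with 2^a at least twice the length of every word in [L]; the power of two is imposed
   by [wtr_pow2_bound]. *)
pose a := (\sum_(vk <- L) 2 * size vk.1)%N.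
have ha vk : List.In vk L -> (2 * size vk.1 <= 2 ^ a)%N.
  move=> h; apply: (@leq_trans a); last exact: ltnW (ltn_expl _ _).
  rewrite /a; elim: (L) h => [//|y L' IH] /= [->|/IH h]; rewrite big_cons.
    exact: leq_addr.
  by apply: leq_trans h _; exact: leq_addl.
pose K := 1 + \sum_p (normc (powval (2 ^ a) p) + 1).
have K0 : 0 <= K.
  by rewrite /K addr_ge0 //; apply: sumr_ge0 => p _; rewrite addr_ge0 ?normc_ge0.
pose Lm := 8 * (2 ^ a)%:R ^+ 2 * K ^+ 2.
have Lm0 : 0 <= Lm by rewrite !mulr_ge0 // exprn_ge0.
have e1 := @expR_gt0 R 1.
(* Solves the requirement 2 kap L e <= dl^2 of [concentration] for all words of [L] at once; the + 1
   keeps the denominator positive. *)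
pose kap := dl ^+ 2 / (2 * (Lm + 1) * expR 1).
have Lm1 : 0 < 2 * (Lm + 1) * expR 1 by rewrite !mulr_gt0 // ltr_wpDl.
have kap0 : 0 < kap by rewrite divr_gt0 // exprn_gt0.
(* The slack allowed to each family, in total at most kap/4; l + 1 avoids division by zero when l =
   0. *)
pose eta := kap / (4 * l.+1%:R).
have eta0 : 0 < eta by rewrite divr_gt0 // mulr_gt0.
have leta : l%:R * eta <= kap / 4.
  rewrite /eta; have -> : l%:R * (kap / (4 * l.+1%:R)) = kap / 4 * (l%:R / l.+1%:R) :> R.
    have ln : l.+1%:R != 0 :> R by rewrite pnatr_eq0.
    by move: (l.+1%:R) ln => D Dn; field.
  apply: ler_piMr; first by rewrite divr_ge0 // ltW.
  by rewrite ler_pdivrMr ?ltr0n // mul1r ler_nat.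
pose q k : R := (#|'I_(n k)| + #|'I_(m k)|)%:R / 2.
have qE : (#|{: I}| + #|{: J}|)%:R / 2 = \sum_k q k :> R.
  rewrite -mulr_suml -natr_sum; congr (_%:R / _).
  have cE (f : 'I_l -> nat) : #|{: {k : 'I_l & 'I_(f k)}}| = (\sum_k #|'I_(f k)|)%N.
    by rewrite card_tagged sumnE /image_mem big_map -big_enum.
  by rewrite !cE -big_split.
(* From this dimension on, exp(kap d^2 / 4) absorbs the number of bad sets and the factor e of the
   concentration bound. *)
pose n1 := (Num.trunc (4 * (size L)%:R * expR 1 / kap)).+1.
have hn1 d : (n1 <= d)%N -> (size L)%:R * expR 1 <= expR (kap / 4 * d%:R ^+ 2).
  move=> dn; apply: le_trans (expR_ge1Dx _).
  have h1 : 4 * (size L)%:R * expR 1 / kap <= d%:R.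
    by apply: ltW; apply: lt_le_trans (truncnS_gt _) _; rewrite ler_nat.
  have d1 : 1 <= d%:R :> R by rewrite ler1n; exact: leq_trans dn.
  rewrite ler_pdivrMr // in h1.
  have h2 : d%:R * kap <= d%:R ^+ 2 * kap.
    by apply: ler_wpM2r; [exact: ltW|rewrite expr2 ler_peMl].
  have h3 : 4 * ((size L)%:R * expR 1) <= 4 * (kap / 4 * d%:R ^+ 2).
    rewrite mulrA; apply: le_trans h1 _; apply: le_trans h2 _.
    by rewrite le_eqVlt; apply/orP; left; apply/eqP; field.
  by rewrite ler_pM2l // in h3; apply: le_trans h3 _; rewrite lerDr.
(* [kap], [eta] and [n1] were fixed before r, so the deficit kap/2 survives the supremum over
   cut-offs. *)
suff h r : 0 < r -> (chi_R phi jX jY r <= (sx - kap / 2)%:E)%E.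
  have : (chi phi jX jY <= (sx - kap / 2)%:E)%E.
    by apply: ub_ereal_sup => _ [r /= r0 <-]; exact: h.
  rewrite chiE lee_fin => hh; move: kap0 hh; lra.
move=> r0.
have /choice [Mk /choice [ek /choice [nk hk]]] k := @chi_volume_bound _ _ phi _ _ (@X k) (@Y k) (x k + eta) r r0
  ltac:(by rewrite xE lte_fin ltrDl).
pose M' := maxn (maxn M0 (2 ^ a)) (\max_k Mk k).
pose eps' := \big[Num.min/Num.min eps0 1]_k ek k.
have e'0 : 0 < eps'.
  rewrite /eps'; apply/bigmin_gtP; split; first by rewrite lt_min e00 ltr01.
  by move=> k _; have [] := hk k.
have e'1 : eps' <= Num.min eps0 1 by exact: bigmin_le_id.
have e'k k : eps' <= ek k by exact: bigmin_le_cond.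
have /andP[e'e e'1'] : (eps' <= eps0) && (eps' <= 1) by rewrite -le_min.
pose n0 := maxn n1 (\max_k nk k).
apply: ereal_inf_le; exists (chi_M phi jX jY r M' eps').
  by exists (M', eps').
apply: (@chi_M_le _ _ _ _ _ _ _ _ _ _ _ n0) => //; first exact: ltW.
move=> d dn d0; rewrite qE.
have r0' := ltW r0.
set S := block_ms (d := d) r M' eps'.
have mS : measurable S by exact: measurable_block_ms.
have Sbd : exists2 r1 : R, 0 <= r1 & S `<=` tcube r1.
  by exists (2 * r); [rewrite mulr_ge0|exact: block_ms_bounded].
pose bad (vk : seq P * 'I_l) := S `&` [set t | dl <= normc (sd (wtr (conf t)) (fun p => key p == vk.2) [::] vk.1)].
have badle vk : List.In vk L -> (ltm R _ (bad vk) <= (expR (1 - kap * d%:R ^+ 2))%:E * ltm R _ S)%E.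
  move=> vL; have hU (U : 'M[C]_d) t : unitary U -> S (act (fun p => key p == vk.2) U t) <-> S t.
    by move=> uU; exact: block_ms_act.
  apply: (@concentration R P d _ S mS Sbd hU vk.1 K d0 K0 _ dl kap dl0 (ltW kap0)).
  - move=> t w /block_msP St hw; have sw : (size w <= 2 ^ a)%N by apply: leq_trans hw _; exact: ha.
    have aM : (2 ^ a <= M')%N by rewrite /M' leq_max leq_max leqnn orbT.
    have e01 : 0 < eps' <= 1 by rewrite e'0.
    exact: (wtr_block_bound e01 aM (adj_conf t) St sw).
  - have sv : (size vk.1)%:R <= (2 ^ a)%:R :> R.
      by rewrite ler_nat; apply: leq_trans (ha vk vL); rewrite mul2n -addnn leq_addr.
    have kapE : kap * (2 * (Lm + 1) * expR 1) = dl ^+ 2 by rewrite /kap divfK // gt_eqF.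
    rewrite -kapE [leLHS](_ : _ = kap * (2 * (8 * (size vk.1)%:R ^+ 2 * K ^+ 2) * expR 1)); last by ring.
    apply: ler_wpM2l; first exact: ltW.
    apply: ler_wpM2r; first exact: ltW.
    apply: ler_wpM2l => //; apply: (@le_trans _ _ Lm); last by rewrite lerDl.
    apply: ler_wpM2r; first exact: sqr_ge0.
    by apply: ler_wpM2l => //; rewrite lerXn2r ?nnegrE.
have mbad vk : measurable (bad vk).
  apply: measurableI => //.
  have [cm _] : cok S (fun t => sd (wtr (conf t)) (fun p => key p == vk.2) [::] vk.1).
    have hU (U : 'M[C]_d) t : unitary U -> S (act (fun p => key p == vk.2) U t) <-> S t.
      by move=> uU; exact: block_ms_act.
    by have [] := @good_sd R P d (fun p => key p == vk.2) S Sbd hU [::] vk.1.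
  rewrite (_ : [set t | _] = (fun t => normc (sd (wtr (conf t)) (fun p => key p == vk.2) [::] vk.1) ^+ 2) @^-1` `[dl ^+ 2, +oo[%classic).
    by apply: measurable_preim => //; exact: cmeas_normc.
  apply/seteqP; split=> t /=; rewrite in_itv /= andbT => h.
    by apply: lerXn2r => //; rewrite nnegrE ?normc_ge0 // ltW.
  by rewrite -(@ler_pXn2r _ 2) ?nnegrE ?normc_ge0 // ltW.
(* A joint microstate outside all bad sets would be the configuration denied by [noB]. *)
have cover : ms phi jX jY r M' eps' (d := d) `<=` [set t | List.Exists (fun vk => bad vk t) L].
  move=> t ht /=; apply: contrapT => hne; apply: noB; exists d, r, (conf t); split=> //.
  - by move=> p; exact: adj_conf.
  - by apply: (chi_M_mono _ e'e ht); rewrite /M' !leq_max leqnn.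
  - move=> vk vL; rewrite ltNge; apply/negP => hb; apply: hne.
    apply/List.Exists_exists; exists vk; split=> //; split=> //.
    exact: ms_block_ms.
pose w := expR (d%:R ^+ 2 * (sx + l%:R * eta - (\sum_k q k) * ln d%:R)).
have Sw : (ltm R _ S <= w%:E)%E.
  rewrite ltm_block_ms //.
  have -> : w = \prod_(k < l) expR (d%:R ^+ 2 * (x k + eta - q k * ln d%:R)).
    rewrite -expR_sum /w; congr expR; rewrite -mulr_sumr; congr (_ * _).
    rewrite sumrB big_split /= mulr_suml; congr (_ + _ - _).
    by rewrite sumr_const card_ord mulr_natl.
  suff [] : (0 <= \prod_(k < l) ltm R _ (ms phi (@X k) (@Y k) r M' eps' (d := d)))%E /\
    (\prod_(k < l) ltm R _ (ms phi (@X k) (@Y k) r M' eps' (d := d)) <=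
     (\prod_(k < l) expR (d%:R ^+ 2 * (x k + eta - q k * ln d%:R)))%:E)%E by [].
  elim/big_ind2: _ => [|u u' v v' [u0 uu'] [v0 vv']|k _]; first by rewrite lexx.
    by split; [exact: mule_ge0|rewrite EFinM; exact: lee_pmul].
  split=> //; have [ek0 hk'] := hk k; apply: hk' => //.
  - by rewrite /M' leq_max; apply/orP; right; exact: (leq_bigmax k).
  - by rewrite e'0 e'k.
  - by apply: leq_trans dn; rewrite /n0 leq_max; apply/orP; right; exact: (leq_bigmax k).
pose c := expR (1 - kap * d%:R ^+ 2) * w.
have hsum L' : (forall vk, List.In vk L' -> (ltm R _ (bad vk) <= c%:E)%E) ->
    (\sum_(vk <- L') ltm R _ (bad vk) <= ((size L')%:R * c)%:E)%E.
  elim: L' => [|vk L' IH] hL; first by rewrite big_nil mul0r.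
  rewrite big_cons (_ : (size (vk :: L'))%:R * c = c + (size L')%:R * c); last first.
    by rewrite /= -natr1 mulrDl mul1r addrC.
  rewrite EFinD; apply: leeD.
    by apply: hL; left.
  by apply: IH => vk' h; apply: hL; right.
have mms : measurable (ms phi jX jY r M' eps' (d := d)) by exact: measurable_ms.
have hcov := @measure_cover_seq _ _ R (ltm R _) _ L bad _ mms mbad cover.
apply: (le_trans hcov).
apply: (@le_trans _ _ (((size L)%:R * c)%:E)).
  apply: hsum => vk vL; apply: le_trans (badle vk vL) _; rewrite /c EFinM.
  by apply: lee_pmul => //; rewrite lee_fin ltW // expR_gt0.
rewrite lee_fin /c mulrA expRD mulrA -mulrA.
have dn1 : (n1 <= d)%N by apply: leq_trans dn; rewrite /n0 leq_max leqnn.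
apply: le_trans (ler_wpM2r _ (hn1 d dn1)) _.
  by rewrite mulr_ge0 // ltW // expR_gt0.
rewrite /w -!expRD ler_expR.
have d20 : 0 <= d%:R ^+ 2 :> R by exact: sqr_ge0.
(* Balance per d^2: + kap/4 for the number of bad sets, at most + kap/4 for the slack, - kap from
   concentration. *)
rewrite [leLHS](_ : _ = d%:R ^+ 2 * (kap / 4 - kap + (sx + l%:R * eta - (\sum_k q k) * ln d%:R))); last by ring.
by apply: ler_wpM2l => //; move: leta; lra.
Qed.

End Joint.

(** * The limiting trace *)

Section Limits.
Context (R : realType) (U : set_system nat).
Context (FU : UltraFilter U).
Local Notation C := R[i].

Lemma ultra_real_limit (x : nat -> R) (K : R) : U [set n | `|x n| <= K] ->
  exists z, forall e, 0 < e -> U [set n | `|x n - z| < e].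
Proof.
move=> hK.
have [|z [_ hz]] := @segment_compact R (- K) K (x @ U) _.
  by rewrite /fmap /=; apply: filterS hK => n /=; rewrite in_itv /= ler_norml.
exists z => e e0; have [//|hc] := in_ultra_setVsetC [set n | `|x n - z| < e] FU.
have [y [/= hy zy]] := hz [set y | ~ `|y - z| < e] _ hc (nbhsx_ballx (z : R^o) e e0).
by case: hy; rewrite distrC.
Qed.

Definition ulim (x : nat -> C) (z : C) : Prop :=
  forall e, 0 < e -> U [set n | normc (x n - z) < e].

Lemma ulim_ex x (K : R) : U [set n | normc (x n) <= K] -> exists z, ulim x z.
Proof.
move=> hK.
have [a ha] : exists z, forall e, 0 < e -> U [set n | `|Re (x n) - z| < e].
  apply: (@ultra_real_limit _ K); apply: filterS hK => n /=; apply: le_trans.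
  exact: normc_ge_Re.
have [b hb] : exists z, forall e, 0 < e -> U [set n | `|Im (x n) - z| < e].
  apply: (@ultra_real_limit _ K); apply: filterS hK => n /=; apply: le_trans.
  exact: normc_ge_Im.
exists (a +i* b) => e e0; have e2 : 0 < e / 2 by rewrite divr_gt0.
apply: filterS2 (ha _ e2) (hb _ e2) => n /= h1 h2.
apply: le_lt_trans (normc_le_ReIm _) _.
by rewrite [e]splitr ReD ImD ReN ImN ltrD.
Qed.

Lemma ulim_uniq x z z' : ulim x z -> ulim x z' -> z = z'.
Proof.
move=> h h'; apply/eqP; rewrite -subr_eq0; apply/eqP/normc_eq0/eqP; rewrite eq_le normc_ge0 andbT.
rewrite leNgt; apply/negP => e0; have e2 : 0 < normc (z - z') / 2 by rewrite divr_gt0.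
have [n /= [h1 h2]] := @filter_ex _ U _ _ (filterI (h _ e2) (h' _ e2)).
have : normc (z - z') < normc (z - z').
  rewrite -{1}(subrKA (x n)) [ltRHS]splitr; apply: le_lt_trans (normcD _ _) _.
  by rewrite ltrD // -normcN opprB.
by rewrite ltxx.
Qed.

Lemma ulim_cst c : ulim (fun=> c) c.
Proof. by move=> e e0; apply: filterE => n /=; rewrite subrr normc0. Qed.

Lemma ulimD x y a b : ulim x a -> ulim y b -> ulim (fun n => x n + y n) (a + b).
Proof.
move=> hx hy e e0; have e2 : 0 < e / 2 by rewrite divr_gt0.
apply: filterS2 (hx _ e2) (hy _ e2) => n /= h1 h2.
by rewrite opprD addrACA [e]splitr; apply: le_lt_trans (normcD _ _) (ltrD h1 h2).
Qed.

Lemma ulimM x y a b : ulim x a -> ulim y b -> ulim (fun n => x n * y n) (a * b).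
Proof.
move=> hx hy e e0; pose k := normc a + normc b + 1.
have k0 : 0 < k by rewrite ltr_wpDl ?addr_ge0 ?normc_ge0.
pose e' := Num.min 1 (e / (2 * k)).
have e'0 : 0 < e' by rewrite lt_min ltr01 divr_gt0 // mulr_gt0.
apply: filterS2 (hx _ e'0) (hy _ e'0) => n /= h1 h2.
rewrite (_ : x n * y n - a * b = (x n - a) * (y n - b) + ((x n - a) * b + a * (y n - b))); last by ring.
have [/andP[_ ee] e1] : (e' <= 1) && (e' <= e / (2 * k)) /\ e' <= 1.
  by rewrite -le_min lexx; split=> //; rewrite /e' ge_min lexx.
have h3 : normc (x n - a) * normc (y n - b) <= e'.
  rewrite -[leRHS]mul1r; apply: ler_pM; rewrite ?normc_ge0 ?(ltW h2) //.
  exact: le_trans (ltW h1) e1.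
have h4 : normc (x n - a) * normc b <= e' * normc b by rewrite ler_wpM2r ?normc_ge0 // ltW.
have h5 : normc a * normc (y n - b) <= normc a * e' by rewrite ler_wpM2l ?normc_ge0 // ltW.
apply: (@le_lt_trans _ _ (e' * k)).
  apply: le_trans (normcD _ _) _; rewrite normcM.
  have := normcD ((x n - a) * b) (a * (y n - b)); rewrite !normcM /k.
  by move: h3 h4 h5; lra.
apply: (@le_lt_trans _ _ (e / 2)); last by rewrite ltr_pdivrMr // ltr_pMr // ltr1n.
have -> : e / 2 = e / (2 * k) * k by field; rewrite gt_eqF.
by rewrite ler_wpM2r // ltW.
Qed.

Lemma ulimN x a : ulim x a -> ulim (fun n => - x n) (- a).
Proof. by move=> h e e0; apply: filterS (h _ e0) => n /=; rewrite -opprD normcN. Qed.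

Lemma ulim_sd (P : finType) (u : nat -> seq P -> C) tau b x v :
  (forall w, ulim (u^~ w) (tau w)) ->
  ulim (fun n => sd (u n) b x v) (sd tau b x v).
Proof.
move=> h; elim: v x => [|a v IH] x /=; first exact: ulim_cst.
apply: ulimD (IH _); case: (b a); last exact: ulim_cst.
by apply: ulimD; [exact: ulimM|apply: ulimN; exact: ulimM].
Qed.

End Limits.

Lemma mem_In (T : eqType) (x : T) (s : seq T) : x \in s -> List.In x s.
Proof.
elim: s => [//|y s IH]; rewrite inE => /orP[/eqP ->|/IH h]; [by left|by right].
Qed.

Section JointLimit.
Context (R : realType) (A : cstarAlgebra R) (phi : {scalar A}).
Context (l : nat) (n m : 'I_l -> nat).
Context (X : forall k, 'I_(n k) -> A) (Y : forall k, 'I_(m k) -> A).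
Local Notation C := R[i].
Local Notation I := {k : 'I_l & 'I_(n k)}.
Local Notation J := {k : 'I_l & 'I_(m k)}.
Local Notation P := (I + J)%type.
Local Notation jX := (joint_family X).
Local Notation jY := (joint_family Y).
Hypothesis phi1 : phi 1 = 1.
Hypothesis chi_fin : forall k, (-oo < chi phi (@X k) (@Y k))%E.
Hypothesis chi_add : chi phi jX jY = (\sum_(k < l) chi phi (@X k) (@Y k))%E.

(** Exact equations come from approximate ones by letting tolerance, word length and the list of
    tested functionals improve together with N. The dimensions and cut-offs may vary freely, since
    only traces of words are kept. *)
Theorem exists_sd_trace : exists tau : seq P -> C,
  [/\ tau [::] = 1, forall u v, tau (u ++ v) = tau (v ++ u),
      forall k v, sd tau (fun p => key p == k) [::] v = 0
    & forall s t, tau (mword s t) = phiw phi jX jY s t].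
Proof.
pose eps N : R := N.+1%:R^-1.
have eps0 N : 0 < eps N by rewrite invr_gt0 ltr0n.
(* The pairs (word, family) with code below N: each pair is tested for all large N. *)
pose L N : seq (seq P * 'I_l) := pmap choice.unpickle (iota 0 N).
have hN N := @exists_sd_small R A phi l n m X Y chi_fin chi_add (L N) (eps N) N (eps N) (eps0 N) (eps0 N).
have [d hd] := choice hN; have [r hr] := choice hd; pose B N := sval (cid (hr N)); have hB N := svalP (cid (hr N)).
pose u N := wtr (B N).
have [U [FU sU]] := @ultraFilterLemma nat \oo _.
have nearU N0 : U [set N | (N0 <= N)%N] by apply: sU; exact: nbhs_infty_ge.
have small e : 0 < e -> U [set N | eps N < e].
  by move=> e0; apply: sU; exact: near_infty_natSinv_lt (PosNum e0).
have /choice [tau ht] w : exists z, ulim U (u^~ w) z.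
  (* The bound from single letters is the same for every N >= 2^a, whatever the cut-off r N, so the
     ultralimit exists. *)
  pose a := size w; apply: (@ulim_ex R U FU _ (1 + \sum_p (normc (@powval R A phi l n m X Y (2 ^ a) p) + 1))).
  apply: filterS (nearU (2 ^ a)%N) => N /= hn.
  have [_ h1 h2 _] := hB N; apply: (@wtr_block_bound R A phi l n m X Y (d N) (r N) N (eps N) a) => //.
  - by rewrite eps0 /eps invf_le1 ?ler1n ?ltr0n.
  - by move=> k; exact: microstates_restr.
  - exact: ltnW (ltn_expl _ _).
have u1 N : u N [::] = 1.
  have [d0 _ _ _] := hB N.
  by rewrite /u /wtr /ntrace /= mxtrace1 mulVf // pnatr_eq0 -lt0n.
have tau1 : tau [::] = 1.
  apply: (ulim_uniq FU (ht [::])); rewrite (_ : u^~ [::] = fun=> 1); first exact: ulim_cst.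
  exact/funext.
exists tau; split=> //.
- move=> v w; apply: (ulim_uniq FU (ht _)); rewrite (_ : (u^~ _) = u^~ (w ++ v)); first exact: ht.
  by apply/funext => N; rewrite /u wtrC.
- move=> k v; apply: (ulim_uniq FU (ulim_sd FU _ [::] v ht)) => e e0.
  apply: filterS2 (nearU (choice.pickle (v, k)).+1) (small e e0) => N /= hn he.
  have [_ _ _ h] := hB N; rewrite subr0; apply: lt_trans he; apply: (h (v, k)).
  apply: mem_In; rewrite mem_pmap; apply/mapP; exists (choice.pickle (v, k)); last by rewrite choice.pickleK.
  by rewrite mem_iota add0n.
(* Microstates say nothing about the empty word; there both sides are 1. *)
- move=> s t; have [st0|st0] := eqVneq (size s + size t)%N 0%N.
    move: st0; case: s; case: t => // _.
    by rewrite /phiw !big_nil mulr1 phi1 -tau1.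
  apply: (ulim_uniq FU (ht _)) => e e0.
  apply: filterS2 (nearU (size s + size t)%N) (small e e0) => N /= hn he.
  have [_ _ /microstatesP[_ h] _] := hB N; rewrite -normcN opprB; apply: lt_trans he.
  by apply: h; rewrite lt0n st0.
Qed.

End JointLimit.

(** * Freeness from the Schwinger-Dyson equations *)

Section Freeness.
Variables (R : realType) (P : finType) (K : eqType) (key : P -> K).
Local Notation C := R[i].
Variable tau : seq P -> C.
Hypothesis tau1 : tau [::] = 1.
Hypothesis tauC : forall u v, tau (u ++ v) = tau (v ++ u).
Hypothesis tauS : forall k v, sd tau (fun p => key p == k) [::] v = 0.

(* [Ex s f] extends [f] linearly and evaluates it at the product of the centred
   words w - tau w, for w running through the second components of [s]. *)
Fixpoint Ex (s : seq (K * seq P)) (f : seq P -> C) : C :=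
  if s is c :: s' then Ex s' (fun v => f (c.2 ++ v)) - tau c.2 * Ex s' f else f [::].

Lemma eq_Ex s f g : f =1 g -> Ex s f = Ex s g.
Proof. by move=> /funext ->. Qed.

Lemma ExD s f g : Ex s (fun v => f v + g v) = Ex s f + Ex s g.
Proof. by elim: s f g => [|c s IH] f g //=; rewrite !IH; ring. Qed.

Lemma ExZ s a f : Ex s (fun v => a * f v) = a * Ex s f.
Proof. by elim: s f => [|c s IH] f //=; rewrite !IH; ring. Qed.

Lemma ExB s f g : Ex s (fun v => f v - g v) = Ex s f - Ex s g.
Proof. by elim: s f g => [|c s IH] f g //=; rewrite !IH; ring. Qed.

Lemma Ex0 s : Ex s (fun=> 0) = 0.
Proof. by elim: s => [|c s IH] //=; rewrite IH mulr0 subr0. Qed.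

Lemma Ex_cat s1 s2 f : Ex (s1 ++ s2) f = Ex s1 (fun x => Ex s2 (fun y => f (x ++ y))).
Proof.
elim: s1 f => [|c s1 IH] f //=; rewrite !IH; congr (_ - _).
by apply: eq_Ex => x; apply: eq_Ex => y; rewrite catA.
Qed.

Lemma Ex_rcons s c f : Ex (rcons s c) f = Ex s (fun x => f (x ++ c.2)) - tau c.2 * Ex s f.
Proof.
rewrite -cats1 Ex_cat /= ExB ExZ; congr (_ - _ * _); last first.
  by apply: eq_Ex => x; rewrite cats0.
by apply: eq_Ex => x; rewrite cats0.
Qed.

Lemma Ex_exchange s t f :
  Ex s (fun x => Ex t (fun y => f x y)) = Ex t (fun y => Ex s (fun x => f x y)).
Proof.
by elim: s f => [|c s IH] f //=; rewrite ExB ExZ -!IH.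
Qed.

Lemma Ex_tauC s t : Ex (s ++ t) tau = Ex (t ++ s) tau.
Proof.
rewrite !Ex_cat Ex_exchange; apply: eq_Ex => x; apply: eq_Ex => y; exact: tauC.
Qed.

Definition block_word (c : K * seq P) := all (fun p => key p == c.1) c.2.

(** Along a word of the block, the contributions of consecutive letters telescope. *)
Lemma sd_block k x w v : block_word (k, w) ->
  sd tau (fun p => key p == k) x (w ++ v) =
  tau (x ++ w) * tau v - tau x * tau (w ++ v) + sd tau (fun p => key p == k) (x ++ w) v.
Proof.
rewrite /block_word /=; elim: w x => [|a w IH] x /=.
  by rewrite cats0 subrr add0r.
by move=> /andP[-> /IH ->]; rewrite cat_rcons; ring.
Qed.

Lemma sd_other j k x w v : j != k -> block_word (j, w) ->
  sd tau (fun p => key p == k) x (w ++ v) = sd tau (fun p => key p == k) (x ++ w) v.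
Proof.
move=> jk; rewrite /block_word /=; elim: w x => [|a w IH] x /=; first by rewrite cats0.
by move=> /andP[/eqP -> /IH ->]; rewrite (negbTE jk) add0r cat_rcons.
Qed.

Let T s := Ex s tau.

(** The analogue of [sd] in which centred blocks take the place of letters. *)
Fixpoint Sd k (pre s : seq (K * seq P)) : C :=
  if s is c :: s' then
    (if c.1 == k then T (rcons pre c) * T s' - T pre * T s else 0) + Sd k (rcons pre c) s'
  else 0.

Lemma SdE k pre s : all block_word s ->
  Ex pre (fun x => Ex s (fun v => sd tau (fun p => key p == k) x v)) = Sd k pre s.
Proof.
elim: s pre => [|[j w] s IH] pre /=; first by rewrite Ex0.
move=> /andP[bw /IH <-]; rewrite Ex_rcons /= ExB ExZ.
have [e|jk] := eqVneq j k; last first.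
  rewrite add0r; congr (_ - _); apply: eq_Ex => x; apply: eq_Ex => v; exact: sd_other jk bw.
rewrite e in bw.
rewrite (@eq_Ex _ _ (fun x => tau (x ++ w) * T s - tau x * Ex s (fun v => tau (w ++ v))
   + Ex s (fun v => sd tau (fun p => key p == k) (x ++ w) v))); last first.
  move=> x; rewrite -ExZ -ExZ -ExB -ExD; apply: eq_Ex => v.
  by rewrite sd_block.
rewrite ExD ExB.
rewrite (@eq_Ex _ _ (fun x => T s * tau (x ++ w))); last by move=> x; rewrite mulrC.
rewrite ExZ (@eq_Ex pre (fun x => tau x * _) (fun x => Ex s (fun v => tau (w ++ v)) * tau x)); last first.
  by move=> x; rewrite mulrC.
by rewrite ExZ /T Ex_rcons /=; ring.
Qed.

Definition alt (s : seq (K * seq P)) := sorted (fun c c' => c.1 != c'.1) s.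

Theorem centred_alternating_eq0 s : s != [::] -> alt s -> all block_word s -> Ex s tau = 0.
Proof.
have [n] := ubnP (size s); elim: n s => // n IH s; rewrite ltnS => sn s0 sa sb.
have IH' t : t != [::] -> alt t -> all block_word t -> (size t < size s)%N -> T t = 0.
  by move=> t0 ta tb ts; apply: IH => //; exact: leq_trans ts sn.
case: s s0 sa sb sn IH' => // c s _; case/lastP: s => [|m c'].
  by move=> _ _ _ _ /=; rewrite tau1 cats0 mulr1 subrr.
move=> sa sb sn IH'; set s := c :: rcons m c' in sa sb sn IH' *.
(* With different end keys, apply the equation for the last key. Proper pieces vanish by induction,
   and only the last block leaves a term, T s times T of the empty product. A first block of the
   same key would contribute - T s and cancel it, hence the case distinction. *)
have [e|ne] := eqVneq c.1 c'.1; last first.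
  have key0 pre suf : pre != [::] -> suf != [::] -> pre ++ suf = s -> Sd c'.1 pre suf = T s.
    elim: suf pre => [//|d suf IHs] pre pre0 _ E.
    have pa : T pre = 0.
      have sz : (size pre < size s)%N by rewrite -E size_cat /= -addSnnS leq_addr.
      apply: IH' => //; last by move: sb; rewrite -E all_cat => /andP[].
      by move: sa; rewrite /alt -E => /cat_sorted2[].
    rewrite /= pa mul0r subr0; case: suf IHs E => [|d' suf] IHs E.
      have -> : d = c'.
        by have := congr1 (last c) E; rewrite last_cat /= last_rcons.
      rewrite eqxx /= addr0 -[X in T X]cats1.
      have -> : pre ++ [:: c'] = s.
        rewrite -E; congr (_ ++ [:: _]).
        by have := congr1 (last c) E; rewrite last_cat /= last_rcons.
      by have -> : T [::] = 1; [exact: tau1|rewrite mulr1].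
    have ta : T (d' :: suf) = 0.
      apply: IH' => //.
      - by move: sa; rewrite /alt -E => /cat_sorted2[_] /= /andP[].
      - by move: sb; rewrite -E all_cat /= => /andP[_ /andP[]].
      - have : (size (d' :: suf) < size (pre ++ [:: d, d' & suf]))%N.
          by rewrite size_cat; apply: ltn_addl; exact: ltnSn.
        by rewrite E.
    rewrite ta mulr0; have -> : (if d.1 == c'.1 then 0 else 0) = 0 :> C by case: ifP.
    rewrite add0r; apply: IHs => //; first by case: (pre).
    by rewrite cat_rcons.
  have E1 : Ex s (sd tau (fun p => key p == c'.1) [::]) = Sd c'.1 [::] s := SdE c'.1 [::] sb.
  have E2 : Sd c'.1 [::] s = Sd c'.1 [:: c] (rcons m c') by rewrite /= (negbTE ne) add0r.
  rewrite -[LHS](key0 [:: c] (rcons m c')) //; last by case: (m).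
  by rewrite -E2 -E1 (@eq_Ex _ _ (fun=> 0)) ?Ex0 // => v; exact: tauS.
have m0 : m != [::].
  by apply/eqP => m0; move: sa; rewrite /alt /s m0 /= e eqxx.
move: sb; rewrite /s /= all_rcons => /and3P[bc bc' bm].
have ma : forall w, alt ((c.1, w) :: m).
  by move=> w; move: sa; rewrite /alt /s /= rcons_path => /andP[]; case: (m).
have ma' : alt m by have := ma [::]; rewrite /alt /=; exact: path_sorted.
have sz : (size m).+2 = size s by rewrite /s /= size_rcons.
have Tm : T m = 0 by apply: IH' => //; rewrite -sz.
have key1 w : block_word (c.1, w) -> Ex m (fun v => tau (w ++ v)) = 0.
  move=> bw; have : T ((c.1, w) :: m) = 0.
    by apply: IH' => //; [apply/andP; split|rewrite -sz].
  by rewrite /T /= -/(T m) Tm mulr0 subr0.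
(* With equal end keys, rotate the last block to the front, where it meets a block of the same key.
   Expanding both centrings leaves multiples of T m and of products of one word with m, all shorter
   than s. *)
have E : Ex s tau = T ([:: c'] ++ c :: m) by rewrite /T -Ex_tauC cats1.
apply: etrans E _.
rewrite /T /= -/(T m) Tm !key1 ?mulr0 ?subr0; last 2 first.
- by case: (c) bc.
- by rewrite e; case: (c') bc'.
rewrite (@eq_Ex _ _ (fun v => tau ((c'.2 ++ c.2) ++ v))) ?key1 ?mulr0 ?subr0 //.
- by rewrite /block_word all_cat /= e; move: bc bc'; rewrite /block_word e => -> ->.
- by move=> v; rewrite catA.
Qed.

End Freeness.

(** * The free product of copies of the kernel of the state *)

Section Kernel.
Local Open Scope quotient_scope.
Context (R : realType) (A : cstarAlgebra R) (phi : {scalar A}).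

Definition kerp : pred A := fun a => phi a == 0.
Fact kerp_submod : submod_closed kerp.
Proof.
split; first by rewrite unfold_in raddf0.
move=> c x y; rewrite !unfold_in => /eqP hx /eqP hy.
by rewrite linearP hx hy mulr0 addr0.
Qed.
HB.instance Definition _ := GRing.isSubmodClosed.Build _ A kerp kerp_submod.

Record kerT := KerT { ker_val :> A; _ : ker_val \in kerp }.
HB.instance Definition _ := [isSub for ker_val].
HB.instance Definition _ := [Choice of kerT by <:].
HB.instance Definition _ := [SubChoice_isSubLmodule of kerT by <:].

Hypothesis phi1 : phi 1 = 1.

Fact cen_ker a : a - phi a *: 1 \in kerp.
Proof. by rewrite unfold_in linearB linearZ phi1 /= mulr1 subrr. Qed.
Definition cen a : kerT := KerT (cen_ker a).

Lemma ker_val0 (v : kerT) : phi (ker_val v) = 0.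
Proof. by case: v => a /=; rewrite unfold_in => /eqP. Qed.

Lemma cen_linear c a b : cen (c *: a + b) = c *: cen a + cen b.
Proof.
apply/val_inj => /=; rewrite linearP scalerBr scalerDl addrACA opprD; congr (_ + _).
by rewrite scalerA.
Qed.
Lemma cen1 : cen 1 = 0.
Proof. by apply/val_inj => /=; rewrite phi1 scale1r subrr. Qed.
Lemma cenK (v : kerT) : cen (ker_val v) = v.
Proof. by apply/val_inj; rewrite /= ker_val0 scale0r subr0. Qed.

Context (K : choiceType).
Local Notation V := (fun _ : K => (kerT : lmodType R[i])).
Local Notation sv := (sv_space V).

Definition to_alg k (z : sv k) : A := z.1 *: 1 + ker_val z.2.

Lemma to_alg_linear k c (x y : sv k) : to_alg (c *: x + y) = c *: to_alg x + to_alg y.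
Proof. by rewrite /to_alg /= scalerDl scalerDr !scalerA addrACA. Qed.

(** Left multiplication by [a], transported through the decomposition of A into C 1 and ker phi;
    [to_alg] is the inverse identification. *)
Definition lmul k (a : A) (z : sv k) : sv k := (phi (a * to_alg z), cen (a * to_alg z)).

Fact lmul_linear k a : linear (@lmul k a).
Proof.
move=> c x y; rewrite /lmul to_alg_linear mulrDr -scalerAr cen_linear linearP.
by [].
Qed.
HB.instance Definition _ k a := GRing.isLinear.Build R[i] (sv k) (sv k) _ (@lmul k a) (@lmul_linear k a).

Definition lrep k (a : A) : {linear sv k -> sv k} := @lmul k a.

Lemma to_algK k (z : sv k) : (phi (to_alg z), cen (to_alg z)) = z.
Proof.
case: z => c v; rewrite /to_alg /= cen_linear cen1 cenK scaler0 add0r linearP phi1 /=.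
by rewrite mulr1 ker_val0 addr0.
Qed.

Lemma lrep_alg k a (z : sv k) : to_alg (lrep k a z) = a * to_alg z.
Proof. by rewrite /lrep /= /lmul /to_alg /= addrC subrK. Qed.

Lemma lrep_hom k (B : set A) : unital_hom B (lrep k).
Proof.
split.
- by move=> z; rewrite /lrep /= /lmul mul1r to_algK.
- move=> c a b _ _ z; rewrite /lrep /= /lmul mulrDl -scalerAl cen_linear linearP.
  by [].
- by move=> a b _ _ z; rewrite /= -[LHS]to_algK !lrep_alg -[RHS]to_algK !lrep_alg mulrA.
Qed.

Context (P : finType) (isl : pred P) (X : P -> A) (key : P -> K).

Definition hat (w : seq P) : seq P := seq.filter isl w ++ rev (seq.filter (predC isl) w).

Variable tau : seq P -> R[i].
Hypothesis tau1 : tau [::] = 1.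
Hypothesis tauC : forall u v, tau (u ++ v) = tau (v ++ u).
Hypothesis tauS : forall k v, sd tau (fun p => key p == k) [::] v = 0.
Hypothesis tau_hat : forall w, phi (\prod_(p <- w) X p) = tau (hat w).

Definition wprod w := \prod_(p <- w) X p.
Definition lett (k : K) (x : kerT) : letter V := @Tagged K k V x.
Definition tens (s : seq (K * seq P)) : seq (letter V) :=
  [seq lett c.1 (cen (wprod c.2)) | c <- s].
Definition hats (s : seq (K * seq P)) := [seq (c.1, hat c.2) | c <- s].

Lemma alternating_tens s : alternating (tens s) = alt s.
Proof. by rewrite /alternating /tens sorted_map. Qed.

Local Notation FP := (free_product V).
Local Notation pis s := (\pi_FP (simple (tens s)) : FP).

Definition actl (p : P) (u : FP) : FP :=
  if isl p then left_op (lrep (key p) (X p)) u else right_op (lrep (key p) (X p)) u.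

Lemma actl_linear p : linear (actl p).
Proof. by rewrite /actl => c u v; case: (isl p); [exact: left_op_linear|exact: right_op_linear]. Qed.

Definition coefz (z : seq P) (u : FP) : R[i] := fp_coef (foldr actl u z).

Lemma fp_coef_linear c (u v : FP) : fp_coef (c *: u + v) = c * fp_coef u + fp_coef v.
Proof.
elim/fp_ind: u => f; elim/fp_ind: v => g.
have -> : c *: (\pi_FP f : FP) = \pi_FP (c *: f) by exact: fp_scale_pi.
rewrite -(fp_piD (c *: f) g) (fp_coef_pi (c *: f + g)) (fp_coef_pi f) (fp_coef_pi g).
by rewrite monalg.mcoeffD monalg.mcoeffZ.
Qed.

Lemma coefz_linear z c u v : coefz z (c *: u + v) = c * coefz z u + coefz z v.
Proof.
rewrite /coefz -fp_coef_linear; congr fp_coef.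
by elim: z => [//|p z IH] /=; rewrite IH actl_linear.
Qed.

Lemma coefz3 z c d u v w :
  coefz z (c *: u + (d *: v + w)) = c * coefz z u + (d * coefz z v + coefz z w).
Proof. by rewrite coefz_linear coefz_linear. Qed.

Lemma pi_linear_letter (s t : seq (letter V)) k c (x y : kerT) :
  (\pi_FP (simple (s ++ lett k (c *: x + y) :: t)) : FP)
  = c *: (\pi_FP (simple (s ++ lett k x :: t)) : FP)
    + (\pi_FP (simple (s ++ lett k y :: t)) : FP).
Proof.
have -> : c *: (\pi_FP (simple (s ++ lett k x :: t)) : FP) = \pi_FP (c *: simple (s ++ lett k x :: t)) by exact: fp_scale_pi.
rewrite -(fp_piD (c *: _) _); apply: (fp_piP _ _).2.
exact: (tensor_rel_linear s t c (x : V k) y).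
Qed.

Lemma wprod_cons p w : wprod (p :: w) = X p * wprod w.
Proof. by rewrite /wprod big_cons. Qed.

Lemma wprod1 p : wprod [:: p] = X p.
Proof. by rewrite /wprod big_seq1. Qed.

(* X_p (w - phi w) = (p w - phi (p w)) - phi w (p - phi p) + scalar *)
Lemma lmul_cen k p w : lmul (k := k) (X p) (0, cen (wprod w)) =
  (tau (hat (p :: w)) - tau (hat w) * tau (hat [:: p]),
   - tau (hat w) *: cen (wprod [:: p]) + cen (wprod (p :: w))).
Proof.
rewrite /lmul /to_alg /= scale0r add0r mulrBr -scalerAr mulr1 wprod1 wprod_cons.
have -> : X p * wprod w - phi (wprod w) *: X p = - phi (wprod w) *: X p + X p * wprod w.
  by rewrite scaleNr addrC.
rewrite cen_linear linearP -wprod_cons -!tau_hat /= -/(wprod w) -/(wprod (p :: w)).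
by rewrite -(wprod1 p) mulNr addrC.
Qed.

Lemma lmul_vac k p : lmul (k := k) (X p) (1, 0) = (tau (hat [:: p]), cen (wprod [:: p])).
Proof.
by rewrite /lmul /to_alg /= scale1r addr0 mulr1 -tau_hat -/(wprod [:: p]) wprod1.
Qed.

Lemma actl_left_head p w s : isl p -> alt ((key p, w) :: s) ->
  actl p (pis ((key p, w) :: s)) =
  (tau (hat (p :: w)) - tau (hat w) * tau (hat [:: p])) *: pis s
  + (- tau (hat w) *: pis ((key p, [:: p]) :: s) + pis ((key p, p :: w) :: s)).
Proof.
move=> lp a; rewrite /actl lp (left_op_pi (lrep (key p) (X p))) extend_simple.
rewrite alternating_tens a /left_act /= eqxx tagged_asE /left_join lmul_cen /=.
set c0 := tau _ - _; rewrite (fp_piD (c0 *: _) _).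
have E0 : c0 *: pis s = \pi_FP (c0 *: simple (tens s)) by exact: fp_scale_pi.
have E := pi_linear_letter [::] (tens s) (key p) (- tau (hat w)) (cen (wprod [:: p])) (cen (wprod (p :: w))).
by rewrite -E0; congr (_ + _); exact: E.
Qed.

Lemma actl_left_new p s : isl p -> alt s -> alt ((key p, [:: p]) :: s) ->
  actl p (pis s) = tau (hat [:: p]) *: pis s + pis ((key p, [:: p]) :: s).
Proof.
move=> lp a a'; rewrite /actl lp (left_op_pi (lrep (key p) (X p))) extend_simple.
rewrite alternating_tens a /left_act.
have -> : left_split (key p) (tens s) = ((1, 0) : sv (key p), tens s).
  case: s a a' => [//|c s] _ /=; rewrite /alt /= => /andP[h _].
  by rewrite eq_sym (negbTE h).
have ev : lrep (key p) (X p) (1, 0) = _ := lmul_vac (key p) p.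
rewrite ev /left_join /=; set c0 := tau _; rewrite (fp_piD (c0 *: _) _).
have E0 : c0 *: pis s = \pi_FP (c0 *: simple (tens s)) by exact: fp_scale_pi.
by rewrite -E0.
Qed.

Lemma tens_rcons s c : tens (rcons s c) = rcons (tens s) (lett c.1 (cen (wprod c.2))).
Proof. by rewrite /tens map_rcons. Qed.

Lemma actl_right_last p w s : ~~ isl p -> alt (rcons s (key p, w)) ->
  actl p (pis (rcons s (key p, w))) =
  (tau (hat (p :: w)) - tau (hat w) * tau (hat [:: p])) *: pis s
  + (- tau (hat w) *: pis (rcons s (key p, [:: p])) + pis (rcons s (key p, p :: w))).
Proof.
move=> lp a; rewrite /actl (negbTE lp) (right_op_pi (lrep (key p) (X p))) extend_simple.
rewrite alternating_tens a /right_act !tens_rcons right_split_rcons /= eqxx tagged_asE.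
have ev : lrep (key p) (X p) (0, cen (wprod w)) = _ := lmul_cen (key p) p w.
rewrite ev /right_join /=; set c0 := tau _ - _; rewrite (fp_piD (c0 *: _) _).
have E0 : c0 *: pis s = \pi_FP (c0 *: simple (tens s)) by exact: fp_scale_pi.
have E := pi_linear_letter (tens s) [::] (key p) (- tau (hat w)) (cen (wprod [:: p])) (cen (wprod (p :: w))).
rewrite !cats1 in E.
by rewrite -E0; congr (_ + _); exact: E.
Qed.

Lemma actl_right_new p s : ~~ isl p -> alt s -> alt (rcons s (key p, [:: p])) ->
  actl p (pis s) = tau (hat [:: p]) *: pis s + pis (rcons s (key p, [:: p])).
Proof.
move=> lp a a'; rewrite /actl (negbTE lp) (right_op_pi (lrep (key p) (X p))) extend_simple.
rewrite alternating_tens a /right_act tens_rcons.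
have -> : right_split (key p) (tens s) = (tens s, (1, 0) : sv (key p)).
  case/lastP: s a a' => [//|s c] _; rewrite tens_rcons right_split_rcons /= /alt => a'.
  have : c.1 != key p.
    by case: s a' => [|c0 s] /=; rewrite ?rcons_path ?last_rcons => /andP[].
  by move=> /negbTE ->.
have ev : lrep (key p) (X p) (1, 0) = _ := lmul_vac (key p) p.
rewrite ev /right_join /=; set c0 := tau _; rewrite (fp_piD (c0 *: _) _).
have E0 : c0 *: pis s = \pi_FP (c0 *: simple (tens s)) by exact: fp_scale_pi.
by rewrite -E0.
Qed.

Lemma hat_left p w : isl p -> hat (p :: w) = p :: hat w.
Proof. by move=> lp; rewrite /hat /= lp. Qed.
Lemma hat_right p w : ~~ isl p -> hat (p :: w) = rcons (hat w) p.
Proof. by move=> lp; rewrite /hat /= (negbTE lp) /= rev_cons -rcons_cat. Qed.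

Lemma block_hat c : block_word key c -> block_word key (c.1, hat c.2).
Proof.
rewrite /block_word /hat /= all_cat all_rev !all_filter => /allP h.
by apply/andP; split; apply/allP => p /h /= ->; rewrite implybT.
Qed.

Local Notation Ex := (Ex tau).

(** The letter of z nearest the vector acts first. A left letter enters or precedes the first block
    and is prepended to the word read by tau; a right letter enters or follows the last block and is
    appended, exactly as [hat] reorders it. The scalar terms produced by recentring match the
    expansion of [Ex]. *)
Theorem coefz_pis z s : alt s -> all (block_word key) s ->
  coefz z (pis s) = Ex (hats s) (fun x => tau (seq.filter isl z ++ x ++ rev (seq.filter (predC isl) z))).
Proof.
elim/last_ind: z s => [|z p IH] s a bs.
  (* For empty z a nonempty alternating tensor has xi-coefficient 0; on the other side this is where
     freeness of tau enters, through [centred_alternating_eq0]. *)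
  rewrite /coefz /= (fp_coef_pi (simple (tens s))).
  rewrite (@eq_Ex _ _ _ tau _ _ tau); last by move=> x; rewrite cats0.
  have [->|s0] := eqVneq s [::].
    by rewrite /= tau1 /simple insubT /= monalg.mcoeffUU.
  rewrite (@centred_alternating_eq0 _ _ _ key) //.
  - rewrite /simple; case: insubP => [w _ we|_]; last exact: monalg.mcoeff0.
    rewrite monalg.mcoeffU; case: eqP => // ew; move: we; rewrite ew /=.
    by case: (s) s0.
  - by case: (s) s0.
  - by rewrite /alt /hats sorted_map.
  - by rewrite all_map; apply/allP => c cs /=; apply: block_hat; exact: (allP bs).
rewrite /coefz foldr_rcons -/(coefz z _).
have bp : block_word key (key p, [:: p]) by rewrite /block_word /= eqxx.
rewrite !filter_rcons /=; case lp : (isl p) => /=.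
  set f := fun x => tau (seq.filter isl z ++ x ++ rev (seq.filter (predC isl) z)).
  rewrite (@eq_Ex _ _ _ tau _ _ (fun x => f (p :: x))); last by move=> x; rewrite /f cat_rcons.
  have [[w [s' e]]|new] : (exists w s', s = (key p, w) :: s') \/ alt ((key p, [:: p]) :: s).
    case: s a bs => [|[k w] s'] a bs; first by right.
    have [<-|ne] := eqVneq k (key p); first by left; exists w, s'.
    by right; rewrite /alt /= eq_sym ne.
  - subst s; have {}a w' : alt ((key p, w') :: s') by move: a; rewrite /alt; case: (s').
    have a' : alt s' by have := a [::]; rewrite /alt /=; exact: path_sorted.
    have /andP[bw bs'] := bs.
    have bpw : block_word key (key p, p :: w) by move: bw; rewrite /block_word /= eqxx.
    have b1 : all (block_word key) ((key p, [:: p]) :: s') by rewrite /= bp.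
    have b2 : all (block_word key) ((key p, p :: w) :: s') by rewrite /= bpw.
    refine (etrans (congr1 (coefz z) (actl_left_head lp (a w))) (etrans (coefz3 _ _ _ _ _ _) _)).
    refine (etrans (congr2 +%R (congr1 ( *%R _) (IH s' a' bs')) (congr2 +%R
      (congr1 ( *%R _) (IH _ (a _) b1)) (IH _ (a _) b2))) _).
    rewrite -/f.
    rewrite /= !hat_left // -!/(f _) /hat /= -/(hat w) /=.
    by ring.
  - have b1 : all (block_word key) ((key p, [:: p]) :: s) by rewrite /= bp.
    refine (etrans (congr1 (coefz z) (actl_left_new lp a new)) (etrans (coefz_linear _ _ _ _) _)).
    refine (etrans (congr2 +%R (congr1 ( *%R _) (IH s a bs)) (IH _ new b1)) _).
    rewrite -/f.
    by rewrite /= !hat_left // /hat /=; ring.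
set f := fun x => tau (seq.filter isl z ++ x ++ rev (seq.filter (predC isl) z)).
rewrite rev_rcons.
rewrite (@eq_Ex _ _ _ tau _ _ (fun x => f (rcons x p))); last first.
  by move=> x; rewrite /f -[rcons x p]cats1 -catA.
have lp' : ~~ isl p by rewrite lp.
have [[w [s' e]]|new] : (exists w s', s = rcons s' (key p, w)) \/ alt (rcons s (key p, [:: p])).
  case/lastP: s a bs => [|s' [k w]] a bs; first by right.
  have [<-|ne] := eqVneq k (key p); first by left; exists w, s'.
  right; move: a; rewrite /alt -!cats1 -catA; case: s' {bs} => [|c s'] /=; first by rewrite ne.
  by rewrite !cat_path /= ne.
- subst s; have {}a w' : alt (rcons s' (key p, w')).
    by move: a; rewrite /alt; case: s' {bs} => [//|c s'] /=; rewrite !rcons_path.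
  have a' : alt s' by have := a [::]; rewrite /alt -cats1 => /cat_sorted2[].
  move: bs; rewrite all_rcons => /andP[bw bs'].
  have bpw : block_word key (key p, p :: w) by move: bw; rewrite /block_word /= eqxx.
  have b1 : all (block_word key) (rcons s' (key p, [:: p])) by rewrite all_rcons bp.
  have b2 : all (block_word key) (rcons s' (key p, p :: w)) by rewrite all_rcons bpw.
  refine (etrans (congr1 (coefz z) (actl_right_last lp' (a w))) (etrans (coefz3 _ _ _ _ _ _) _)).
  refine (etrans (congr2 +%R (congr1 ( *%R _) (IH s' a' bs')) (congr2 +%R
    (congr1 ( *%R _) (IH _ (a _) b1)) (IH _ (a _) b2))) _).
  rewrite -/f.
  rewrite /hats !map_rcons !Ex_rcons /= !hat_right // -/(hats s').
  rewrite (_ : hat [::] = [::]) //=.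
  rewrite (@eq_Ex _ _ _ tau (hats s') (fun x => f (x ++ rcons (hat w) p)) (fun x => f (rcons (x ++ hat w) p))); last first.
    by move=> x; rewrite rcons_cat.
  rewrite (@eq_Ex _ _ _ tau (hats s') (fun x => f (x ++ [:: p])) (fun x => f (rcons x p))); last first.
    by move=> x; rewrite cats1.
  by ring.
- have b1 : all (block_word key) (rcons s (key p, [:: p])) by rewrite all_rcons bp.
  refine (etrans (congr1 (coefz z) (actl_right_new lp' a new)) (etrans (coefz_linear _ _ _ _) _)).
  refine (etrans (congr2 +%R (congr1 ( *%R _) (IH s a bs)) (IH _ new b1)) _).
  rewrite -/f.
  rewrite /hats !map_rcons !Ex_rcons /= !hat_right // -/(hats s) (_ : hat [::] = [::]) //=.
  rewrite (@eq_Ex _ _ _ tau (hats s) (fun x => f (x ++ [:: p])) (fun x => f (rcons x p))); last first.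
    by move=> x; rewrite cats1.
  by ring.
Qed.

Corollary coefz_vacuum z : coefz z (fp_vacuum V) = phi (wprod z).
Proof. by rewrite (@coefz_pis z [::]) //= tau_hat. Qed.

End Kernel.

(** * Operators on the free product *)

Section Operators.
Local Open Scope quotient_scope.
Context (F : fieldType) (K : choiceType) (V : K -> lmodType F).
Local Notation FP := (free_product V).
Local Notation sv := (sv_space V).
Implicit Types (k : K) (s : seq (letter V)).

Lemma formal_simple (f : formal V) :
  f = \sum_(w <- monalg.msupp f) monalg.mcoeff w f *: simple (val w).
Proof.
refine (etrans (monalg.monalgE f) _); apply: eq_bigr => w _.
have -> : simple (val w) = monalg.mkmalgU w 1 by rewrite /simple valK.
apply/monalg.malgP => w'; refine (etrans (monalg.mcoeffU _ _ _) (esym (etrans (monalg.mcoeffZ _ _ _) _))).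
refine (etrans (congr1 ( *%R _) (monalg.mcoeffU _ _ _)) _).
by case: (w == w'); [exact: mulr1|exact: mulr0].
Qed.

Lemma piZ c (f : formal V) : c *: (\pi_FP f : FP) = \pi_FP (c *: f).
Proof. exact: fp_scale_pi. Qed.

Lemma pi0 : (\pi_FP (0 : formal V) : FP) = 0.
Proof. by rewrite -(scale0r (0 : formal V)) -piZ scale0r. Qed.

Lemma eq_linear_simple (D1 D2 : FP -> FP) : linear D1 -> linear D2 ->
  (forall s, alternating s -> D1 (\pi_FP (simple s)) = D2 (\pi_FP (simple s))) ->
  D1 =1 D2.
Proof.
move=> l1 l2 h; elim/fp_ind => f.
have z (D : FP -> FP) : linear D -> D 0 = 0.
  move=> lD; have e : D (-1 *: 0 + 0) = -1 *: D 0 + D 0 by exact: lD.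
  by move: e; rewrite scaler0 addr0 scaleN1r addNr.
rewrite (formal_simple f); elim: (monalg.msupp f : seq _) => [|w r IH].
  by rewrite big_nil pi0 !z.
rewrite big_cons (fp_piD (_ *: _)) -(piZ _ (simple _)) l1 l2 IH.
exact: (congr1 (fun t => _ *: t + _) (h (val w) (valP w))).
Qed.

Lemma left_join_linear k c (z1 z2 : sv k) s :
  (\pi_FP (left_join (c *: z1 + z2) s) : FP) =
  c *: (\pi_FP (left_join z1 s) : FP) + (\pi_FP (left_join z2 s) : FP).
Proof.
rewrite (piZ c (left_join z1 s)) -(fp_piD (c *: _)); apply: (fp_piP _ _).2.
have := tensor_rel_linear [::] s c z1.2 z2.2; congr tensor_rel.
rewrite /left_join /= scalerDl scalerDr scalerA.
rewrite [X in _ = _ - X]addrACA [in RHS]opprD [RHS]addrACA.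
by rewrite subrr add0r.
Qed.

Lemma right_join_linear k c (z1 z2 : sv k) s :
  (\pi_FP (right_join s (c *: z1 + z2)) : FP) =
  c *: (\pi_FP (right_join s z1) : FP) + (\pi_FP (right_join s z2) : FP).
Proof.
rewrite (piZ c (right_join s z1)) -(fp_piD (c *: _)); apply: (fp_piP _ _).2.
have := tensor_rel_linear s [::] c z1.2 z2.2; rewrite !cats1; congr tensor_rel.
rewrite /right_join /= scalerDl scalerDr scalerA.
rewrite [X in _ = _ - X]addrACA [in RHS]opprD [RHS]addrACA.
by rewrite subrr add0r.
Qed.

(** Disposes of the spurious tensor with letter 0 that [left_join] and [right_join] produce at the
    state vector (1, 0). *)
Lemma pi_simple0 k s t : (\pi_FP (simple (s ++ Tagged V (0 : V k) :: t)) : FP) = 0.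
Proof.
have := tensor_rel_linear s t (-1) (0 : V k) 0; rewrite scaleN1r oppr0 addr0.
rewrite scaleN1r addNr subr0 => h.
by rewrite -pi0; apply: (fp_piP _ _).2; rewrite subr0.
Qed.

Lemma left_op_simple k (T : {linear sv k -> sv k}) s : alternating s ->
  left_op T (\pi_FP (simple s)) = \pi_FP (left_act T s).
Proof. by move=> a; rewrite (left_op_pi T (simple s)) extend_simple a. Qed.

Lemma right_op_simple k (T : {linear sv k -> sv k}) s : alternating s ->
  right_op T (\pi_FP (simple s)) = \pi_FP (right_act T s).
Proof. by move=> a; rewrite (right_op_pi T (simple s)) extend_simple a. Qed.

(** The remainder lies in X(l,k), so any vector of the k-th space can be joined to it again; this is
    what makes composition on the k-th factor well behaved in [left_op_comp]. *)
Lemma left_splitP k s : alternating s ->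
  let t := (left_split k s).2 in
  [/\ alternating t, forall x : V k, alternating (Tagged V x :: t), left_split k t = ((1, 0), t)
    & \pi_FP (left_join (left_split k s).1 t) = \pi_FP (simple s) :> FP].
Proof.
case: s => [|u t] /= a.
  split=> //; rewrite /left_join /= scale1r (fp_piD (simple [::])) -[[:: _]]cat0s pi_simple0.
  exact: addr0.
have [e|ne] := eqVneq (tag u) k; last first.
  split=> //=; first by move=> x; rewrite eq_sym ne.
    by rewrite (negbTE ne).
  rewrite /left_join /= scale1r (fp_piD (simple (u :: t))) -[Tagged _ _ :: _]cat0s pi_simple0.
  exact: addr0.
case: u e a => k' x /= e; subst k'; rewrite tagged_asE => a.
have ht : alternating t by case: t a => [//|v t] /= /andP[].
split=> //=.
- by case: t a {ht} => [//|v t] /=.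
- case: t a {ht} => [//|v t] /= /andP[h _]; rewrite /= in h *.
  by rewrite eq_sym (negbTE h).
- by rewrite /left_join /= scale0r add0r.
Qed.

Lemma left_op_join k (T : {linear sv k -> sv k}) (z : sv k) t :
  alternating t -> (forall x : V k, alternating (Tagged V x :: t)) -> left_split k t = ((1, 0), t) ->
  left_op T (\pi_FP (left_join z t)) = \pi_FP (left_join (T z) t).
Proof.
move=> a ax st; case: z => c v; rewrite {1}/left_join /=; move: (c : F) => {}c.
have -> : \pi_FP (c *: simple t + simple (Tagged V v :: t)) =
    c *: (\pi_FP (simple t) : FP) + \pi_FP (simple (Tagged V v :: t)).
  by rewrite (piZ c (simple t)); exact: fp_piD.
rewrite left_op_linear.
rewrite !left_op_simple // /left_act st /= eqxx tagged_asE.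
rewrite -left_join_linear -linearP; congr (\pi_FP (left_join (T _) t)).
by congr (_, _); rewrite /= ?scaler0 ?add0r // addr0; exact: mulr1.
Qed.

Lemma linear_comb (W W' : lmodType F) (D1 D2 : W -> W') c : linear D1 -> linear D2 ->
  linear (fun u => c *: D1 u + D2 u).
Proof.
move=> l1 l2 a u v; rewrite l1 l2 scalerDr scalerDr !scalerA [c * a]mulrC.
by rewrite addrACA.
Qed.

Lemma linear_compose (W W' W'' : lmodType F) (D1 : W' -> W'') (D2 : W -> W') :
  linear D1 -> linear D2 -> linear (fun u => D1 (D2 u)).
Proof. by move=> l1 l2 a u v; rewrite l2 l1. Qed.

Lemma left_op_lin k (T T1 T2 : {linear sv k -> sv k}) c :
  (forall x, T x = c *: T1 x + T2 x) ->
  forall u, left_op T u = c *: left_op T1 u + left_op T2 u.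
Proof.
move=> h; apply: eq_linear_simple; first exact: left_op_linear.
  by apply: linear_comb; exact: left_op_linear.
move=> s a; rewrite !left_op_simple // /left_act.
by case: (left_split k s) => z t; rewrite h left_join_linear.
Qed.

Lemma left_op_comp k (T T1 T2 : {linear sv k -> sv k}) :
  (forall x, T x = T1 (T2 x)) -> forall u, left_op T u = left_op T1 (left_op T2 u).
Proof.
move=> h; apply: eq_linear_simple; first exact: left_op_linear.
  by apply: linear_compose; exact: left_op_linear.
move=> s a; have [a1 a2 a3 _] := left_splitP k a.
rewrite !left_op_simple // /left_act; case: (left_split k s) a1 a2 a3 => z t /= a1 a2 a3.
by rewrite left_op_join // h.
Qed.

Lemma left_op_id k (T : {linear sv k -> sv k}) : T =1 id -> left_op T =1 id.
Proof.
move=> h; apply: eq_linear_simple => // [|s a]; first exact: left_op_linear.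
have [_ _ _ e] := left_splitP k a; rewrite left_op_simple // -[RHS]e /left_act.
by case: (left_split k s) => z t; rewrite h.
Qed.

Lemma alternating_rcons s u : alternating (rcons s u) =
  alternating s && (if s is _ :: _ then tag (last u s) != tag u else true).
Proof. by case: s => [|v s] //=; rewrite /alternating /= rcons_path. Qed.

Lemma right_splitP k s : alternating s ->
  let t := (right_split k s).1 in
  [/\ alternating t, forall x : V k, alternating (rcons t (Tagged V x)), right_split k t = (t, (1, 0))
    & \pi_FP (right_join t (right_split k s).2) = \pi_FP (simple s) :> FP].
Proof.
case/lastP: s => [|t u] a.
  split=> //; rewrite /right_join /= scale1r (fp_piD (simple [::])) -[[:: _]]cat0s pi_simple0.
  exact: addr0.
rewrite right_split_rcons; have [e|ne] := eqVneq (tag u) k; last first.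
  split=> //=; first by move=> x; rewrite alternating_rcons a last_rcons; case: (t).
    by rewrite right_split_rcons (negbTE ne).
  rewrite /right_join /= scale1r (fp_piD (simple (rcons t u))) -(cats1 (rcons t u)) pi_simple0.
  exact: addr0.
case: u e a => k' x /= e; subst k'; rewrite tagged_asE => a.
have [ht hl] := andP (etrans (esym (alternating_rcons _ _)) a).
split=> //=.
- by move=> y; move: a; rewrite !alternating_rcons; case: (t).
- case/lastP: t a {ht} hl => [//|t v] _; rewrite last_rcons right_split_rcons => h.
  by rewrite ifN //; case: t h.
- by rewrite /right_join /= scale0r add0r.
Qed.

Lemma right_op_join k (T : {linear sv k -> sv k}) (z : sv k) t :
  alternating t -> (forall x : V k, alternating (rcons t (Tagged V x))) -> right_split k t = (t, (1, 0)) ->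
  right_op T (\pi_FP (right_join t z)) = \pi_FP (right_join t (T z)).
Proof.
move=> a ax st; case: z => c v; rewrite {1}/right_join /=; move: (c : F) => {}c.
have -> : \pi_FP (c *: simple t + simple (rcons t (Tagged V v))) =
    c *: (\pi_FP (simple t) : FP) + \pi_FP (simple (rcons t (Tagged V v))).
  by rewrite (piZ c (simple t)); exact: fp_piD.
rewrite right_op_linear.
rewrite !right_op_simple // /right_act st right_split_rcons /= eqxx tagged_asE.
rewrite -right_join_linear -linearP; congr (\pi_FP (right_join t (T _))).
by congr (_, _); rewrite /= ?scaler0 ?add0r // addr0; exact: mulr1.
Qed.

Lemma right_op_lin k (T T1 T2 : {linear sv k -> sv k}) c :
  (forall x, T x = c *: T1 x + T2 x) ->
  forall u, right_op T u = c *: right_op T1 u + right_op T2 u.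
Proof.
move=> h; apply: eq_linear_simple; first exact: right_op_linear.
  by apply: linear_comb; exact: right_op_linear.
move=> s a; rewrite !right_op_simple // /right_act.
by case: (right_split k s) => t z; rewrite h right_join_linear.
Qed.

Lemma right_op_comp k (T T1 T2 : {linear sv k -> sv k}) :
  (forall x, T x = T1 (T2 x)) -> forall u, right_op T u = right_op T1 (right_op T2 u).
Proof.
move=> h; apply: eq_linear_simple; first exact: right_op_linear.
  by apply: linear_compose; exact: right_op_linear.
move=> s a; have [a1 a2 a3 _] := right_splitP k a.
rewrite !right_op_simple // /right_act; case: (right_split k s) a1 a2 a3 => t z /= a1 a2 a3.
by rewrite right_op_join // h.
Qed.

Lemma right_op_id k (T : {linear sv k -> sv k}) : T =1 id -> right_op T =1 id.
Proof.
move=> h; apply: eq_linear_simple => // [|s a]; first exact: right_op_linear.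
have [_ _ _ e] := right_splitP k a; rewrite right_op_simple // -[RHS]e /right_act.
by case: (right_split k s) => t z; rewrite h.
Qed.

End Operators.

(** * Bi-freeness *)

Section Sorting.
Context (R : realType) (A : cstarAlgebra R) (phi : {scalar A}).
Context (I J : finType) (X : I -> A) (Y : J -> A).
Local Notation P := (I + J)%type.

Definition isleft : pred P := fun p => if p is inl _ then true else false.
Definition letter_val (p : P) : A := match p with inl i => X i | inr j => Y j end.

Hypothesis bip : tracially_bipartite phi X Y.

Lemma phi_swap u v i j : phi (wprod letter_val (u ++ inl i :: inr j :: v)) =
  phi (wprod letter_val (u ++ inr j :: inl i :: v)).
Proof.
have [_ h _ _] := bip; have := h u v i j; rewrite /wprod !big_cat !big_cons /= !mulrA.
exact.
Qed.

(** Here [t] collects the right letters met so far; the next left letter is moved across all of them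
    by adjacent exchanges. *)
Lemma phi_sort u t w : all (predC isleft) t ->
  phi (wprod letter_val (u ++ t ++ w)) =
  phi (wprod letter_val (u ++ seq.filter isleft w ++ t ++ seq.filter (predC isleft) w)).
Proof.
have move_left i : forall t w u, all (predC isleft) t ->
    phi (wprod letter_val (u ++ t ++ inl i :: w)) = phi (wprod letter_val (u ++ inl i :: t ++ w)).
  elim/last_ind => [//|s p IH] v u'; rewrite all_rcons; case: p => [//|j] /= hs.
  by rewrite cat_rcons catA -phi_swap -catA IH // cat_rcons.
elim: w u t => [|[i|j] w IH] u t ht /=; first by rewrite !cats0.
  by rewrite move_left // -cat_rcons IH // cat_rcons.
by rewrite -cat_rcons IH ?all_rcons // cat_rcons.
Qed.

Lemma phi_hat (tau : seq P -> R[i]) :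
  (forall s t, tau (mword s t) = phiw phi X Y s t) ->
  forall w, phi (wprod letter_val w) = tau (hat isleft w).
Proof.
move=> ht w; rewrite (@phi_sort [::] [::] w) //= .
have [s es] : exists s, seq.filter isleft w = map inl s.
  elim: w => [|[i|j] w [s IH]] /=; first by exists [::].
    by exists (i :: s); rewrite IH.
  by exists s.
have [t et] : exists t, seq.filter (predC isleft) w = map inr t.
  elim: w {es} => [|[i|j] w [t IH]] /=; first by exists [::].
    by exists t.
  by exists (j :: t); rewrite IH.
by rewrite /hat es et -map_rev ht /phiw /wprod big_cat !big_map.
Qed.

End Sorting.

(** * From words in the generators to elements of the generated algebras *)

Section Assembly.
Context (R : realType) (A : cstarAlgebra R) (phi : {scalar A}).
Hypothesis phi1 : phi 1 = 1.
Context (K : choiceType) (P : finType) (isl : pred P) (X : P -> A) (key : P -> K).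
Local Notation V := (fun _ : K => (kerT phi : lmodType R[i])).
Local Notation FP := (free_product V).
Local Notation coefz := (coefz phi1 isl X key).

(** [bi_free] speaks of arbitrary elements of the generated algebras, while moments are computed for
    words in generators. This relation says that words in the generators, applied from the left,
    cannot distinguish b from the vector u. *)
Definition tracks (b : A) (u : FP) := forall z, phi (wprod X z * b) = coefz z u.

Lemma lrep1 (k : K) : lrep phi1 k 1 =1 id.
Proof. by have [] := lrep_hom phi1 k setT. Qed.

Lemma lrepP (k : K) c a b x : lrep phi1 k (c *: a + b) x = c *: lrep phi1 k a x + lrep phi1 k b x.
Proof. by have [_ h _] := lrep_hom phi1 k setT; exact: h. Qed.

Lemma lrepM (k : K) a b x : lrep phi1 k (a * b) x = lrep phi1 k a (lrep phi1 k b x).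
Proof. by have [_ _ h] := lrep_hom phi1 k setT; exact: h. Qed.

(** The elements a that preserve [tracks] for all b and u form a unital subalgebra: quantifying over
    b and u gives closure under products. It contains the generators, because a generator can be
    absorbed into the testing word z. *)
Lemma tracks_gen (D : A -> FP -> FP) (S : set A) :
  D 1 =1 id -> (forall c a b u, D (c *: a + b) u = c *: D a u + D b u) ->
  (forall a b u, D (a * b) u = D a (D b u)) ->
  (forall a, S a -> exists p, a = X p /\ forall u, D a u = actl phi1 isl X key p u) ->
  forall a b u, gen_algebra S a -> tracks b u -> tracks (a * b) (D a u).
Proof.
move=> D1 DP DM DS a b u ga.
have : [set a | forall b u, tracks b u -> tracks (a * b) (D a u)] a; last exact.
apply: smallest_sub ga => [|{}a /DS[p [-> Dp]] /= {}b {}u h z]; last first.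
  by rewrite Dp mulrA -[_ * X p](_ : wprod X (rcons z p) = _) ?h /coefz ?foldr_rcons // /wprod -cats1 big_cat big_seq1.
split=> /= [{}b {}u|c a1 a2 h1 h2 {}b {}u h z|a1 a2 h1 h2 {}b {}u h].
- by rewrite mul1r D1.
- by rewrite DP coefz_linear -(h1 _ _ h z) -(h2 _ _ h z) mulrDl mulrDr linearD -scalerAl -scalerAr linearZ.
- by rewrite DM -mulrA; apply: (h1); exact: h2.
Qed.

End Assembly.

Theorem corollary6p2 (R : realType) (A : cstarAlgebra R) (phi : {scalar A})
    (l : nat) (n m : 'I_l -> nat)
    (X : forall k, 'I_(n k) -> A) (Y : forall k, 'I_(m k) -> A)
    (phi_state : is_state phi)
    (nm_gt0 : forall k, (1 <= n k + m k)%N)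
    (X_sa : forall k i, star (X k i) = X k i)
    (Y_sa : forall k j, star (Y k j) = Y k j)
    (chi_fin : forall k, (-oo < chi phi (X k) (Y k))%E)
    (bipartite : tracially_bipartite phi (joint_family X) (joint_family Y))
    (chi_add : chi phi (joint_family X) (joint_family Y) =
               (\sum_(k < l) chi phi (X k) (Y k))%E) :
  bi_free phi (fun k => gen_algebra (range (X k)))
              (fun k => gen_algebra (range (Y k))).
Proof.
have [phi1 _] := phi_state.
have [tau [tau1 tauC tauS tau_phi]] := exists_sd_trace phi1 chi_fin chi_add.
have tau_hat := phi_hat bipartite tau_phi.
exists (fun _ => kerT phi), (@lrep _ _ _ phi1 'I_l), (@lrep _ _ _ phi1 'I_l).
split=> [k|k|w hw]; [exact: lrep_hom|exact: lrep_hom|].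
set F := fp_coef _; set W := letter_val (joint_family X) (joint_family Y).
set isl := @isleft {k : 'I_l & 'I_(n k)} {k : 'I_l & 'I_(m k)}.
have vac := coefz_vacuum phi1 tau1 tauC tauS tau_hat.
(* Testing with the empty word gives the required equality of moments; general test words are needed
   for the induction on w, which starts from [vac]. *)
suff : tracks phi1 isl W (@key l n m)
    (\prod_(z <- w) match z with inl ka => ka.2 | inr ka => ka.2 end)
    (foldr (fun z u => match z with
       | inl ka => left_op (lrep phi1 ka.1 ka.2) u
       | inr ka => right_op (lrep phi1 ka.1 ka.2) u end) (fp_vacuum _) w).
  by move=> /(_ [::]); rewrite /wprod big_nil mul1r.
rewrite {}/F; elim: w hw => [|z w IH] hw.
  by rewrite big_nil => z /=; rewrite mulr1 vac.
rewrite big_cons /=; have {}IH := IH (fun y yw => hw y (mem_behead (s := z :: w) yw)).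
case: z {hw} (hw z (mem_head z w)) => -[k a] /= ga.
- apply: (tracks_gen (D := fun a => left_op (lrep phi1 k a)) _ _ _ _ ga IH).
  + by apply: left_op_id; exact: lrep1.
  + by move=> c b b' u; apply: left_op_lin => x; exact: lrepP.
  + by move=> b b' u; apply: left_op_comp => x; exact: lrepM.
  + by move=> _ [i _ <-]; exists (inl (Tagged (fun k => 'I_(n k)) i)).
- apply: (tracks_gen (D := fun a => right_op (lrep phi1 k a)) _ _ _ _ ga IH).
  + by apply: right_op_id; exact: lrep1.
  + by move=> c b b' u; apply: right_op_lin => x; exact: lrepP.
  + by move=> b b' u; apply: right_op_comp => x; exact: lrepM.
  + by move=> _ [j _ <-]; exists (inr (Tagged (fun k => 'I_(m k)) j)).
Qed.
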